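(* Let $q\in(0,\infty)$ and let $Z$ be a standard normal random variable. (1) Let $n\ge 4$, let $w\in B_n$ be Mallows distributed with parameter $q$, and let $\mu$ and $\sigma^2$ be the mean and variance of $\mathrm{des}(w)+\mathrm{des}(w^{-1})$. Then $$d_W\!\left(\frac{\mathrm{des}(w)+\mathrm{des}(w^{-1})-\mu}{\sigma},Z\right)\le\left(180+236\max(q^{-1/2},q^{1/2})\right)n^{-1/2}.$$ (2) Let $n\ge 30$, let $w\in D_n$ be Mallows distributed with parameter $q$, and let $\mu$ and $\sigma^2$ be the mean and variance of $\mathrm{des}(w)+\mathrm{des}(w^{-1})$. Then $$d_W\!\left(\frac{\mathrm{des}(w)+\mathrm{des}(w^{-1})-\mu}{\sigma},Z\right)\le\left(384+666\max(q^{-1/2},q^{1/2})\right)n^{-1/2}.$$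
   Context: $[\pm n]=\{-n,\dots,-1,1,\dots,n\}$. $B_n$ is the group of bijections $w$ of $[\pm n]$ with $w(-i)=-w(i)$ for all $i$; $D_n$ is the subgroup of those $w$ that send an even number of positive integers to negative integers. Both are Coxeter groups with generators $s_0,s_1,\dots,s_{n-1}$, where $s_i=(i\ \ i+1)(-i\ \ -i-1)$ for $1\le i\le n-1$, and $s_0=(-1\ \ 1)$ for $B_n$, while $s_0=(-1\ \ 2)(-2\ \ 1)$ for $D_n$. The length $\ell(w)$ (in the group considered) is the minimal number of generators in a product equal to $w$; $w$ has a descent at $s_i$ if $\ell(ws_i)<\ell(w)$; and $\mathrm{des}(w)$ is the number of generators at which $w$ has a descent. The Mallows distribution with parameter $q$ on a finite Coxeter group $W$ is $\mu_q^W(w)=q^{\ell(w)}/\sum_{v\in W}q^{\ell(v)}$. The Wasserstein $1$-distance between real random variables $A,B$ is $d_W(A,B)=\inf_{(A',B')}\mathbb{E}|A'-B'|$, the infimum being over all couplings $(A',B')$ of $A$ and $B$. *)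

(* Defs.v *)
From HB Require Import structures.
From mathcomp Require Import all_boot all_order all_algebra all_fingroup.
From mathcomp Require Import all_classical all_reals all_analysis.

Set Implicit Arguments.
Unset Strict Implicit.
Unset Printing Implicit Defensive.

Import Order.TTheory GRing.Theory Num.Theory.
Import numFieldNormedType.Exports.

Local Open Scope ring_scope.

(* The point (i, b) of [±n] is the integer i + 1 if b = false and -(i + 1) if
   b = true: the index i : 'I_n is the absolute value, shifted by one. *)
Definition signed (n : nat) : finType := ('I_n * bool)%type.

Definition sopp (n : nat) (x : signed n) : signed n := (x.1, ~~ x.2).

Definition Bn (n : nat) : {set {perm signed n}} :=
  [set w : {perm signed n} | [forall x, w (sopp x) == sopp (w x)]].

Definition Dn (n : nat) : {set {perm signed n}} :=
  [set w in Bn n | ~~ odd #|[set i : 'I_n | (w (i, false)).2]|].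

(* Generators are indexed by 'I_n.  For i > 0 the integers i and i + 1 have
   indices ord_pred i and i; for i = 0 the integers 1 and 2 have indices i and
   ordS i. *)
Definition sgenA (n : nat) (i : 'I_n) : {perm signed n} :=
  (tperm (ord_pred i, false) (i, false) *
   tperm (ord_pred i, true) (i, true))%g.

Definition sgenB (n : nat) (i : 'I_n) : {perm signed n} :=
  if i == 0%N :> nat then tperm (i, true) (i, false) else sgenA i.

Definition sgenD (n : nat) (i : 'I_n) : {perm signed n} :=
  if i == 0%N :> nat then
    (tperm (i, true) (ordS i, false) * tperm (ordS i, true) (i, false))%g
  else sgenA i.

Section Coxeter.
Context {T : finType} {I : finType} (s : I -> {perm T}).
Local Open Scope nat_scope.

Definition has_word (w : {perm T}) (k : nat) : bool :=
  [exists t : k.-tuple I, w == (\prod_(i <- t) s i)%g].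

(* The value 0 for a w outside the group generated by s is irrelevant. *)
Definition length (w : {perm T}) : nat :=
  if pselect (exists k, has_word w k) is left ex then ex_minn ex else 0.

(* In {perm T}, (u * v)%g x = v (u x), so the composite w s_i, which applies
   s_i first, is (s i * w)%g. *)
Definition des (w : {perm T}) : nat :=
  #|[set i : I | length (s i * w)%g < length w]|.

End Coxeter.

Definition mallows {R : realType} {T I : finType} (W : {set {perm T}})
    (s : I -> {perm T}) (q : R) (w : {perm T}) : R :=
  if w \in W then q ^+ length s w / \sum_(v in W) q ^+ length s v else 0.

Local Open Scope classical_set_scope.

Definition mallows_distributed {R : realType} {T I : finType}
    (W : {set {perm T}}) (s : I -> {perm T}) (q : R)
    {d : measure_display} {Omega : measurableType d}
    (P : probability Omega R) (w : Omega -> {perm T}) : Prop :=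
  forall v : {perm T},
    measurable (w @^-1` [set v]) /\
    P (w @^-1` [set v]) = (mallows W s q v)%:E.

Definition two_sided_des {R : realType} {T I : finType} (s : I -> {perm T})
    (w : {perm T}) : R := (des s w + des s (w^-1)%g)%:R.

Definition standardize {R : realType}
    {d : measure_display} {Omega : measurableType d}
    (P : probability Omega R) (X : Omega -> R) : Omega -> R :=
  fun t => (X t - fine 'E_P[X]%E) / Num.sqrt (fine 'V_P[X]%E).

Definition same_law {R : realType}
    {d1 : measure_display} {Omega1 : measurableType d1}
    (P1 : probability Omega1 R) (X1 : Omega1 -> R)
    {d2 : measure_display} {Omega2 : measurableType d2}
    (P2 : probability Omega2 R) (X2 : Omega2 -> R) : Prop :=
  forall U : set R, measurable U -> P1 (X1 @^-1` U) = P2 (X2 @^-1` U).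

Definition wasserstein1 {R : realType}
    {d1 : measure_display} {Omega1 : measurableType d1}
    (P1 : probability Omega1 R) (A : Omega1 -> R)
    {d2 : measure_display} {Omega2 : measurableType d2}
    (P2 : probability Omega2 R) (B : Omega2 -> R) : \bar R :=
  ereal_inf [set e : \bar R |
    exists (d : measure_display) (Omega : measurableType d)
           (P : probability Omega R) (A' B' : {RV P >-> R}),
      [/\ same_law P A' P1 A, same_law P B' P2 B &
          e = 'E_P[(fun t => `|A' t - B' t|)%R]%E] ].

Definition standard_normal {R : realType}
    {d : measure_display} {Omega : measurableType d}
    (P : probability Omega R) (Z : {RV P >-> R}) : Prop :=
  forall U : set R, measurable U -> P (Z @^-1` U) = normal_prob 0 1 U.

(* Main.v *)
(* Stein's method with a discrete Stein kernel.  Write des(w) + des(w^-1) as the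
   sum of the 2n indicators I_j of the right and left descents.  Toggling a
   descent, w -> w s_i or w -> s_i w, multiplies the Mallows weight by q or 1/q,
   so that E[(I_j - q/(1+q)) F] = q/(1+q)^2 E[F(w_j^+) - F(w_j^-)], where w_j^+
   and w_j^- are the two elements of the pair having, resp. not having, the j-th
   descent.  With D_j = X(w_j^+) - X(w_j^-) this gives Var X = q/(1+q)^2 E[sum_j D_j]
   and, since |D_j| <= 2, Stein's equation bounds the distance to the normal law
   by the relative fluctuations of the kernel K = sum_j D_j plus O(n^{-1/2}): the
   monotone coupling z -> T z of the two laws costs E[h(T z) - h(z)] for the
   1-Lipschitz h whose slope at u is the sign of T u - u, and after smoothing h is
   the test function of a Stein equation with a Lipschitz derivative.

   One finds K(w) = H(w) + H(w^-1), H = n - C + N + O(1), where C counts the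
   consecutive generators at which w has exactly one descent and N counts the
   adjacent positions of w carrying adjacent values of equal sign.  Flips show that
   the terms of C have mean 2q/(1+q+q^2) <= 2/3 and are uncorrelated at distance
   at least 3, so that E K is of order n and Var C = O(n).  For N, build w by
   inserting the letters 1, ..., n in this order at independent positions: with
   nonincreasing weights S on the positions, the conditional mean of the weighted
   count after one more insertion is again such a weighted count, and an insertion
   changes it by O(1); hence Var N = O(n).  In type D the law of N is read off from
   the type B group with the weight of the number of signs removed. *)
Require Import Defs.
From HB Require Import structures.
From mathcomp Require Import all_boot all_order all_algebra all_fingroup.
From mathcomp Require Import all_classical all_reals all_analysis.
From mathcomp Require Import measurable_realfun zify ring lra.

Set Implicit Arguments.
Unset Strict Implicit.
Unset Printing Implicit Defensive.

Import Order.TTheory GRing.Theory Num.Theory.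
Import numFieldNormedType.Exports.

Local Open Scope ring_scope.

(** * Gaussian integrals, the Stein equation and the quantile coupling *)

(** The bounds on the kernel K are uniform in q. The parameter enters the rate only through the
    variance q/(1+q)^2 E K, whose square root divides the Taylor remainder of Stein's equation; with
    M the larger of q^(-1/2) and q^(1/2), sqrt(q)/(1+q) is at least 1/(2M).

    The irregular bonds at s_0 cost an additive constant, so that E K >= 2n/3 - 10. This is at least
    n/3 once n >= 30 and at least 3n/5 once n >= 150; below 150 the claim for type B is weaker than
    the trivial bound 2.

    Nonincreasing weights S serve the variance of N as follows: an insertion shifts the weights of
    the later pairs by one place, and the total change telescopes only if S is monotone. Averaging
    over the insertion place keeps S monotone because, for every q, places further right are
    likelier once both signs are added up. The pair in the first two positions is left out of N,
    which makes N blind to the sign of the first letter; that is what carries the estimate from type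
    B to type D. *)

Section Gaussian.
Local Open Scope classical_set_scope.
Local Open Scope ring_scope.
Context {R : realType}.
Local Notation mu := (@lebesgue_measure R).
Local Notation gam := (@normal_prob R 0 1).
Local Notation phi := (@normal_pdf R 0 1).

Lemma gauss_pdfE x : phi x = normal_peak 1 * expR (- (x ^+ 2 / 2)).
Proof.
by rewrite normal_pdfE ?oner_eq0// /normal_fun subr0 expr1n mulNr.
Qed.

Lemma gauss_pdf_gt0 x : 0 < phi x.
Proof. by rewrite gauss_pdfE mulr_gt0 ?expR_gt0// normal_peak_gt0 ?oner_eq0. Qed.

Lemma is_derive_gauss_pdf (x : R) : is_derive x (1 : R) phi (- x * phi x).
Proof.
have -> : phi = (fun x => normal_peak 1 * expR (- (x ^+ 2 / 2))).
  by apply/funext => y; rewrite gauss_pdfE.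
apply: is_derive_eq.
rewrite /= /GRing.scale/= /GRing.scale/=. by field.
Qed.

Lemma gauss_pdf_continuous : continuous phi.
Proof. by apply: continuous_normal_pdf; rewrite oner_eq0. Qed.


(** The Radon-Nikodym derivative of the normal law agrees almost everywhere with [phi], because both
    have the same integral over every measurable set. *)
Lemma integral_gauss (f : R -> R) E : measurable E -> measurable_fun E f ->
  (forall x, 0 <= f x) ->
  (\int[gam]_(x in E) (f x)%:E = \int[mu]_(x in E) (f x * phi x)%:E)%E.
Proof.
move=> mE mf f0.
have dom := @normal_prob_dominates R 0 1.
have mphi A : measurable_fun A phi.
  by apply: measurable_funTS; exact: measurable_normal_pdf.
rewrite -(@Radon_Nikodym_SigmaFinite.change_of_variables _ _ _ gam mu dom (EFin \o f))//; last first.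
  exact/measurable_EFinP.
have mg : measurable_fun E (Radon_Nikodym_SigmaFinite.f gam mu).
  apply: measurable_funTS; apply: (measurable_int mu).
  exact: Radon_Nikodym_SigmaFinite.f_integrable.
apply: ae_eq_integral => //.
- by apply: emeasurable_funM => //; exact/measurable_EFinP.
- by apply/measurable_EFinP; apply: measurable_funM; [exact: mf|exact: mphi].
suff ae1 : ae_eq mu E (Radon_Nikodym_SigmaFinite.f gam mu) (EFin \o phi).
  by apply: filterS ae1 => x /= fx Ex; rewrite EFinM -fx.
apply: integral_ae_eq => //=.
- apply: (@integrableS _ _ _ mu setT) => //.
  exact: Radon_Nikodym_SigmaFinite.f_integrable.
- by apply/measurable_EFinP; exact: mphi.
- move=> A AE mA.
  by rewrite -Radon_Nikodym_SigmaFinite.f_integral.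
Qed.

Lemma normal_peak1_le : normal_peak (1 : R) <= 1 / 2.
Proof.
rewrite /normal_peak expr1n mul1r.
have pi2 : 2 <= (pi : R) by exact: pi_ge2.
rewrite -[leRHS]invrK lef_pV2 ?posrE//; last by rewrite sqrtr_gt0; lra.
rewrite -[leLHS]ger0_norm// -sqrtr_sqr ler_sqrt; lra.
Qed.

(** This rational bound, from e^t >= 1 + t, suffices for every tail estimate below. *)
Lemma gauss_pdf_le x : phi x <= (2 + x ^+ 2)^-1.
Proof.
rewrite gauss_pdfE expRN.
have e : 1 + x ^+ 2 / 2 <= expR (x ^+ 2 / 2) by exact: expR_ge1Dx.
have x2 : 0 <= x ^+ 2 by exact: sqr_ge0.
have -> : (2 + x ^+ 2)^-1 = 1 / 2 * (1 + x ^+ 2 / 2)^-1 by field; lra.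
apply: ler_pM => //; first exact: normal_peak_ge0.
  exact: normal_peak1_le.
rewrite lef_pV2// posrE; lra.
Qed.

Lemma gauss_pdf_tail (a eps : R) : 0 < eps ->
  exists2 x, a <= x & (2 * `|x| + 1) * phi x < eps.
Proof.
move=> e0; pose x := Num.max a (Num.max 1 (4 / eps)).
exists x; first by rewrite /x le_max lexx.
have x1 : 1 <= x by rewrite /x !le_max lexx !orbT.
have xe : 4 / eps <= x by rewrite /x !le_max lexx !orbT.
rewrite ger0_norm; last lra.
have := gauss_pdf_le x.
have p0 := ltW (gauss_pdf_gt0 x).
move: xe; rewrite ler_pdivrMr// => xe.
have h : phi x <= (x ^+ 2)^-1.
  apply: (le_trans (gauss_pdf_le x)); rewrite lef_pV2 ?posrE; nra.
move=> _; apply: (@le_lt_trans _ _ (3 * x * (x ^+ 2)^-1)).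
  by apply: ler_pM => //; lra.
have -> : 3 * x * (x ^+ 2)^-1 = 3 / x by field; lra.
by rewrite ltr_pdivrMr; nra.
Qed.

Lemma gauss_pdf_cvgy : phi x @[x --> +oo] --> (0 : R).
Proof.
apply/cvgr0Pnorm_lt => e e0; near=> x.
have p0 := gauss_pdf_gt0 x.
rewrite gtr0_norm//.
have x1 : 1 <= x by near: x; exact: nbhs_pinfty_ge.
have xe : 1 / e <= x by near: x; apply: nbhs_pinfty_ge; exact: num_real.
apply: (le_lt_trans (gauss_pdf_le x)).
move: xe; rewrite ler_pdivrMr// => xe.
rewrite invf_plt ?posrE//; last by rewrite addr_gt0// exprn_gt0//; lra.
have -> : e^-1 = (e^-1 * 1) by rewrite mulr1.
rewrite ltr_pdivrMl//; nra.
Unshelve. all: by end_near. Qed.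

Lemma gauss_half_moment :
  (\int[mu]_(x in `[0%R, +oo[) (x * phi x)%:E = (phi 0)%:E)%E.
Proof.
rewrite (@ge0_continuous_FTC2y _ _ (fun x => - phi x) 0 0).
- by rewrite sub0e -EFinN opprK.
- by move=> x x0; rewrite mulr_ge0// ltW// gauss_pdf_gt0.
- apply: continuous_subspaceT => x.
  by apply: cvgM; [exact: cvg_id|exact: gauss_pdf_continuous].
- rewrite -[X in _ --> X]oppr0; apply: (@cvgN R R^o); exact: gauss_pdf_cvgy.
- move=> x _; have dphi := is_derive_gauss_pdf x.
  exact: ex_derive.
- apply: cvg_at_right_filter; apply: (@cvgN R R^o); exact: gauss_pdf_continuous.
- move=> x _; have dphi := is_derive_gauss_pdf x.
  rewrite derive1E derive_val; lra.
Qed.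

Lemma gauss_abs_moment : (\int[mu]_x (`|x| * phi x)%:E = (2 * phi 0)%:E)%E.
Proof.
rewrite (@ge0_symfun_integralT _ (fun x => `|x| * phi x)).
- rewrite EFinM -gauss_half_moment -set_itvcy; congr (_ * _)%E.
  apply: eq_integral => x; rewrite inE/= in_itv/= andbT => x0.
  by rewrite ger0_norm.
- by move=> x; rewrite mulr_ge0// ltW// gauss_pdf_gt0.
- move=> x; apply: cvgM; first exact: (@norm_continuous R R^o).
  exact: gauss_pdf_continuous.
- by move=> x /=; rewrite normrN !gauss_pdfE sqrrN.
Qed.

Lemma gauss_pdf0_le : 2 * phi 0 <= 1.
Proof.
rewrite gauss_pdfE expr0n/= mul0r oppr0 expR0 mulr1.
by have := normal_peak1_le; lra.
Qed.

Lemma integrable_gauss (g : R -> R) (a b : R) E : measurable E ->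
  measurable_fun setT g -> (forall x, `|g x| <= a * `|x| + b) ->
  mu.-integrable E (EFin \o (fun x => g x * phi x)).
Proof.
move=> mE mg gab.
have mphi : measurable_fun setT phi by exact: measurable_normal_pdf.
apply: (@integrableS _ _ _ mu setT) => //.
have i1 : mu.-integrable setT (EFin \o (fun x => `|x| * phi x)).
  apply/integrableP; split.
    apply/measurable_EFinP; exact: measurable_funM.
  under eq_integral => x _ do
    rewrite /= ger0_norm ?mulr_ge0 ?normr_ge0 ?(ltW (gauss_pdf_gt0 _))//.
  by rewrite gauss_abs_moment ltry.
have i2 : mu.-integrable setT (EFin \o phi).
  by apply: integrable_normal_pdf.
have i3 : mu.-integrable setT
    ((fun x => a%:E * (EFin \o (fun x => (`|x| * phi x)%R)) x) \+
     (fun x => b%:E * (EFin \o phi) x))%E.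
  by apply: integrableD => //; apply: integrableZl.
apply: le_integrable i3 => //.
  by apply/measurable_EFinP; apply: measurable_funM.
move=> x _ /=; rewrite lee_fin.
have p0 := ltW (gauss_pdf_gt0 x).
rewrite normrM (ger0_norm p0) mulrA -mulrDl normrM (ger0_norm p0).
by rewrite ler_wpM2r// (le_trans (gab x))// ler_norm.
Qed.

Lemma is_derive_gauss_int (g : R -> R) (a b : R) : continuous g ->
  (forall x, `|g x| <= a * `|x| + b) ->
  forall x : R, is_derive x (1 : R)
    (fun y => \int[mu]_(t in `]-oo, y]) (g t * phi t)) (g x * phi x).
Proof.
move=> cg gab x.
have mg : measurable_fun setT g by exact: continuous_measurable_fun.
have [||||d1 d2] := @continuous_FTC1 R (fun t => g t * phi t) -oo%O x (x + 1).
- by rewrite ltrDl.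
- by apply: (@integrable_gauss g a b).
- exact: ltNyr.
- by apply: cvgM; [exact: cg|exact: gauss_pdf_continuous].
by apply: DeriveDef; [exact: d1|rewrite -d2 derive1E].
Qed.

Lemma Rintegral_gauss_split (g : R -> R) (a b : R) x : measurable_fun setT g ->
  (forall x, `|g x| <= a * `|x| + b) ->
  \int[mu]_(t in setT) (g t * phi t) =
  \int[mu]_(t in `]-oo, x]) (g t * phi t) + \int[mu]_(t in `]x, +oo[) (g t * phi t).
Proof.
move=> mg gab.
have := @Rintegral_itvB R (fun t => g t * phi t) -oo%O +oo%O x.
rewrite set_itvNyy => <-//; first by rewrite addrC subrK.
exact: (@integrable_gauss g a b).
Qed.

Lemma gauss_moment_right0 : \int[mu]_(t in `]0, +oo[) (t * phi t) = phi 0.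
Proof.
rewrite Rintegral_itv_obnd_cbnd.
  by rewrite /Rintegral gauss_half_moment.
apply: (@integrable_gauss id 1 0) => // x; lra.
Qed.

(** Obtained by subtracting the right half from the absolute moment. *)
Lemma gauss_moment_left0 : \int[mu]_(t in `]-oo, 0]) (t * phi t) = - phi 0.
Proof.
have := @Rintegral_gauss_split (fun x => `|x|) 1 0 0 (@normr_measurable _ _).
have e1 : \int[mu]_(t in setT) (`|t| * phi t) = 2 * phi 0.
  by rewrite /Rintegral gauss_abs_moment.
have e2 : \int[mu]_(t in `]0, +oo[) (`|t| * phi t) = phi 0.
  rewrite -gauss_moment_right0; apply: eq_Rintegral => t.
  by rewrite inE/= in_itv/= andbT => t0; rewrite gtr0_norm.
have e3 : \int[mu]_(t in `]-oo, 0]) (`|t| * phi t) =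
    \int[mu]_(t in `]-oo, 0]) ((-1) * (t * phi t)).
  apply: eq_Rintegral => t; rewrite inE/= in_itv/= => t0.
  by rewrite ler0_norm//; lra.
rewrite e1 e2 e3 RintegralZl//; last first.
  by apply: (@integrable_gauss id 1 0) => // x; lra.
have h0 : forall x : R, `| `|x| | <= 1 * `|x| + 0 by move=> x; rewrite normr_id; lra.
move=> /(_ h0); lra.
Qed.

Lemma gauss_moment_left x : \int[mu]_(t in `]-oo, x]) (t * phi t) = - phi x.
Proof.
have dP : forall y : R, is_derive y (1 : R)
    ((fun y => \int[mu]_(t in `]-oo, y]) (t * phi t)) + phi) 0.
  move=> y; have d1 := is_derive_gauss_pdf y.
  have d2 : is_derive y (1 : R) (fun y => \int[mu]_(t in `]-oo, y]) (t * phi t))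
      (y * phi y).
    apply: (@is_derive_gauss_int id 1 0) => [z|z]; [exact: cvg_id|lra].
  by apply: is_derive_eq; lra.
have e : \int[mu]_(t in `]-oo, x]) (t * phi t) + phi x =
    \int[mu]_(t in `]-oo, 0]) (t * phi t) + phi 0.
  exact: (@is_derive_0_is_cst R _ x 0 dP).
by move: e; rewrite gauss_moment_left0; lra.
Qed.

Lemma gauss_moment_right x : \int[mu]_(t in `]x, +oo[) (t * phi t) = phi x.
Proof.
have idb (y : R) : `|y| <= 1 * `|y| + 0 by lra.
have mid : measurable_fun setT (@id R) by exact: measurable_id.
have := Rintegral_gauss_split 0 mid idb.
rewrite (Rintegral_gauss_split x mid idb) !gauss_moment_left gauss_moment_right0.
lra.
Qed.

Lemma gauss_total : \int[mu]_(t in setT) phi t = 1.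
Proof. by rewrite /Rintegral integral_normal_pdf. Qed.

(** * The Stein equation and bounds on its solution *)

Section stein_primitive.
Variables (h : R -> R).
Hypothesis hlip : forall x y, x <= y -> `|h y - h x| <= y - x.
Hypothesis hcont : continuous h.
Let c := \int[mu]_(t in setT) (h t * phi t).

Lemma lip_growth x : `|h x| <= 1 * `|x| + `|h 0|.
Proof.
have : `|h x - h 0| <= `|x|.
  have [x0|/ltW x0] := leP 0 x.
    by have := hlip x0; rewrite subr0 (ger0_norm x0).
  by have := hlip x0; rewrite distrC sub0r (ler0_norm x0).
have := ler_normD (h x - h 0) (h 0); rewrite subrK; lra.
Qed.

Lemma lip_centered_growth x : `|h x - c| <= 1 * `|x| + (`|h 0| + `|c|).
Proof. by have := lip_growth x; have := ler_normB (h x) c; lra. Qed.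

Let mh : measurable_fun setT h. Proof. exact: continuous_measurable_fun. Qed.
Let mhc : measurable_fun setT (fun x => h x - c).
Proof. by apply: measurable_funB. Qed.

Lemma lip_centered_total : \int[mu]_(t in setT) ((h t - c) * phi t) = 0.
Proof.
under eq_Rintegral => t _ do rewrite mulrBl.
rewrite RintegralB//; first last.
- have := @integrable_gauss (fun=> c) 0 `|c| setT.
  by apply=> // x; lra.
- by apply: (@integrable_gauss h 1 `|h 0|) => //; exact: lip_growth.
rewrite RintegralZl//; last by apply: integrable_normal_pdf.
by rewrite gauss_total mulr1 subrr.
Qed.

(* [h + id] is nondecreasing, so on one side of [x] the function [h - c] is
   dominated by [-id], whose primitive is the Gaussian density itself. *)
Lemma stein_primitive_le x :
  \int[mu]_(t in `]-oo, x]) ((h t - c) * phi t) <= phi x.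
Proof.
have ic E : measurable E -> mu.-integrable E (EFin \o (fun t => (h t - c) * phi t)).
  by move=> mE; apply: integrable_gauss => //; exact: lip_centered_growth.
have ii E : measurable E -> mu.-integrable E (EFin \o (fun t => - 1 * (t * phi t))).
  move=> mE; under eq_fun do rewrite mulrA.
  by apply: (@integrable_gauss (fun t => - 1 * t) 1 0) => // [|t];
    [exact: measurable_funM|rewrite normrM normrN1; lra].
have i1 E : measurable E -> mu.-integrable E (EFin \o (fun t => t * phi t)).
  by move=> mE; apply: (@integrable_gauss id 1 0) => // t; lra.
have mono s t : s <= t -> h s + s <= h t + t.
  by move=> st; have := hlip st; rewrite ler_norml; lra.
have p0 t : 0 <= phi t by exact/ltW/gauss_pdf_gt0.
have [hx|/ltW hx] := leP (h x + x) c.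
  have <- : \int[mu]_(t in `]-oo, x]) (- 1 * (t * phi t)) = phi x.
    by rewrite RintegralZl//; [rewrite gauss_moment_left; lra|exact: i1].
  apply: le_Rintegral => //; [exact: ic|exact: ii|move=> t].
  rewrite /= in_itv/= => tx; rewrite mulrA ler_wpM2r//.
  by have := mono _ _ tx; lra.
have := Rintegral_gauss_split x mhc lip_centered_growth.
rewrite lip_centered_total => tot.
suff : - phi x <= \int[mu]_(t in `]x, +oo[) ((h t - c) * phi t) by lra.
have <- : \int[mu]_(t in `]x, +oo[) (- 1 * (t * phi t)) = - phi x.
  by rewrite RintegralZl//; [rewrite gauss_moment_right; lra|exact: i1].
apply: le_Rintegral => //; [exact: ii|exact: ic|move=> t].
rewrite /= in_itv/= andbT => /ltW tx; rewrite mulrA ler_wpM2r//.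
by have := mono _ _ tx; lra.
Qed.

End stein_primitive.

Lemma stein_primitive_norm (h : R -> R) :
  (forall x y, x <= y -> `|h y - h x| <= y - x) -> continuous h -> forall x,
  `|\int[mu]_(t in `]-oo, x])
     ((h t - \int[mu]_(t in setT) (h t * phi t)) * phi t)| <= phi x.
Proof.
move=> hlip hcont x; set c := \int[mu]_(t in setT) _.
have mh : measurable_fun setT h by exact: continuous_measurable_fun.
rewrite ler_norml stein_primitive_le// andbT.
have := @stein_primitive_le (fun t => -1 * h t) _ _ x.
have cE : \int[mu]_(t in setT) (-1 * h t * phi t) = - c.
  under eq_Rintegral => t _ do rewrite -mulrA.
  rewrite RintegralZl//; first by rewrite mulN1r.
  by apply: (@integrable_gauss h 1 `|h 0|) => //; exact: lip_growth.
rewrite cE.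
have -> : \int[mu]_(t in `]-oo, x]) ((-1 * h t - - c) * phi t) =
   - \int[mu]_(t in `]-oo, x]) ((h t - c) * phi t).
  transitivity (\int[mu]_(t in `]-oo, x]) (-1 * ((h t - c) * phi t))).
    by apply: eq_Rintegral => t _; lra.
  rewrite RintegralZl//; first by rewrite mulN1r.
  apply: integrable_gauss => //; first exact: measurable_funB.
  exact: lip_centered_growth.
rewrite lerNl; apply.
- by move=> s t st; rewrite -mulrBr normrM normrN1 mul1r hlip.
- by move=> t; apply: cvgM; [exact: cvg_cst|exact: hcont].
Qed.

(** If [v a] were negative, [v] would stay below [v a] to the right of [a], while the lower envelope
    comes arbitrarily close to 0 far out. *)
Lemma gauss_tail_sign (v dv : R -> R) (a : R) :
  (forall x, a <= x -> is_derive x (1 : R) v (dv x)) ->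
  (forall x, a <= x -> dv x <= 0) ->
  (forall x, a <= x -> - ((2 * `|x| + 1) * phi x) <= v x) -> 0 <= v a.
Proof.
move=> dvE dv0 vlb; rewrite leNgt; apply/negP => va.
have [|x ax xv] := @gauss_pdf_tail a (- v a); first lra.
have [||z] := @MVT_segment R v dv a x ax.
- by move=> z; rewrite in_itv/= => /andP[az _]; apply: dvE; exact: ltW.
- apply: derivable_within_continuous => z; rewrite in_itv/= => /andP[az _].
  by have := dvE z az => ?; exact: ex_derive.
rewrite in_itv/= => /andP[az _] vE.
have := vlb x ax; have := dv0 z az.
have : dv z * (x - a) <= 0 by rewrite mulr_le0_ge0 ?subr_ge0 ?dv0.
lra.
Qed.

Lemma is_derive_gauss_quotient (M b y : R) : y + b != 0 ->
  is_derive y (1 : R) (fun y => M * ((y + b)^-1 * phi y))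
    (M * ((y + b)^-1 * (- y * phi y) + - (y + b) ^- 2 * phi y)).
Proof.
move=> yb0; have dphi := is_derive_gauss_pdf y.
apply: is_derive_eq; rewrite /GRing.scale/=; lra.
Qed.

(* The comparison functions [4 phi / (y + 7/5)] and [2 phi / y] decrease at
   least as fast as [2 phi]. *)
Lemma gauss_comparison (u du : R -> R) (x : R) :
  (forall y : R, is_derive y (1 : R) u (du y)) ->
  (forall y, `|du y| <= 2 * phi y) ->
  (forall y, `|u y| <= (2 * `|y| + 1) * phi y) ->
  0 <= x -> u x <= 3 * phi x /\ x * u x <= 2 * phi x.
Proof.
move=> uE du2 ulb x0.
have p0 y : 0 < phi y by exact: gauss_pdf_gt0.
split.
  pose v y := 4 * ((y + 7 / 5)^-1 * phi y) - u y.
  pose dv y := 4 * ((y + 7 / 5)^-1 * (- y * phi y) +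
                    - (y + 7 / 5) ^- 2 * phi y) - du y.
  have yp y : x <= y -> 0 < y + 7 / 5 by lra.
  have vx : 0 <= v x -> u x <= 3 * phi x.
    rewrite /v => ux; apply: (@le_trans _ _ (4 * ((x + 7 / 5)^-1 * phi x))); first lra.
    (* For x >= 0 the factor is at most 4 / (7/5) = 20/7 < 3. *)
    rewrite mulrA ler_wpM2r ?(ltW (p0 _))// -[4 * _]/(4 / _) ler_pdivrMr; lra.
  apply: vx; apply: (@gauss_tail_sign v dv) => y xy.
  - have y0 := yp y xy; have yn0 : y + 7 / 5 != 0 by rewrite gt_eqF.
    have uEy := uE y; have q := @is_derive_gauss_quotient 4 _ _ yn0.
    exact: is_derive_eq.
  - have y0 := yp y xy; have := du2 y; rewrite ler_norml => /andP[d1 _].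
    rewrite /dv; have := p0 y; set w := phi y in d1 * => w0.
    set b := (y + 7 / 5)^-1.
    have -> : (y + 7 / 5) ^- 2 = b ^+ 2 by rewrite /b exprVn.
    have bE : b * (y + 7 / 5) = 1 by rewrite /b mulVf// gt_eqF.
    suff : 0 <= w * (2 * b * y + 2 * b ^+ 2 - 1) by nra.
    apply: mulr_ge0; first exact: ltW.
    (* Homogenizing with b (y + 7/5) = 1 cancels the linear term; the remainder is nonnegative
       because 7/5 is below sqrt 2. *)
    have -> : 2 * b * y + 2 * b ^+ 2 - 1 = b ^+ 2 * (y ^+ 2 + (2 - (7/5) ^+ 2)).
      transitivity (2 * b * y * (b * (y + 7 / 5)) + 2 * b ^+ 2 - (b * (y + 7 / 5)) ^+ 2).
        by rewrite bE; ring.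
      ring.
    by apply: mulr_ge0; [exact: sqr_ge0|have := sqr_ge0 y; lra].
  - rewrite /v; have := ulb y; rewrite ler_norml => /andP[_ u2].
    have : 0 <= 4 * ((y + 7 / 5)^-1 * phi y).
      by rewrite mulr_ge0// mulr_ge0 ?(ltW (p0 _))// invr_ge0 ltW// yp.
    lra.
have [->|xn0] := eqVneq x 0; first by rewrite mul0r mulr_ge0// ltW.
have {x0 xn0} x0 : 0 < x by rewrite lt_neqAle eq_sym xn0.
pose v y := 2 * (y^-1 * phi y) - u y.
pose dv y := 2 * (y^-1 * (- y * phi y) + - y ^- 2 * phi y) - du y.
have vx : 0 <= v x -> x * u x <= 2 * phi x.
  rewrite /v => ux; have : x * u x <= x * (2 * (x^-1 * phi x)).
    by rewrite ler_wpM2l ?(ltW x0)//; lra.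
  by rewrite mulrCA mulVKf// gt_eqF.
apply: vx; apply: (@gauss_tail_sign v dv) => y xy.
- have y0 : 0 < y by lra. have yn0 : y != 0 by rewrite gt_eqF.
  have q : is_derive y (1 : R) (fun y => 2 * (y^-1 * phi y))
      (2 * (y^-1 * (- y * phi y) + - y ^- 2 * phi y)).
    have := @is_derive_gauss_quotient 2 0 y; rewrite addr0.
    by under eq_fun do rewrite addr0; apply.
  by have uEy := uE y; exact: is_derive_eq.
- have y0 : 0 < y by lra. have := du2 y; rewrite ler_norml => /andP[d1 _].
  have -> : dv y = - 2 * phi y - 2 * (y ^- 2 * phi y) - du y.
    by rewrite /dv; field; rewrite gt_eqF.
  have : 0 <= y ^- 2 * phi y.
    by rewrite mulr_ge0 ?(ltW (p0 _))// invr_ge0 sqr_ge0.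
  lra.
- have y0 : 0 < y by lra. rewrite /v; have := ulb y; rewrite ler_norml => /andP[_ u2].
  have : 0 <= y^-1 * phi y by rewrite mulr_ge0 ?(ltW (p0 _))// invr_ge0 ltW.
  lra.
Qed.

(** [phi] is even, so the one-sided comparison applies to u(y), u(-y) and their negatives. *)
Lemma gauss_comparison_norm (u du : R -> R) (x : R) :
  (forall y : R, is_derive y (1 : R) u (du y)) ->
  (forall y, `|du y| <= 2 * phi y) ->
  (forall y, `|u y| <= (2 * `|y| + 1) * phi y) ->
  `|u x| <= 3 * phi x /\ `|x * u x| <= 2 * phi x.
Proof.
move=> uE du2 ulb.
have phiN y : phi (- y) = phi y by rewrite !gauss_pdfE sqrrN.
pose sgn (s : bool) : R := if s then 1 else - 1.
have sN s : `|sgn s| = 1 by case: s; rewrite /sgn ?normr1 ?normrN1.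
have H (s t : bool) y : 0 <= y ->
    sgn s * u (sgn t * y) <= 3 * phi y /\ y * (sgn s * u (sgn t * y)) <= 2 * phi y.
  have phis z : phi (sgn t * z) = phi z by case: t; rewrite /sgn ?mul1r// mulN1r phiN.
  apply: (@gauss_comparison (fun y => sgn s * u (sgn t * y))
    (fun y => sgn s * (sgn t * du (sgn t * y)))) => z.
  - have d1 := uE (sgn t * z).
    have d2 : is_derive z (1 : R) (fun y => sgn t * y) (sgn t).
      by apply: is_derive_eq; rewrite /GRing.scale/= mulr1.
    have := @is_derive1_comp R u (fun y => sgn t * y) z _ _ d1 d2 => d3.
    by apply: is_derive_eq; rewrite /GRing.scale/= mulrA -mulrA (mulrC (du _)).
  - by rewrite !normrM !sN !mul1r (le_trans (du2 _))// phis.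
  - by rewrite !normrM !sN !mul1r (le_trans (ulb _))// phis normrM sN mul1r.
have [x0|/ltW x0] := leP 0 x.
  have [] := H true true x x0; have [] := H false true x x0.
  by rewrite /sgn !mul1r !mulN1r !mulrN !ler_norml; lra.
have x0' : 0 <= - x by lra.
have [] := H true false _ x0'; have [] := H false false _ x0'.
by rewrite /sgn !mul1r !mulN1r !mulrN !opprK !mulNr !phiN !ler_norml; lra.
Qed.

Lemma derive_bound_lip (f df : R -> R) (M : R) :
  (forall x : R, is_derive x (1 : R) f (df x)) -> (forall x, `|df x| <= M) ->
  forall x y, x <= y -> `|f y - f x| <= M * (y - x).
Proof.
move=> fE dM x y xy; have [|z _] := @MVT_segment R f df x y xy.
  apply: derivable_within_continuous => z _.
  exact: ex_derive.
by move=> ->; rewrite normrM (ger0_norm (_ : 0 <= y - x)) ?subr_ge0// ler_wpM2r// subr_ge0.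
Qed.

Lemma derive_continuous (f df : R -> R) :
  (forall x : R, is_derive x (1 : R) f (df x)) -> continuous f.
Proof.
move=> fE x; apply: differentiable_continuous; apply/derivable1_diffP.
by have := fE x => ?; exact: ex_derive.
Qed.

(* Solution of the Stein equation [f' - x f = h - c]. *)
Lemma stein_solution (h h' : R -> R) :
  (forall x : R, is_derive x (1 : R) h (h' x)) -> (forall x, `|h' x| <= 1) ->
  exists f k : R -> R,
  [/\ forall x, k x - x * f x = h x - \int[mu]_(t in setT) (h t * phi t),
      forall x, `|k x| <= 3 &
      forall a b, `|f b - f a - k a * (b - a)| <= 4 * (b - a) ^+ 2].
Proof.
move=> hE h1.
have hcont := derive_continuous hE.
have hlip x y : x <= y -> `|h y - h x| <= y - x.
  by move=> xy; rewrite -[leRHS]mul1r; exact: (derive_bound_lip hE).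
have p0 y : 0 < phi y by exact: gauss_pdf_gt0.
have pn0 y : phi y != 0 by rewrite gt_eqF.
set c := \int[mu]_(t in setT) _.
have mh : measurable_fun setT h by exact: continuous_measurable_fun.
(* Average |h x - h t| <= |x| + |t| over t; the absolute moment of the normal law is at most 1. *)
have hc x : `|h x - c| <= `|x| + 1.
  have ih := @integrable_gauss h 1 `|h 0| setT measurableT mh (lip_growth hlip).
  have ip := @integrable_normal_pdf R 0 1.
  have ixp : mu.-integrable setT (EFin \o (fun t => h x * phi t)).
    by apply: (@integrable_gauss (fun=> h x) 0 `|h x|) => // t; lra.
  have E : h x - c = \int[mu]_(t in setT) (h x * phi t - h t * phi t).
    by rewrite RintegralB// RintegralZl// gauss_total mulr1.
  have id1 : mu.-integrable setT (EFin \o (fun t => `|x| * phi t)).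
    by apply: (@integrable_gauss (fun=> `|x|) 0 `|x|) => // t; rewrite normr_id; lra.
  have id2 : mu.-integrable setT (EFin \o (fun t => `|t| * phi t)).
    by apply: (@integrable_gauss (fun t => `|t|) 1 0) => // t; rewrite normr_id; lra.
  have id : mu.-integrable setT (EFin \o (fun t => `|x| * phi t + `|t| * phi t)).
    exact: (integrableD measurableT id1 id2).
  have ie : mu.-integrable setT (EFin \o (fun t => h x * phi t - h t * phi t)).
    exact: (integrableB measurableT ixp ih).
  rewrite E; apply: (le_trans (le_normr_Rintegral _ ie)) => //.
  apply: (@le_trans _ _ (\int[mu]_(t in setT) (`|x| * phi t + `|t| * phi t))).
    apply: le_Rintegral => //.
      exact: (integrable_abse ie).
    move=> t _; rewrite -mulrBl -mulrDl normrM (gtr0_norm (p0 _)).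
    rewrite ler_wpM2r ?(ltW (p0 _))//.
    have [xt|/ltW tx] := leP x t.
      rewrite distrC (le_trans (hlip _ _ xt))// (le_trans (ler_norm _))//.
      by rewrite (le_trans (ler_normB _ _))// addrC.
    by rewrite (le_trans (hlip _ _ tx))// (le_trans (ler_norm _))// ler_normB.
  rewrite RintegralD// RintegralZl// gauss_total mulr1 lerD2l.
  have -> : \int[mu]_(t in setT) (`|t| * phi t) = 2 * phi 0.
    by rewrite /Rintegral gauss_abs_moment.
  exact: gauss_pdf0_le.
pose G x := \int[mu]_(t in `]-oo, x]) ((h t - c) * phi t).
have GE (x : R) : is_derive x (1 : R) G ((h x - c) * phi x).
  apply: (@is_derive_gauss_int (fun t => h t - c) 1 (`|h 0| + `|c|)) => y.
    by apply: cvgB; [exact: hcont|exact: cvg_cst].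
  exact: lip_centered_growth.
have Gphi x : `|G x| <= phi x by exact: stein_primitive_norm.
pose f x := G x * (phi x)^-1.
pose k x := x * f x + (h x - c).
have fE (x : R) : is_derive x (1 : R) f (k x).
  have dG := GE x; have dphi := is_derive_gauss_pdf x; have pnx := pn0 x.
  apply: is_derive_eq; rewrite /k /f /GRing.scale/=; field.
  exact: pn0.
have kE (x : R) : is_derive x (1 : R) k (f x + x * k x + h' x).
  have df := fE x; have dh := hE x.
  apply: is_derive_eq; rewrite /GRing.scale/=; lra.
have f1 x : `|f x| <= 1.
  by rewrite /f normrM normfV (gtr0_norm (p0 x)) ler_pdivrMr// mul1r.
(* The factor [phi] cancels the term x k of k', leaving u' = (f + h') phi, at most 2 phi in absolute
   value. The envelope 2|x| + 1 comes from |x f| <= |x| and [hc]. The comparison then gives |k| <= 3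
   and |x k| <= 2. *)
pose u x := k x * phi x.
have uE (x : R) : is_derive x (1 : R) u ((f x + h' x) * phi x).
  have dk := kE x; have dphi := is_derive_gauss_pdf x.
  apply: is_derive_eq; rewrite /GRing.scale/=; lra.
have [ku kxu] : (forall x, `|u x| <= 3 * phi x) /\ (forall x, `|x * u x| <= 2 * phi x).
  suff H x : `|u x| <= 3 * phi x /\ `|x * u x| <= 2 * phi x.
    by split=> x; have [] := H x.
  apply: (gauss_comparison_norm x uE) => y.
    rewrite normrM (gtr0_norm (p0 y)) ler_wpM2r ?(ltW (p0 _))//.
    by have := ler_normD (f y) (h' y); have := f1 y; have := h1 y; lra.
  rewrite normrM (gtr0_norm (p0 y)) ler_wpM2r ?(ltW (p0 _))// /k.
  have := ler_normD (y * f y) (h y - c); have := hc y.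
  have : `|y * f y| <= `|y| by rewrite normrM ler_piMr.
  lra.
have k3 x : `|k x| <= 3.
  by have := ku x; rewrite normrM (gtr0_norm (p0 x)) ler_pM2r.
have xk2 x : `|x * k x| <= 2.
  by have := kxu x; rewrite mulrA normrM (gtr0_norm (p0 x)) ler_pM2r.
(* 4 = 1 + 2 + 1; it becomes the Lipschitz constant of [k] and the constant of the Taylor
   remainder. *)
have dk4 x : `|f x + x * k x + h' x| <= 4.
  have := ler_normD (f x + x * k x) (h' x); have := ler_normD (f x) (x * k x).
  by have := f1 x; have := xk2 x; have := h1 x; lra.
have klip x y : `|k y - k x| <= 4 * `|y - x|.
  have [xy|/ltW yx] := leP x y.
    by rewrite (ger0_norm (_ : 0 <= y - x)) ?subr_ge0//; exact: (derive_bound_lip kE).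
  rewrite distrC (distrC y) (ger0_norm (_ : 0 <= x - y)) ?subr_ge0//.
  exact: (derive_bound_lip kE).
exists f, k; split=> //.
  by move=> x; rewrite /k; ring.
have taylor a x y : x <= y -> a \in `[x, y] ->
    `|f y - f x - k a * (y - x)| <= 4 * (y - x) ^+ 2.
  move=> xy; rewrite in_itv/= => /andP[xa ay].
  have [|z] := @MVT_segment R f k x y xy.
    by apply: continuous_subspaceT; exact: (derive_continuous fE).
  rewrite in_itv/= => /andP[xz zy] ->.
  rewrite -mulrBl normrM (ger0_norm (_ : 0 <= y - x)) ?subr_ge0// expr2 mulrA.
  rewrite ler_wpM2r ?subr_ge0// (le_trans (klip _ _))// ler_wpM2l//.
  by rewrite ler_norml; lra.
move=> a b; have [ab|/ltW ba] := leP a b.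
  by apply: taylor => //; rewrite in_itv/= lexx.
have -> : (b - a) ^+ 2 = (a - b) ^+ 2 by ring.
have -> : f b - f a - k a * (b - a) = - (f a - f b - k a * (a - b)) by ring.
by rewrite normrN; apply: taylor => //; rewrite in_itv/= lexx ba.
Qed.

(** * An explicit dual potential for a monotone coupling *)

Section monotone_dual.
Variables (T : R -> R) (m : R).
Hypothesis Tmono : forall x y, x <= y -> T x <= T y.
Hypothesis mT : measurable_fun setT T.
Hypothesis Tm : forall x, m <= T x.

Let A := [set u | T u <= u].
(** Finite, since a point u of [A] satisfies m <= T u <= u and so [A] is bounded below. *)
Let g x := fine (mu (`]-oo, x[ `&` A)).

Let mA : measurable A.
Proof.
have -> : A = [set u | 0 <= u - T u].
  by apply/seteqP; split=> u /=; rewrite subr_ge0.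
rewrite -[X in measurable X]setTI; apply: measurable_fun_le => //.
exact: measurable_funB.
Qed.

Let mAi (i : interval R) : measurable ([set` i] `&` A).
Proof. exact: measurableI. Qed.

Let muA_le a b : (mu (`[a, b[ `&` A) <= (Num.max (b - a) 0)%:E)%E.
Proof.
apply: (@le_trans _ _ (mu `[a, b[)).
  by apply: le_measure; [rewrite inE; exact: mAi|rewrite inE|exact: subIsetl].
rewrite lebesgue_measure_itv/= lte_fin; case: ifPn => ab.
  by rewrite -EFinB lee_fin le_max lexx.
by rewrite lee_fin le_max lexx orbT.
Qed.

Let gE x : `]-oo, x[ `&` A = `[m, x[ `&` A.
Proof.
apply/seteqP; split=> u /=; rewrite !in_itv/= => -[ux Au]; split=> //.
  by rewrite ux andbT (le_trans (Tm u)).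
by move/andP : ux => [].
Qed.

Let mu_fin x : mu (`]-oo, x[ `&` A) \is a fin_num.
Proof.
rewrite ge0_fin_numE ?measure_ge0// gE.
exact: (le_lt_trans (muA_le m x) (ltry _)).
Qed.

Let gB a b : a <= b -> g b - g a = fine (mu (`[a, b[ `&` A)).
Proof.
move=> ab; apply/eqP; rewrite subr_eq; apply/eqP.
rewrite /g -fineD; last 2 first.
- rewrite ge0_fin_numE ?measure_ge0//.
  exact: (le_lt_trans (muA_le a b) (ltry _)).
- exact: mu_fin.
have dis : (`]-oo, a[ `&` A) `&` (`[a, b[ `&` A) = set0.
  apply/seteqP; split=> u//= [[]]; rewrite !in_itv/= => ua _ [/andP[au _] _].
  by move: (lt_le_trans ua au); rewrite ltxx.
rewrite addeC -(measureU mu (mAi _) (mAi _) dis).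
congr fine; congr (mu _); apply/seteqP; split=> u /=; rewrite !in_itv/=.
  by move=> [ub Au]; have [ua|au] := ltP u a; [left|right].
move=> [[ua Au]|[/andP[au ub] Au]]//; split=> //.
exact: lt_le_trans ua ab.
Qed.

Let gB_bnd a b : a <= b -> 0 <= g b - g a <= b - a.
Proof.
move=> ab; rewrite gB//; apply/andP; split; first exact: fine_ge0.
have := muA_le a b; rewrite max_l ?subr_ge0// => h.
rewrite -lee_fin fineK// ge0_fin_numE ?measure_ge0//.
exact: (le_lt_trans h (ltry _)).
Qed.

Let h x := x - 2 * g x.

Let hlip a b : a <= b -> `|h b - h a| <= b - a.
Proof. by move=> ab; have := gB_bnd ab; rewrite /h ler_norml; lra. Qed.

(* [h] has slope [1] where [T u > u] and [-1] where [T u <= u], and by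
   monotonicity the sign of [T u - u] is constant between [z] and [T z]. *)
Let hT z : h (T z) - h z = `|T z - z|.
Proof.
have [zT|/ltW Tz] := leP z (T z).
  have : g (T z) - g z = 0.
    rewrite gB// (_ : _ `&` _ = set0) ?measure0//.
    apply/seteqP; split=> u//=; rewrite in_itv/= => -[/andP[zu uT]].
    rewrite /A/= => Tu; have := Tmono zu.
    by move=> /le_trans/(_ Tu); rewrite leNgt uT.
  by rewrite ger0_norm ?subr_ge0// /h; lra.
have : g z - g (T z) = z - T z.
  rewrite gB// (_ : _ `&` _ = `[T z, z[%classic).
    rewrite lebesgue_measure_itv/= lte_fin; case: ifPn => //.
    by rewrite -leNgt => zT; apply/esym/eqP; rewrite subr_eq0 eq_le zT Tz.
  apply/seteqP; split=> u/= => [[]//|uTz]; split=> //.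
  move: uTz; rewrite in_itv/= => /andP[Tu uz].
  by rewrite /A/= (le_trans _ Tu)// Tmono// ltW.
by rewrite ler0_norm ?subr_le0// /h; lra.
Qed.

Let gcont : continuous g.
Proof.
move=> x; apply/cvgrPdist_le => e e0; near=> y.
have xy : `|x - y| <= e by near: y; exact: cvgr_dist_le.
have [yx|/ltW yx] := leP y x.
  have := gB_bnd yx; move: xy; rewrite (ger0_norm (_ : 0 <= x - y)) ?subr_ge0//.
  by rewrite ler_norml; lra.
have := gB_bnd yx; move: xy; rewrite distrC (ger0_norm (_ : 0 <= y - x)) ?subr_ge0//.
by rewrite ler_norml; lra.
Unshelve. all: by end_near. Qed.

Let g0 x : x <= m -> g x = 0.
Proof.
move=> xm; rewrite /g gE (_ : _ `&` _ = set0) ?measure0//.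
apply/seteqP; split=> u//=; rewrite in_itv/= => -[/andP[mu1 ux] _].
by move: (lt_le_trans ux xm); rewrite ltNge mu1.
Qed.

Let gint y : mu.-integrable `]-oo, y] (EFin \o g).
Proof.
have i1 : mu.-integrable `]-oo, y]
    (fun x => (g y)%:E * (EFin \o \1_(`[m, y])) x)%E.
  apply: integrableZl => //.
  apply: (@integrableS _ _ _ mu setT) => //.
  exact: integrable_indic_itv.
apply: le_integrable i1 => //.
  apply/measurable_EFinP; apply: measurable_funTS.
  exact: continuous_measurable_fun.
move=> x /=; rewrite in_itv/= => xy; rewrite lee_fin.
have gx0 : 0 <= g x by exact: fine_ge0.
have gy0 : 0 <= g y by exact: fine_ge0.
rewrite (ger0_norm gx0).
have [/g0 ->|/ltW mx] := leP x m; first exact: normr_ge0.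
rewrite indicE mem_set ?mulr1; last by rewrite /= in_itv/= mx.
by rewrite (ger0_norm gy0); have := gB_bnd xy; lra.
Qed.

Let H x := x ^+ 2 / 2 - 2 * \int[mu]_(t in `]-oo, x]) g t.

Let HE (x : R) : is_derive x (1 : R) H (h x).
Proof.
have d : is_derive x (1 : R) (fun x => \int[mu]_(t in `]-oo, x]) g t) (g x).
  have [||||d1 d2] := @continuous_FTC1 R g -oo%O x (x + 1).
  - by rewrite ltrDl.
  - exact: gint.
  - exact: ltNyr.
  - exact: gcont.
  by apply: DeriveDef; [exact: d1|rewrite -d2 derive1E].
by apply: is_derive_eq; rewrite /h /GRing.scale/=; lra.
Qed.

(** The 1-Lipschitz [h] attains |T z - z| exactly but need not be differentiable. Its mean over
    [x, x + e], written as a difference quotient of the primitive [H], is differentiable with slope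
    at most 1 and within e of [h]; the two endpoints cost 2e. *)
Lemma monotone_dual (e : R) : 0 < e -> exists k k' : R -> R,
  [/\ forall x : R, is_derive x (1 : R) k (k' x), forall x, `|k' x| <= 1 &
      forall z, `|T z - z| <= k (T z) - k z + 2 * e].
Proof.
move=> e0; pose k x := e^-1 * (H (x + e) - H x).
have en0 : e != 0 by rewrite gt_eqF.
have xe x : x + e - x = e by ring.
exists k, (fun x => e^-1 * (h (x + e) - h x)); split.
- move=> x; have d0 := HE x.
  have d1 : is_derive x (1 : R) (fun y => y + e) 1.
    by apply: is_derive_eq; rewrite addr0.
  have d2 := @is_derive1_comp R H (fun y => y + e) x _ _ (HE (x + e)) d1.
  by apply: is_derive_eq; rewrite /GRing.scale/= mulr1.
- move=> x; have he := @hlip x (x + e); rewrite xe in he.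
  rewrite normrM gtr0_norm ?invr_gt0// ler_pdivrMl// mulr1; apply: he; lra.
move=> z.
have kh x : `|k x - h x| <= e.
  have xxe : x <= x + e by lra.
  have [||c] := @MVT_segment R H h x (x + e) xxe.
  - by move=> y _; exact: HE.
  - apply: derivable_within_continuous => y _.
    exact: (@ex_derive _ _ _ _ _ _ _ (HE y)).
  rewrite in_itv/= => /andP[xc ce]; rewrite /k => ->.
  rewrite xe mulrCA mulVf// mulr1.
  by rewrite (le_trans (hlip xc))//; lra.
have := kh z; have := kh (T z); rewrite -hT !ler_norml; lra.
Qed.

End monotone_dual.

(** * The normal distribution function and quantile maps *)

Local Notation Phi x := (\int[mu]_(t in `]-oo, x]) (1 * phi t)).

Lemma gauss_cdfE x : gam `]-oo, x] = (Phi x)%:E.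
Proof.
rewrite /normal_prob /Rintegral fineK.
  by apply: eq_integral => t _; rewrite mul1r.
apply: integrable_fin_num => //.
by apply: (@integrable_gauss (fun=> 1) 0 1) => // t; rewrite normr1; lra.
Qed.

Lemma is_derive_gauss_cdf (x : R) : is_derive x (1 : R) (fun x => Phi x) (phi x).
Proof.
rewrite -[phi x]mul1r; apply: (@is_derive_gauss_int (fun=> 1) 0 1).
  exact: cst_continuous.
by move=> t; rewrite normr1; lra.
Qed.

Lemma gauss_cdf_lt x y : x < y -> Phi x < Phi y.
Proof.
move=> xy; have [||z _] := @MVT R (fun x => Phi x) phi x y xy.
- by move=> z _; exact: is_derive_gauss_cdf.
- apply: derivable_within_continuous => z _.
  exact: (@ex_derive _ _ _ _ _ _ _ (is_derive_gauss_cdf z)).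
by move=> e; rewrite -subr_gt0 e mulr_gt0 ?gauss_pdf_gt0// subr_gt0.
Qed.

Lemma gauss_cdf_le x y : (Phi x <= Phi y) = (x <= y).
Proof.
apply/idP/idP => [|]; last by rewrite le_eqVlt => /predU1P[->//|/gauss_cdf_lt/ltW].
by apply: contraLR; rewrite -!ltNge; exact: gauss_cdf_lt.
Qed.

Lemma gauss_cdf_ge0 x : 0 <= Phi x.
Proof. by apply: Rintegral_ge0 => t _; rewrite mul1r ltW// gauss_pdf_gt0. Qed.

Lemma gauss_cdf_le1 x : Phi x <= 1.
Proof. by rewrite -lee_fin -gauss_cdfE probability_le1. Qed.

(** There 1 <= -t, and -t [phi] integrates to [phi x]. *)
Lemma gauss_cdf_left x : x <= -1 -> Phi x <= phi x.
Proof.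
move=> x1; rewrite -[leRHS]opprK -gauss_moment_left -mulN1r -RintegralZl//; last first.
  by apply: (@integrable_gauss id 1 0) => // t; lra.
apply: le_Rintegral => //.
- by apply: (@integrable_gauss (fun=> 1) 0 1) => // t; rewrite normr1; lra.
- have -> : (fun t => -1 * (t * phi t)) = (fun t => -1 * t * phi t).
    by apply/funext => t; rewrite mulrA.
  apply: (@integrable_gauss (fun t => -1 * t) 1 0) => // [|t].
    exact: measurable_funM.
  by rewrite normrM normrN1; lra.
move=> t /=; rewrite in_itv/= => tx; rewrite mulrA ler_wpM2r//.
  exact/ltW/gauss_pdf_gt0.
lra.
Qed.

Lemma gauss_cdf_right x : 1 <= x -> 1 - Phi x <= phi x.
Proof.
move=> x1; have m1 : measurable_fun setT (fun _ : R => 1 : R) by [].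
have b1 (t : R) : `|1 : R| <= 0 * `|t| + 1 by rewrite normr1; lra.
have := Rintegral_gauss_split x m1 b1.
under eq_Rintegral do rewrite mul1r.
rewrite gauss_total => e1.
have -> : 1 - Phi x = \int[mu]_(t in `]x, +oo[) (1 * phi t) by lra.
rewrite -(gauss_moment_right x).
apply: le_Rintegral => //.
- exact: integrable_gauss b1.
- by apply: (@integrable_gauss id 1 0) => // t; lra.
move=> t /=; rewrite in_itv/= andbT => tx; rewrite ler_wpM2r//; last lra.
exact/ltW/gauss_pdf_gt0.
Qed.

Lemma gauss_quantile t : 0 < t < 1 -> exists x, Phi x = t.
Proof.
move=> /andP[t0 t1].
(* Large enough that phi(M) <= 1/(2 + M^2) is below both t and 1 - t, so that t lies between the
   values of [Phi] at -M and M. *)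
pose M := 1 / t + 1 / (1 - t) + 1.
have it0 : 0 < 1 / t by rewrite divr_gt0.
have it1 : 0 < 1 / (1 - t) by rewrite divr_gt0// subr_gt0.
have small x : M <= `|x| -> phi x <= t /\ phi x <= 1 - t.
  move=> Mx; have xx : `|x| ^+ 2 = x ^+ 2 by rewrite real_normK ?num_real.
  have b s : 0 < s -> 1 / s <= `|x| -> phi x <= s.
    move=> s0 sx; apply: (le_trans (gauss_pdf_le x)).
    rewrite invf_ple ?posrE//; last by have := sqr_ge0 x; lra.
    by rewrite -xx; move: sx Mx; rewrite div1r /M; nra.
  by split; apply: b; rewrite ?subr_gt0//; move: Mx; rewrite /M; lra.
have [|||x _ <-] := @IVT R (fun x => Phi x) (- M) M t.
- rewrite /M; lra.
- apply: derivable_within_continuous => z _.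
  exact: (@ex_derive _ _ _ _ _ _ _ (is_derive_gauss_cdf z)).
- have [|s1 _] := small (- M); first by rewrite normrN ler_norm.
  have [|_ s2] := small M; first exact: ler_norm.
  have l := @gauss_cdf_left (- M); have r := @gauss_cdf_right M.
  rewrite ge_min le_max; apply/andP; split; apply/orP; [left|right].
    by apply: (le_trans (l _)) => //; rewrite /M; lra.
  have : 1 - Phi M <= phi M by apply: r; rewrite /M; lra.
  lra.
- by exists x.
Qed.

(** [Phi] omits the values 0 and 1; for these the set is empty or everything. *)
Lemma gauss_quantile_set t : 0 <= t <= 1 ->
  measurable [set x | Phi x <= t] /\ gam [set x | Phi x <= t] = t%:E.
Proof.
move=> /andP[]; rewrite le_eqVlt => /predU1P[<- _|t0].
  rewrite (_ : [set x | _] = set0); first by rewrite measure0.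
  apply/seteqP; split=> x//= x0.
  have := @gauss_cdf_lt (x - 1) x; have := gauss_cdf_ge0 (x - 1).
  by move=> h /(_ _)/=; rewrite ltrBlDr ltrDl ltr01 => /(_ isT); lra.
rewrite le_eqVlt => /predU1P[->|t1].
  rewrite (_ : [set x | _] = setT); first by rewrite probability_setT.
  by apply/seteqP; split=> x//= _; exact: gauss_cdf_le1.
have [|x xt] := @gauss_quantile t; first by rewrite t0.
rewrite (_ : [set x | _] = `]-oo, x]%classic); first by rewrite gauss_cdfE xt.
by apply/seteqP; split=> y /=; rewrite in_itv/= -xt gauss_cdf_le.
Qed.

Lemma gauss_cdf_gt0 x : 0 < Phi x.
Proof.
by apply: (le_lt_trans (gauss_cdf_ge0 (x - 1))); apply: gauss_cdf_lt; lra.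
Qed.

(** Sort V by Y, let F be the partial sums of p in this order, and send x to the first entry whose
    cumulative mass reaches [Phi x]. *)
Lemma quantile_map (V : finType) (p Y : V -> R) :
  (forall v, 0 <= p v) -> \sum_v p v = 1 ->
  exists tau : R -> V,
  [/\ forall v, measurable (tau @^-1` [set v]),
      forall v, gam (tau @^-1` [set v]) = (p v)%:E &
      forall x y, x <= y -> Y (tau x) <= Y (tau y)].
Proof.
move=> p0 p1.
pose e := sort (fun u v => Y u <= Y v) (enum V).
have e_uniq : uniq e by rewrite sort_uniq enum_uniq.
have e_mem v : v \in e by rewrite mem_sort mem_enum.
have e_sorted : sorted (fun u v => Y u <= Y v) e.
  by apply: sort_sorted => u v; exact: le_total.
case E : e => [|v0 e'].
  have: \sum_v p v = 0.
    by apply: big1_seq => v _; have := e_mem v; rewrite E.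
  by rewrite p1 => /eqP; rewrite oner_eq0.
pose F j := \sum_(v <- take j e) p v.
have F0 : F 0%N = 0 by rewrite /F take0 big_nil.
have FS j : (j < size e)%N -> F j.+1 = F j + p (nth v0 e j).
  by move=> je; rewrite /F (take_nth v0)// -cats1 big_cat big_seq1.
have Fmono i j : (i <= j)%N -> F i <= F j.
  move=> ij; rewrite /F -(subnKC ij) takeD big_cat/= lerDl.
  by apply: sumr_ge0 => v _.
have Fsize : F (size e) = 1.
  by rewrite /F take_size -p1 (perm_big (index_enum V))//= perm_sort enumT.
have F01 j : (j <= size e)%N -> 0 <= F j <= 1.
  by move=> je; rewrite -{1}F0 -Fsize !Fmono.
pose J x := find (fun j => Phi x <= F j.+1) (iota 0 (size e)).
have esz : (0 < size e)%N by rewrite E.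
have hasJ x : has (fun j => Phi x <= F j.+1) (iota 0 (size e)).
  apply/hasP; exists (size e).-1; first by rewrite mem_iota/= add0n prednK.
  by rewrite prednK// Fsize gauss_cdf_le1.
have Jlt x : (J x < size e)%N by have := hasJ x; rewrite has_find size_iota.
have Jle x j : (j < size e)%N -> (J x <= j)%N = (Phi x <= F j.+1).
  move=> je; apply/idP/idP => [Jj|]; last first.
    move=> xj; rewrite leqNgt; apply/negP => jJ.
    by have := before_find 0%N jJ; rewrite nth_iota// add0n xj.
  have := nth_find 0%N (hasJ x); rewrite -/(J x) nth_iota// add0n.
  by move=> h; apply: (le_trans h); apply: Fmono.
pose tau x := nth v0 e (J x).
(* The fibre is a difference of two lower level sets of [Phi], whose measures are known. *)
have tauE v : tau @^-1` [set v] =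
    [set x | Phi x <= F (index v e).+1] `\` [set x | Phi x <= F (index v e)].
  have iv : (index v e < size e)%N by rewrite index_mem.
  apply/seteqP; split=> x /=.
    move=> <-; rewrite /tau index_uniq// -Jle// leqnn; split=> //.
    case Jx : (J x) => [|j].
      by rewrite F0 leNgt gauss_cdf_gt0.
    have jlt : (j < size e)%N by rewrite ltnW// -Jx.
    by rewrite -Jle// Jx ltnn.
  rewrite -Jle// => -[Jv nJ]; rewrite /tau.
  suff -> : J x = index v e by rewrite nth_index.
  apply/eqP; rewrite eqn_leq Jv/= leqNgt; apply/negP => Jlt'; apply: nJ.
  case I : (index v e) Jlt' => [//|i] Ji.
  by rewrite -Jle ?I//; rewrite ltnW// -I.
have Fi v : 0 <= F (index v e) <= 1 by apply: F01; rewrite ltnW// index_mem.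
have FSi v : 0 <= F (index v e).+1 <= 1 by apply: F01; rewrite index_mem.
exists tau; split.
- move=> v; rewrite tauE; apply: measurableD.
    by have [] := gauss_quantile_set (FSi v).
  by have [] := gauss_quantile_set (Fi v).
- move=> v; rewrite tauE.
  have [m1 e1] := gauss_quantile_set (FSi v).
  have [m2 e2] := gauss_quantile_set (Fi v).
  rewrite measureD//; last by rewrite [ltLHS]e1 ltry.
  rewrite (_ : _ `&` _ = [set x | Phi x <= F (index v e)]).
    rewrite [X in (X - _)%E]e1 [X in (_ - X)%E]e2 -EFinB FS ?index_mem// nth_index//.
    by rewrite addrAC subrr add0r.
  apply/seteqP; split=> x /=; first by case.
  by move=> h; split=> //; apply: (le_trans h); exact: Fmono.
move=> x y xy; rewrite /tau.
have Jxy : (J x <= J y)%N.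
  by rewrite Jle// (le_trans (_ : _ <= Phi y))// ?gauss_cdf_le// -Jle.
have tr : transitive (fun u v : V => Y u <= Y v) by move=> a b c; exact: le_trans.
have rf : reflexive (fun u v : V => Y u <= Y v) by move=> a; exact: lexx.
exact: (@sorted_leq_nth _ _ tr rf v0 e e_sorted _ _ (Jlt x) (Jlt y) Jxy).
Qed.

End Gaussian.

(** * Coupling a finite-valued variable with the normal law *)

Section finite_valued.
Local Open Scope classical_set_scope.
Local Open Scope ring_scope.
Context {R : realType} {d : measure_display} {T : measurableType d}.
Context {V : finType} (tau : T -> V).
Hypothesis mtau : forall v, measurable (tau @^-1` [set v]).

Lemma finite_comp_indic (g : V -> R) :
  (g \o tau) = (fun z => \sum_v g v * \1_(tau @^-1` [set v]) z).
Proof.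
apply/funext => z /=; rewrite (bigD1 (tau z))//= big1 => [|v vz].
  by rewrite addr0 indicE mem_set ?mulr1.
by rewrite indicE memNset ?mulr0//= => e; rewrite e eqxx in vz.
Qed.

Lemma measurable_finite_comp (g : V -> R) : measurable_fun setT (g \o tau).
Proof.
rewrite finite_comp_indic; apply: measurable_sum => v.
by apply: measurable_funM => //; exact: measurable_indic.
Qed.

Lemma integral_finite_comp (P : probability T R) (p g : V -> R) :
  (forall v, P (tau @^-1` [set v]) = (p v)%:E) ->
  (\int[P]_z (g (tau z))%:E = (\sum_v p v * g v)%:E)%E.
Proof.
move=> Pp.
have ii v : P.-integrable setT (EFin \o \1_(tau @^-1` [set v])).
  exact: integrable_indic.
transitivity (\int[P]_z (\sum_v (g v)%:E * (EFin \o \1_(tau @^-1` [set v])) z))%E.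
  apply: eq_integral => z _; rewrite -[g _]/((g \o tau) z) finite_comp_indic.
  by rewrite -sumEFin; apply: eq_bigr => v _; rewrite EFinM.
rewrite integral_sum//; last by move=> v; apply: integrableZl.
rewrite -sumEFin; apply: eq_bigr => v _.
rewrite integralZl//= integral_indic// setIT mulrC EFinM.
by congr (_ * _)%E; exact: Pp.
Qed.

Lemma probability_finite_comp (P : probability T R) (p : V -> R) (A : set V) :
  (forall v, P (tau @^-1` [set v]) = (p v)%:E) ->
  measurable (tau @^-1` A) /\
  P (tau @^-1` A) = (\sum_(v | `[< A v >]) p v)%:E.
Proof.
move=> Pp.
have AE : tau @^-1` A = ((fun v => (`[< A v >]%:R : R)) \o tau) @^-1` [set 1].
  apply/seteqP; split=> z /=; first by move=> /asboolP ->.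
  by case: asboolP => //= _ /eqP; rewrite eq_sym oner_eq0.
have mA : measurable (tau @^-1` A).
  rewrite AE -[X in measurable X]setTI; apply: measurable_finite_comp => //.
split=> //; transitivity (\int[P]_z (\1_(tau @^-1` A) z)%:E)%E.
  by rewrite integral_indic// setIT.
transitivity (\int[P]_z ((fun v => (`[< A v >]%:R : R)) (tau z))%:E)%E.
  by apply: eq_integral => z _; rewrite indicE.
rewrite (integral_finite_comp (fun v => `[< A v >]%:R) Pp) [in RHS]big_mkcond/=.
congr EFin.
by apply: eq_bigr => v _; case: ifP => _; rewrite ?mulr1 ?mulr0.
Qed.

End finite_valued.

Section Gaussian_coupling.
Local Open Scope classical_set_scope.
Local Open Scope ring_scope.
Context {R : realType}.
Local Notation mu := (@lebesgue_measure R).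
Local Notation gam := (@normal_prob R 0 1).
Local Notation phi := (@normal_pdf R 0 1).
Variables (V : finType) (p Y : V -> R) (tau : R -> V).
Hypothesis mtau : forall v, measurable (tau @^-1` [set v]).
Hypothesis ptau : forall v, gam (tau @^-1` [set v]) = (p v)%:E.
Hypothesis Ymono : forall x y, x <= y -> Y (tau x) <= Y (tau y).

Let mY (g : V -> R) : measurable_fun setT (fun z => g (tau z)).
Proof. exact: (measurable_finite_comp mtau g). Qed.

Let gbnd (g : V -> R) z : `|g (tau z)| <= 0 * `|z| + \sum_v `|g v|.
Proof.
rewrite mul0r add0r (bigD1 (tau z))//= lerDl; exact: sumr_ge0.
Qed.

Let igam (g : V -> R) :
  (\int[gam]_z (g (tau z))%:E = (\sum_v p v * g v)%:E)%E.
Proof.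
exact: (@integral_finite_comp R _ (measurableTypeR R) V tau mtau
          (normal_prob 0 1) p g ptau).
Qed.

Let psum : \sum_v p v = 1.
Proof.
have := igam (fun=> 1).
rewrite integral_cst// [X in (_ * X)%E]probability_setT mule1 => -[->].
by apply: eq_bigr => v _; rewrite mulr1.
Qed.

Lemma Rintegral_quantile (g : V -> R) :
  \int[mu]_(z in setT) (g (tau z) * phi z) = \sum_v p v * g v.
Proof.
pose C := \sum_v `|g v|.
have ip (f : V -> R) : mu.-integrable setT (EFin \o (fun z => f (tau z) * phi z)).
  exact: (integrable_gauss measurableT (mY f) (gbnd f)).
(* [integral_gauss] wants a nonnegative function, hence the shift by [C]. *)
have Cg : \int[mu]_(z in setT) ((g (tau z) + C) * phi z) = \sum_v p v * (g v + C).
  rewrite /Rintegral.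
  have <- := @integral_gauss R (fun z => g (tau z) + C) setT measurableT.
  - by rewrite (igam (fun v => g v + C)).
  - exact: (mY (fun v => g v + C)).
  by move=> z; have := gbnd g z; rewrite ler_norml; rewrite -/C; lra.
have : \int[mu]_(z in setT) ((g (tau z) + C) * phi z) =
    \int[mu]_(z in setT) (g (tau z) * phi z) + C.
  under eq_Rintegral => z _ do rewrite mulrDl.
  rewrite RintegralD//; last exact: (ip (fun=> C)).
  by rewrite RintegralZl ?gauss_total ?mulr1//; apply: integrable_normal_pdf.
rewrite Cg; under [in LHS]eq_bigr do rewrite mulrDr.
by rewrite big_split/= -mulr_suml psum mul1r => /addIr <-.
Qed.

Lemma quantile_coupling_triv :
  (\int[gam]_z (`|Y (tau z) - z|)%:E <= (\sum_v p v * `|Y v| + 1)%:E)%E.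
Proof.
have m1 : measurable_fun setT (fun z : R => `|Y (tau z)|).
  exact: (mY (fun v => `|Y v|)).
have m0 : measurable_fun setT (fun z : R => `|z|) by [].
apply: (@le_trans _ _ (\int[gam]_z (`|Y (tau z)|%:E + `|z|%:E))%E).
  apply: ge0_le_integral => //.
  - apply/measurable_EFinP; apply: measurableT_comp => //.
    by apply: measurable_funB => //; exact: mY.
  - by apply: emeasurable_funD; exact/measurable_EFinP.
  - by move=> z _; rewrite -EFinD lee_fin ler_normB.
rewrite ge0_integralD//; last 2 first.
- exact/measurable_EFinP.
- exact/measurable_EFinP.
rewrite (igam (fun v => `|Y v|)) EFinD leeD2l//.
rewrite integral_gauss// gauss_abs_moment lee_fin; exact: gauss_pdf0_le.
Qed.

(** The hypothesis ranges over all pairs with the bounds of [stein_solution], so the combinatorial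
    side never meets a Gaussian integral. The conclusion follows because the coupling cost is, up to
    e, the difference of the means of one smooth test function under the two laws. *)
Lemma quantile_coupling_stein (B : R) :
  (forall f k : R -> R, (forall x, `|k x| <= 3) ->
    (forall a b, `|f b - f a - k a * (b - a)| <= 4 * (b - a) ^+ 2) ->
    \sum_v p v * (k (Y v) - Y v * f (Y v)) <= B) ->
  (\int[gam]_z (`|Y (tau z) - z|)%:E <= B%:E)%E.
Proof.
move=> HB.
have mT : measurable_fun setT (fun z => Y (tau z)) by exact: mY.
rewrite integral_gauss//; last 1 first.
  apply: measurableT_comp => //; exact: measurable_funB.
have growth z : `| `|Y (tau z) - z| | <= 1 * `|z| + \sum_v `|Y v|.
  rewrite normr_id mul1r (le_trans (ler_normB _ _))// addrC lerD2l.
  by have := gbnd Y z; rewrite mul0r add0r.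
have md : measurable_fun setT (fun z => `|Y (tau z) - z|).
  by apply: measurableT_comp => //; exact: measurable_funB.
have id := integrable_gauss (@measurableT _ _) md growth.
rewrite -[leLHS]fineK; last exact: (integrable_fin_num _ id).
rewrite lee_fin; apply/ler_addgt0Pr => e e0.
have lb z : - \sum_v `|Y v| <= Y (tau z).
  by have := gbnd Y z; rewrite mul0r add0r ler_norml => /andP[].
have e20 : 0 < e / 2 by rewrite divr_gt0.
have [k [k' [kE k1 kT]]] := monotone_dual Ymono mT lb e20.
have klip x y : x <= y -> `|k y - k x| <= y - x.
  by move=> xy; rewrite -[leRHS]mul1r; exact: (derive_bound_lip kE).
have kc := derive_continuous kE.
have mk : measurable_fun setT k by exact: continuous_measurable_fun.
have ik := integrable_gauss measurableT mk (lip_growth klip).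
have ikY := integrable_gauss measurableT (mY (k \o Y)) (gbnd (k \o Y)).
have ie : mu.-integrable setT (EFin \o (fun z => e * phi z)).
  by apply: (@integrable_gauss R (fun=> e) 0 `|e|) => // x; lra.
have ikk : mu.-integrable setT
    (EFin \o (fun z => (k \o Y) (tau z) * phi z - k z * phi z)).
  exact: (integrableB measurableT ikY ik).
apply: (@le_trans _ _ (\int[mu]_(z in setT)
    ((k \o Y) (tau z) * phi z - k z * phi z + e * phi z))).
  apply: le_Rintegral => //; first exact: (integrableD measurableT ikk ie).
  move=> z _; rewrite -mulrBl -mulrDl ler_wpM2r//; first exact/ltW/gauss_pdf_gt0.
  by have := kT z; rewrite mulrC divfK.
rewrite RintegralD// RintegralB// Rintegral_quantile RintegralZl//; last first.
  by apply: integrable_normal_pdf.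
rewrite gauss_total mulr1 lerD2r.
(* Here [k] is the test function and [g] is the derivative of the Stein solution [f]. *)
have [f [g [fE g3 gt]]] := stein_solution kE k1.
apply: le_trans (HB f g g3 gt); rewrite le_eqVlt; apply/orP; left; apply/eqP.
set c := \int[mu]_z _.
transitivity (\sum_v (p v * k (Y v) - p v * c)).
  by rewrite sumrB -mulr_suml psum mul1r.
by apply: eq_bigr => v _; rewrite fE -mulrBr.
Qed.

End Gaussian_coupling.


Section wasserstein_finite.
Local Open Scope classical_set_scope.
Local Open Scope ring_scope.
Context {R : realType}.
Context {dZ : measure_display} {OmegaZ : measurableType dZ}.
Context {PZ : probability OmegaZ R} {Z : {RV PZ >-> R}}.
Hypothesis hZ : standard_normal Z.
Context {d : measure_display} {Omega : measurableType d} (P : probability Omega R).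
Context {V : finType} (p Y : V -> R) (w : Omega -> V).
Hypothesis mw : forall v, measurable (w @^-1` [set v]).
Hypothesis pw : forall v, P (w @^-1` [set v]) = (p v)%:E.

(** The coupling lives on the real line with the normal law: [Y \o tau] against the identity. *)
Lemma wasserstein1_normal_coupling (tau : R -> V) :
  (forall v, measurable (tau @^-1` [set v])) ->
  (forall v, normal_prob 0 1 (tau @^-1` [set v]) = (p v)%:E) ->
  (wasserstein1 P (fun t => Y (w t)) PZ Z <=
   \int[normal_prob 0 1]_z (`|Y (tau z) - z|)%:E)%E.
Proof.
move=> mtau ptau; apply: ereal_inf_lbound.
have mYtau : measurable_fun (setT : set (measurableTypeR R)) (fun z => Y (tau z)).
  exact: (@measurable_finite_comp R _ (measurableTypeR R) V tau mtau Y).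
have mid : measurable_fun (setT : set (measurableTypeR R)) (fun z : R => z).
  exact: measurable_id.
pose A' : {mfun measurableTypeR R >-> R} :=
  HB.pack (fun z : measurableTypeR R => Y (tau z))
    (isMeasurableFun.Build _ _ (measurableTypeR R) R _ mYtau).
pose B' : {mfun measurableTypeR R >-> R} :=
  HB.pack (fun z : measurableTypeR R => z : R)
    (isMeasurableFun.Build _ _ (measurableTypeR R) R _ mid).
exists _, (measurableTypeR R), (normal_prob 0 1), A', B'; split.
- move=> U mU.
  have [_ /=] := @probability_finite_comp R _ (measurableTypeR R) V tau mtau
    (normal_prob 0 1) p (Y @^-1` U) ptau.
  have [_ ] := probability_finite_comp mw (Y @^-1` U) pw.
  by move=> e1 e2; exact: (etrans e2 (esym e1)).
- by move=> U mU; rewrite hZ.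
- by rewrite unlock.
Qed.

Hypothesis p0 : forall v, 0 <= p v.
Hypothesis p1 : \sum_v p v = 1.

Lemma wasserstein1_normal_triv :
  (wasserstein1 P (fun t => Y (w t)) PZ Z <= (\sum_v p v * `|Y v| + 1)%:E)%E.
Proof.
have [tau [mtau ptau Ymono]] := quantile_map Y p0 p1.
apply: le_trans (wasserstein1_normal_coupling mtau ptau) _.
exact: quantile_coupling_triv.
Qed.

Lemma wasserstein1_normal_stein (B : R) :
  (forall f k : R -> R, (forall x, `|k x| <= 3) ->
    (forall a b, `|f b - f a - k a * (b - a)| <= 4 * (b - a) ^+ 2) ->
    \sum_v p v * (k (Y v) - Y v * f (Y v)) <= B) ->
  (wasserstein1 P (fun t => Y (w t)) PZ Z <= B%:E)%E.
Proof.
have [tau [mtau ptau Ymono]] := quantile_map Y p0 p1.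
move=> HB; apply: le_trans (wasserstein1_normal_coupling mtau ptau) _.
exact: quantile_coupling_stein.
Qed.

Lemma standardize_finite (X : V -> R) :
  let m := \sum_v p v * X v in
  standardize P (fun t => X (w t)) =
  (fun t => (X (w t) - m) / Num.sqrt (\sum_v p v * (X v - m) ^+ 2)).
Proof.
move=> m; have Em : fine ('E_P[fun t => X (w t)])%E = m.
  by rewrite unlock (integral_finite_comp mw X pw).
apply/funext => t; rewrite /standardize Em; congr (_ / Num.sqrt _).
rewrite /variance covariance.unlock Em expectation.unlock.
transitivity (fine (\int[P]_t ((fun v => (X v - m) ^+ 2) (w t))%:E)%E).
  by congr fine; apply: eq_integral => x _; rewrite expr2.
by rewrite (integral_finite_comp mw (fun v => (X v - m) ^+ 2) pw).
Qed.

End wasserstein_finite.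

(** * Stein kernel of a sum of flip indicators *)

Section finite_expectation.
Context {R : realType} {V : finType} (p : V -> R).
Hypothesis p0 : forall v, 0 <= p v.
Hypothesis p1 : \sum_v p v = 1.

Definition fexp (F : V -> R) : R := \sum_v p v * F v.
Definition fvar (F : V -> R) : R := fexp (fun v => (F v - fexp F) ^+ 2).

Lemma eq_fexp F G : F =1 G -> fexp F = fexp G.
Proof. by move=> FG; apply: eq_bigr => v _; rewrite FG. Qed.

Lemma fexpD F G : fexp (fun v => F v + G v) = fexp F + fexp G.
Proof. by rewrite /fexp -big_split; apply: eq_bigr => v _; rewrite mulrDr. Qed.

Lemma fexpZ a F : fexp (fun v => a * F v) = a * fexp F.
Proof. by rewrite /fexp mulr_sumr; apply: eq_bigr => v _; rewrite mulrCA. Qed.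

Lemma fexpN F : fexp (fun v => - F v) = - fexp F.
Proof. by rewrite /fexp -sumrN; apply: eq_bigr => v _; rewrite mulrN. Qed.

Lemma fexpB F G : fexp (fun v => F v - G v) = fexp F - fexp G.
Proof. by rewrite fexpD fexpN. Qed.

Lemma fexp_sum (I : finType) (P : pred I) (F : I -> V -> R) :
  fexp (fun v => \sum_(i | P i) F i v) = \sum_(i | P i) fexp (F i).
Proof.
rewrite /fexp exchange_big/=; apply: eq_bigr => v _.
by rewrite mulr_sumr.
Qed.

Lemma fexp_cst a : fexp (fun=> a) = a.
Proof. by rewrite /fexp -mulr_suml p1 mul1r. Qed.

(** Bounds on the support are enough: later F and G are controlled only on the Coxeter group, inside
    all permutations. *)
Lemma ler_fexp F G : (forall v, p v != 0 -> F v <= G v) -> fexp F <= fexp G.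
Proof.
move=> FG; apply: ler_sum => v _; have [->|pv] := eqVneq (p v) 0.
  by rewrite !mul0r.
by rewrite ler_wpM2l// FG.
Qed.

Lemma fexp_ge0 F : (forall v, 0 <= F v) -> 0 <= fexp F.
Proof. by move=> F0; apply: sumr_ge0 => v _; rewrite mulr_ge0. Qed.

Lemma fvar_ge0 F : 0 <= fvar F.
Proof. by apply: fexp_ge0 => v; exact: sqr_ge0. Qed.

Lemma fvarE F : fvar F = fexp (fun v => F v ^+ 2) - fexp F ^+ 2.
Proof.
rewrite /fvar; set m := fexp F.
under eq_fexp do rewrite sqrrB.
transitivity (fexp (fun v => F v ^+ 2) - 2 * m * fexp F + m ^+ 2).
  rewrite -fexpZ -fexpB -[in RHS](fexp_cst (m ^+ 2)) -fexpD.
  by apply: eq_fexp => v; ring.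
by rewrite -/m; ring.
Qed.

Lemma fexp_sqr_dev F a : fexp (fun v => (F v - a) ^+ 2) = fvar F + (fexp F - a) ^+ 2.
Proof.
rewrite -(fexp_cst ((fexp F - a) ^+ 2)) /fvar -fexpD; set m := fexp F.
have e : fexp (fun v => 2 * (m - a) * (F v - m)) = 0.
  by rewrite fexpZ fexpB fexp_cst -/m subrr mulr0.
by rewrite -[RHS]addr0 -e -fexpD; apply: eq_fexp => v; ring.
Qed.

Lemma fvar_le F a : fvar F <= fexp (fun v => (F v - a) ^+ 2).
Proof. by rewrite fexp_sqr_dev lerDl sqr_ge0. Qed.

Lemma fvarD2_le F G : fvar (fun v => F v + G v) <= 2 * fvar F + 2 * fvar G.
Proof.
apply: (le_trans (fvar_le _ (fexp F + fexp G))).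
have -> : 2 * fvar F + 2 * fvar G =
    fexp (fun v => 2 * (F v - fexp F) ^+ 2 + 2 * (G v - fexp G) ^+ 2).
  by rewrite fexpD !fexpZ.
apply: ler_fexp => v _.
by have := sqr_ge0 ((F v - fexp F) - (G v - fexp G)); nra.
Qed.

Lemma fvarDcst F a : fvar (fun v => a + F v) = fvar F.
Proof.
rewrite /fvar fexpD fexp_cst; apply: eq_fexp => v; ring.
Qed.

Lemma fvarN F : fvar (fun v => - F v) = fvar F.
Proof. by rewrite /fvar fexpN; apply: eq_fexp => v; ring. Qed.

Lemma fvar_bounded F b : (forall v, p v != 0 -> `|F v| <= b) -> fvar F <= b ^+ 2.
Proof.
move=> Fb; apply: (le_trans (fvar_le _ 0)); rewrite -[leRHS]fexp_cst.
apply: ler_fexp => v pv; rewrite subr0 -real_normK ?num_real//.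
by rewrite lerXn2r ?nnegrE// ?(le_trans _ (Fb v pv))// Fb.
Qed.

Lemma fexp_norm_sqr F : fexp (fun v => `|F v|) ^+ 2 <= fexp (fun v => F v ^+ 2).
Proof.
have := fvar_ge0 (fun v => `|F v|); rewrite fvarE subr_ge0.
suff -> : fexp (fun v => `|F v| ^+ 2) = fexp (fun v => F v ^+ 2) by [].
by apply: eq_fexp => v; rewrite real_normK ?num_real.
Qed.

End finite_expectation.

Section finite_variance.
Context {R : realType}.

Lemma eq_fexp_supp (V : finType) (p : V -> R) F G :
  (forall v, p v != 0 -> F v = G v) -> fexp p F = fexp p G.
Proof.
move=> FG; apply: eq_bigr => v _; have [->|pv] := eqVneq (p v) 0; first by rewrite !mul0r.
by rewrite FG.
Qed.

Lemma eq_fvar (V : finType) (p : V -> R) F G :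
  (forall v, p v != 0 -> F v = G v) -> fvar p F = fvar p G.
Proof.
by move=> FG; rewrite /fvar (eq_fexp_supp FG); apply: eq_fexp_supp => v /FG->.
Qed.

Lemma fvar_dev (V : finType) (p : V -> R) F a b : (forall v, 0 <= p v) -> \sum_v p v = 1 ->
  (forall v, p v != 0 -> `|F v - a| <= b) -> fvar p F <= b ^+ 2.
Proof.
move=> p0 p1 Fb; have -> : fvar p F = fvar p (fun v => - a + F v) by rewrite fvarDcst.
by apply: fvar_bounded => // v pv; rewrite addrC Fb.
Qed.

(** Law of total variance, with the conditional variances bounded by [B]. *)
Lemma fvar_fiber (V C V' : finType) (p : V -> R) (pi : C -> R) (p' : V' -> R)
    (z : C -> V -> V') (F : V' -> R) (B : R) :
  (forall v, 0 <= p v) -> \sum_v p v = 1 -> \sum_c pi c = 1 ->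
  (forall G, fexp p' G = fexp p (fun v => fexp pi (fun c => G (z c v)))) ->
  (forall v, p v != 0 -> fvar pi (fun c => F (z c v)) <= B) ->
  fvar p' F <= B + fvar p (fun v => fexp pi (fun c => F (z c v))).
Proof.
move=> p0 p1 pi1 pE FB; rewrite /fvar !pE -[B](fexp_cst p1) -fexpD.
by apply: ler_fexp => // v pv; rewrite fexp_sqr_dev// lerD2r FB.
Qed.

Lemma fvar_sum (V : finType) (p : V -> R) (I : finType) (F : I -> V -> R) :
  \sum_v p v = 1 ->
  fvar p (fun w => \sum_i F i w) =
  \sum_i \sum_j (fexp p (fun w => F i w * F j w) - fexp p (F i) * fexp p (F j)).
Proof.
move=> p1; rewrite (fvarE p1).
have -> : fexp p (fun w => (\sum_i F i w) ^+ 2) = \sum_i \sum_j fexp p (fun w => F i w * F j w).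
  under eq_bigr do rewrite -fexp_sum; rewrite -fexp_sum; apply: eq_fexp => w.
  by rewrite expr2 mulr_suml; apply: eq_bigr => i _; rewrite mulr_sumr.
rewrite fexp_sum expr2 mulr_suml -sumrB; apply: eq_bigr => i _.
by rewrite mulr_sumr -sumrB.
Qed.

End finite_variance.

Section flip_indicators.
Context {R : realType} {V J : finType} (p : V -> R) (q : R).
Hypothesis p0 : forall v, 0 <= p v.
Hypothesis p1 : \sum_v p v = 1.
Hypothesis q0 : 0 < q.
Context (I : J -> V -> bool) (fl : J -> V -> V).
Hypothesis flK : forall j, involutive (fl j).
Hypothesis pfl : forall j v, ~~ I j v -> p (fl j v) = q * p v.
Hypothesis Ifl : forall j v, p v != 0 -> I j (fl j v) = ~~ I j v.

Local Notation E := (fexp p).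

Definition flip_up j v := if I j v then v else fl j v.
Definition flip_dn j v := if I j v then fl j v else v.
Definition flip_stat v : R := \sum_j (I j v)%:R.
Definition flip_diff j v := flip_stat (flip_up j v) - flip_stat (flip_dn j v).
Definition flip_kernel v := \sum_j flip_diff j v.

Let r := q / (1 + q).
Let pq := q / (1 + q) ^+ 2.

(** Substitute v by [fl j v]: on the support this exchanges the two values of the indicator and
    changes the weight by q. *)
Lemma flip_swap j (F : V -> R) :
  \sum_v p v * (I j v)%:R * F v = q * \sum_v p v * (~~ I j v)%:R * F (fl j v).
Proof.
rewrite (reindex_inj (inv_inj (flK j)))/= mulr_sumr.
apply: eq_bigr => v _; have [pv|pv] := eqVneq (p v) 0.
  case Iv : (I j v); last by rewrite pfl ?Iv// pv !(mulr0, mul0r).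
  rewrite /= mulr0 !mul0r mulr0; case Ifv : (I j (fl j v)); last by rewrite mulr0 mul0r.
  have [pfv|pfv] := eqVneq (p (fl j v)) 0; first by rewrite pfv !mul0r.
  by have := Ifl j pfv; rewrite flK Iv Ifv.
rewrite Ifl//; case Iv : (I j v); first by rewrite /= !(mulr0, mul0r).
by rewrite pfl ?Iv//= !mulr1 mulrA.
Qed.

Lemma flip_cov j (F : V -> R) :
  E (fun v => ((I j v)%:R - r) * F v) =
  pq * E (fun v => F (flip_up j v) - F (flip_dn j v)).
Proof.
(* By [flip_swap] every expectation in the identity is a combination of the two sums [A] and [B]
   over the elements without the j-th property. *)
pose A := \sum_v p v * (~~ I j v)%:R * F v.
pose B := \sum_v p v * (~~ I j v)%:R * F (fl j v).
have splt (G H : V -> R) : E (fun v => if I j v then G v else H v) =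
    \sum_v p v * (I j v)%:R * G v + \sum_v p v * (~~ I j v)%:R * H v.
  rewrite -big_split; apply: eq_bigr => v _.
  by case: (I j v); rewrite /= !(mulr1, mulr0, mul0r) ?addr0 ?add0r.
have eI : E (fun v => (I j v)%:R * F v) = q * B.
  rewrite -flip_swap; apply: eq_bigr => v _; exact: mulrA.
have eF : E F = q * B + A.
  rewrite -flip_swap -splt; apply: eq_bigr => v _; by case: ifP.
have eU : E (fun v => F (flip_up j v)) = q * B + B.
  rewrite -[in q * B]flip_swap -splt; apply: eq_bigr => v _.
  by rewrite /flip_up; case: ifP.
have eD : E (fun v => F (flip_dn j v)) = q * A + A.
  have <- : \sum_v p v * (I j v)%:R * F (fl j v) = q * A.
    rewrite flip_swap; congr (_ * _); apply: eq_bigr => v _; by rewrite flK.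
  rewrite -splt; apply: eq_bigr => v _.
  by rewrite /flip_dn; case: ifP.
have -> : E (fun v => ((I j v)%:R - r) * F v) =
    E (fun v => (I j v)%:R * F v) - r * E F.
  by rewrite -fexpZ -fexpB; apply: eq_fexp => v; ring.
have qn0 : 1 + q != 0 by rewrite gt_eqF// addr_gt0.
by rewrite fexpB eI eF eU eD /r /pq; field.
Qed.

Lemma flip_mean j : E (fun v => (I j v)%:R) = r.
Proof.
have := flip_cov j (fun=> 1); rewrite fexpB subrr mulr0.
under eq_fexp do rewrite mulr1.
by rewrite fexpB fexp_cst// => /eqP; rewrite subr_eq0 => /eqP.
Qed.

Let m := E flip_stat.

Lemma flip_stat_centered v : flip_stat v - m = \sum_j ((I j v)%:R - r).
Proof.
rewrite /m /flip_stat fexp_sum sumrB; congr (_ - _).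
by apply: eq_bigr => j _; exact: flip_mean.
Qed.

Lemma flip_stein (F : V -> R) :
  E (fun v => (flip_stat v - m) * F v) =
  pq * \sum_j E (fun v => F (flip_up j v) - F (flip_dn j v)).
Proof.
under eq_fexp do rewrite flip_stat_centered mulr_suml.
by rewrite fexp_sum mulr_sumr; apply: eq_bigr => j _; exact: flip_cov.
Qed.

Lemma flip_variance : fvar p flip_stat = pq * E flip_kernel.
Proof.
rewrite /fvar -/m; under eq_fexp do rewrite expr2.
rewrite (flip_stein (fun v => flip_stat v - m)); congr (_ * _).
rewrite -fexp_sum; apply: eq_fexp => v; apply: eq_bigr => j _.
by rewrite /flip_diff; ring.
Qed.

Let s := Num.sqrt (fvar p flip_stat).
Let Y v := (flip_stat v - m) / s.

Lemma flip_std_norm : E (fun v => `|Y v|) <= 1.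
Proof.
have Y2 : E (fun v => Y v ^+ 2) <= 1.
  have -> : E (fun v => Y v ^+ 2) = E (fun v => (s ^+ 2)^-1 * (flip_stat v - m) ^+ 2).
    by apply: eq_fexp => v; rewrite /Y expr_div_n mulrC.
  rewrite fexpZ -/(fvar p flip_stat) sqr_sqrtr; last exact: fvar_ge0.
  (* If the variance vanishes, the convention x / 0 = 0 makes the standardized variable 0. *)
  have [->|vn0] := eqVneq (fvar p flip_stat) 0; first by rewrite mulr0.
  by rewrite mulVf.
have Y0 : 0 <= E (fun v => `|Y v|) by exact: fexp_ge0.
have := le_trans (fexp_norm_sqr p0 p1 Y) Y2; set a := E _ in Y0 *.
by rewrite expr_le1.
Qed.

(* Zeroth and first order parts of [flip_stein] applied to [f o Y]. *)
Lemma flip_stein_bound (c W : R) (f k : R -> R) :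
  (forall j v, p v != 0 -> `|flip_diff j v| <= 2) ->
  0 < c -> c <= E flip_kernel -> fvar p flip_kernel <= W ->
  (forall x, `|k x| <= 3) ->
  (forall a b, `|f b - f a - k a * (b - a)| <= 4 * (b - a) ^+ 2) ->
  E (fun v => k (Y v) - Y v * f (Y v)) <=
  3 * Num.sqrt W / c + 16 * #|J|%:R / (Num.sqrt (pq * c) * c).
Proof.
move=> D2 c0 cK KW k3 tay.
have pq0 : 0 < pq by rewrite /pq divr_gt0// exprn_gt0// addr_gt0.
set K := E flip_kernel in cK *.
have K0 : 0 < K by exact: lt_le_trans cK.
have s2 : s ^+ 2 = pq * K by rewrite /s sqr_sqrtr ?flip_variance// -flip_variance fvar_ge0.
have s0 : 0 < s by rewrite /s flip_variance sqrtr_gt0 mulr_gt0.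
have sn0 : s != 0 by rewrite gt_eqF.
have YB u v : Y u - Y v = (flip_stat u - flip_stat v) / s by rewrite /Y; field.
(* One element of the pair is v itself, so the Taylor bound applies with base point [Y v]; the
   increment is at most 2/s and 4 (2/s)^2 = 16/s^2. *)
pose err j v := f (Y (flip_up j v)) - f (Y (flip_dn j v)) - k (Y v) * (flip_diff j v / s).
have errb j v : p v != 0 -> `|err j v| <= 16 / s ^+ 2.
  move=> pv.
  have e2 : 4 * (flip_diff j v / s) ^+ 2 <= 16 / s ^+ 2.
    rewrite expr_div_n mulrA ler_wpM2r ?invr_ge0 ?sqr_ge0//.
    have := D2 j v pv; rewrite -real_normK ?num_real//.
    by have := normr_ge0 (flip_diff j v); nra.
  apply: le_trans e2; rewrite /err /flip_diff -YB /flip_up /flip_dn; case: ifP => _.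
    have := tay (Y v) (Y (fl j v)).
    have -> : (Y (fl j v) - Y v) ^+ 2 = (Y v - Y (fl j v)) ^+ 2 by ring.
    by rewrite -normrN; congr (`|_| <= _); ring.
  exact: tay.
have main : E (fun v => k (Y v) - Y v * f (Y v)) =
    E (fun v => k (Y v) * (1 - flip_kernel v / K)) - pq / s * \sum_j E (err j).
  rewrite fexpB.
  have -> : E (fun v => Y v * f (Y v)) =
      s^-1 * E (fun v => (flip_stat v - m) * f (Y v)).
    by rewrite -fexpZ; apply: eq_fexp => v; rewrite /Y; ring.
  rewrite (flip_stein (fun v => f (Y v))).
  have -> : \sum_j E (fun v => f (Y (flip_up j v)) - f (Y (flip_dn j v))) =
      \sum_j E (err j) + s^-1 * E (fun v => k (Y v) * flip_kernel v).
    rewrite -fexpZ -!fexp_sum -fexpD; apply: eq_fexp => v.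
    rewrite /flip_kernel mulr_sumr mulr_sumr -big_split; apply: eq_bigr => j _.
    by rewrite /err /=; ring.
  have -> : E (fun v => k (Y v) * (1 - flip_kernel v / K)) =
      E (fun v => k (Y v)) - K^-1 * E (fun v => k (Y v) * flip_kernel v).
    by rewrite -fexpZ -fexpB; apply: eq_fexp => v; ring.
  have -> : K^-1 = pq * s ^- 2.
    by rewrite s2; field; rewrite !gt_eqF.
  by field.
(* |k| <= 3, then Cauchy-Schwarz for the deviation of the kernel from its mean. *)
have b1 : E (fun v => k (Y v) * (1 - flip_kernel v / K)) <= 3 * Num.sqrt W / c.
  have : E (fun v => k (Y v) * (1 - flip_kernel v / K)) <=
      E (fun v => 3 / K * `|flip_kernel v - K|).
    apply: ler_fexp => // v _; apply: (le_trans (ler_norm _)).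
    rewrite normrM -mulrA; apply: ler_pM => //.
    have -> : 1 - flip_kernel v / K = - (K^-1 * (flip_kernel v - K)).
      by field; rewrite gt_eqF.
    by rewrite normrN normrM gtr0_norm// invr_gt0.
  move=> /le_trans; apply; rewrite fexpZ.
  have sq : E (fun v => `|flip_kernel v - K|) <= Num.sqrt W.
    rewrite -[leLHS]ger0_norm ?fexp_ge0// -sqrtr_sqr ler_wsqrtr//.
    exact: le_trans (fexp_norm_sqr p0 p1 _) KW.
  apply: (@le_trans _ _ (3 / K * Num.sqrt W)).
    by rewrite ler_wpM2l// divr_ge0// ltW.
  rewrite mulrAC ler_wpM2l ?mulr_ge0 ?sqrtr_ge0//.
  by rewrite lef_pV2 ?posrE.
have b2 : - (pq / s * \sum_j E (err j)) <= 16 * #|J|%:R / (Num.sqrt (pq * c) * c).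
  have e1 : `|\sum_j E (err j)| <= #|J|%:R * (16 / s ^+ 2).
    apply: (le_trans (ler_norm_sum _ _ _)).
    rewrite mulr_natl -sumr_const; apply: ler_sum => j _.
    apply: (@le_trans _ _ (E (fun v => `|err j v|))).
      rewrite ler_norml -fexpN; apply/andP; split; apply: ler_fexp => // v _.
        by rewrite lerNl ler_normr lexx orbT.
      by rewrite ler_norm.
    by rewrite -[leRHS](fexp_cst p1); apply: ler_fexp => // v pv; exact: errb.
  have e2 : - (pq / s * \sum_j E (err j)) <= pq / s * (#|J|%:R * (16 / s ^+ 2)).
    have pqs : 0 <= pq / s by apply: divr_ge0; exact: ltW.
    rewrite -mulrN ler_wpM2l//.
    by move: e1; rewrite ler_norml; lra.
  apply: (le_trans e2).
  have -> : pq / s * (#|J|%:R * (16 / s ^+ 2)) = 16 * #|J|%:R / (s * K).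
    by rewrite s2; field; rewrite !gt_eqF.
  rewrite ler_wpM2l ?mulr_ge0//.
  have sc0 : 0 < Num.sqrt (pq * c) by rewrite sqrtr_gt0 mulr_gt0.
  rewrite lef_pV2 ?posrE ?mulr_gt0//.
  apply: ler_pM => //; first exact: ltW.
  by rewrite /s flip_variance ler_wsqrtr// ler_wpM2l//; exact: ltW.
by rewrite main; lra.
Qed.

End flip_indicators.

(** * Lengths and descents in types B and D *)

Lemma has_word_cons (T I : finType) (s : I -> {perm T}) i w k :
  has_word s w k -> has_word s (s i * w)%g k.+1.
Proof.
move=> /existsP[t /eqP->]; apply/existsP; exists [tuple of i :: t].
by rewrite /= big_cons.
Qed.

Section length_characterization.
Context {T I : finType} (s : I -> {perm T}) (W : {set {perm T}}).
Variable len : {perm T} -> nat.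
Hypothesis W1 : 1%g \in W.
Hypothesis sW : forall i w, w \in W -> (s i * w)%g \in W.
Hypothesis ss : forall i, (s i * s i = 1)%g.
Hypothesis len1 : len 1%g = 0%N.
Hypothesis len_le : forall i w, w \in W -> (len (s i * w)%g <= (len w).+1)%N.
Hypothesis len_desc : forall w, w \in W -> w != 1%g ->
  exists i, (len w = (len (s i * w)%g).+1)%N.

(** A generator raises [len] by at most one, so words are at least [len w] long; following
    generators that lower [len] reaches 1 in exactly [len w] steps. *)
Lemma length_characterization w : w \in W -> length s w = len w.
Proof.
have lew k u : has_word s u k -> u \in W /\ (len u <= k)%N.
  move=> /existsP[t /eqP->] {u}; case: t => t /=/eqP <- {k}.
  elim: t => [|i t [tW tl]]; first by rewrite big_nil len1.
  by rewrite big_cons; split; [exact: sW|exact: leq_trans (len_le _ tW) _].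
have wle u : u \in W -> has_word s u (len u).
  move: {2}(len u) (erefl (len u)) => k; elim: k u => [|k IH] u uk uW.
    have [->|u1] := eqVneq u 1%g.
      by rewrite len1; apply/existsP; exists [tuple]; rewrite big_nil.
    by have [i] := len_desc uW u1; rewrite uk.
  have [u1|u1] := eqVneq u 1%g; first by rewrite u1 len1 in uk.
  have [i iu] := len_desc uW u1.
  rewrite iu -[u]mul1g -(ss i) -mulgA mulgA ss mul1g -[X in has_word _ X]mul1g.
  rewrite -(ss i) -mulgA; apply: has_word_cons; apply: IH; last exact: sW.
  by apply: succn_inj; rewrite -iu.
move=> wW; rewrite /length; case: pselect => [ex|[]]; last first.
  by exists (len w); exact: wle.
case: ex_minnP => k /lew[_ lk] kmin; apply/eqP; rewrite eqn_leq lk.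
by rewrite kmin// wle.
Qed.

End length_characterization.

Lemma strictly_increasing_nat (n : nat) (f : nat -> nat) :
  (forall i, (i.+1 < n)%N -> (f i < f i.+1)%N) -> (forall i, (i < n)%N -> (0 < f i <= n)%N) ->
  forall i, (i < n)%N -> f i = i.+1.
Proof.
move=> fS fn.
have lo i : (i < n)%N -> (i < f i)%N.
  elim: i => [|i IH] ilt; first by have /andP[] := fn _ ilt.
  by apply: leq_ltn_trans (fS _ ilt); apply: IH; exact: ltnW.
have up d i : (i + d < n)%N -> (f i + d <= f (i + d))%N.
  elim: d => [|d IH] idn; first by rewrite !addn0.
  rewrite !addnS in idn *; apply: leq_ltn_trans (fS _ idn); apply: IH; exact: ltnW.
move=> i ilt; apply/eqP; rewrite eqn_leq lo// andbT.
have n1 : (n.-1 < n)%N by lia.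
have := up (n.-1 - i)%N i; rewrite subnKC; last lia.
by move=> /(_ n1); have /andP[_] := fn _ n1; lia.
Qed.

(** * Signed permutations and the generators as maps of integers *)

Section signed_permutations.
Context {m : nat}.
Local Notation n := m.+2.
Implicit Types (x y : signed n) (w : {perm signed n}) (i : 'I_n).

Definition skey x : int := if x.2 then - (x.1.+1%:Z) else x.1.+1%:Z.

Lemma skey_inj : injective skey.
Proof.
move=> [i [|]] [j [|]]; rewrite /skey/= => e; try (exfalso; lia);
  by congr (_, _); apply/val_inj => /=; lia.
Qed.

Lemma skey_sopp x : skey (sopp x) = - skey x.
Proof. by case: x => i [|]; rewrite /skey/= ?opprK. Qed.

Lemma skey_abs x : `|skey x|%N = x.1.+1.
Proof. by case: x => i [|]; rewrite /skey/=; lia. Qed.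

Lemma soppK : involutive (@sopp n).
Proof. by case=> i b; rewrite /sopp/= negbK. Qed.

Lemma BnP w : reflect (forall x, w (sopp x) = sopp (w x)) (w \in Bn n).
Proof. by rewrite inE; apply: forallPP => x; exact: eqP. Qed.

Lemma Bn1 : 1%g \in Bn n. Proof. by apply/BnP => x; rewrite !perm1. Qed.

Lemma BnM u w : u \in Bn n -> w \in Bn n -> (u * w)%g \in Bn n.
Proof. by move=> /BnP hu /BnP hw; apply/BnP => x; rewrite !permM hu hw. Qed.

Lemma BnV w : w \in Bn n -> w^-1%g \in Bn n.
Proof.
by move=> /BnP hw; apply/BnP => x; apply: (@perm_inj _ w); rewrite hw !permKV.
Qed.

Lemma skey_Bn w x : w \in Bn n -> skey (w (sopp x)) = - skey (w x).
Proof. by move=> /BnP ->; rewrite skey_sopp. Qed.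

Lemma ord_predE i : (0 < i)%N -> ord_pred i = i.-1 :> nat.
Proof.
move=> i0 /=; rewrite -(prednK i0) addSn/= modnDr modn_small//.
by have := ltn_ord i; lia.
Qed.

(* The generators act on keys, i.e. on the integers of [±n]. *)
Definition swA (i : nat) (k : int) : int :=
  if k == i%:Z then i.+1%:Z else if k == i.+1%:Z then i%:Z else
  if k == - i%:Z then - i.+1%:Z else if k == - i.+1%:Z then - i%:Z else k.
Definition sw0B (k : int) : int :=
  if k == 1 then -1 else if k == -1 then 1 else k.
Definition sw0D (k : int) : int :=
  if k == 1 then -2%:Z else if k == -2%:Z then 1 else
  if k == -1 then 2 else if k == 2 then -1 else k.

Lemma skey_eq x y : (x == y) = (skey x == skey y).
Proof. by rewrite (inj_eq skey_inj). Qed.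

Lemma skey_sgenA i x : (0 < i)%N -> skey (sgenA i x) = swA i (skey x).
Proof.
move=> i0; have := ord_predE i0; rewrite /sgenA; move: (ord_pred i) => a ai.
have [iv ia] : (i = a.+1 :> nat /\ i != a) by split; [lia|rewrite -val_eqE/=; lia].
have ai' : a != i by rewrite eq_sym.
case: x => j c; rewrite permM.
have [->|ja] := eqVneq j a; [|have [->|ji] := eqVneq j i]; case: c;
  rewrite !permE /= !xpair_eqE/= ?eqxx ?andbT ?andbF/= ?(negbTE ia) ?(negbTE ai')
    ?(negbTE ja) ?(negbTE ji)/= ?permE/= ?xpair_eqE ?eqxx ?andbF ?andbT/=
    ?(negbTE ia) ?(negbTE ai') ?(negbTE ja) ?(negbTE ji)/=;
  rewrite /skey/= /swA; do ?[case: eqP => ?];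
  try (by try move: ja ji; rewrite -?val_eqE/=; lia).
Qed.

Lemma skey_sgenB0 i x : i = 0%N :> nat -> skey (sgenB i x) = sw0B (skey x).
Proof.
move=> i0; rewrite /sgenB i0 eqxx; case: x => j c.
have [->|ji] := eqVneq j i; case: c;
  rewrite !permE /= !xpair_eqE/= ?eqxx ?andbT ?andbF/= ?(negbTE ji)/=;
  rewrite /skey/= /sw0B; do ?[case: eqP => ?];
  by try move: ji; rewrite -?val_eqE/=; lia.
Qed.

Lemma ordS0E i : i = 0%N :> nat -> ordS i = 1%N :> nat.
Proof. by move=> i0; rewrite /= i0. Qed.

Lemma skey_sgenD0 i x : i = 0%N :> nat -> skey (sgenD i x) = sw0D (skey x).
Proof.
move=> i0; have := ordS0E i0; rewrite /sgenD i0 eqxx; move: (ordS i) => a ai.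
have ia : i != a by rewrite -val_eqE/=; lia.
have ai' : a != i by rewrite eq_sym.
case: x => j c; rewrite permM.
have [->|ja] := eqVneq j a; [|have [->|ji] := eqVneq j i]; case: c;
  rewrite !permE /= !xpair_eqE/= ?eqxx ?andbT ?andbF/= ?(negbTE ia) ?(negbTE ai')
    ?(negbTE ja) ?(negbTE ji)/= ?permE/= ?xpair_eqE ?eqxx ?andbF ?andbT/=
    ?(negbTE ia) ?(negbTE ai') ?(negbTE ja) ?(negbTE ji)/=;
  rewrite /skey/= /sw0D; do ?[case: eqP => ?];
  try (by try move: ja ji; rewrite -?val_eqE/=; lia).
Qed.

(* [true] is type B and [false] is type D. *)
Definition sgen (b : bool) i := if b then sgenB i else sgenD i.
Arguments sgen : simpl never.
Definition swk (b : bool) (i : nat) (k : int) : int :=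
  if i == 0%N then (if b then sw0B k else sw0D k) else swA i k.

Lemma skey_sgen b i x : skey (sgen b i x) = swk b i (skey x).
Proof.
rewrite /sgen /swk; case: (posnP i) => [i0|i0].
  by case: b; [exact: skey_sgenB0|exact: skey_sgenD0].
case: b; rewrite /sgenB /sgenD (gtn_eqF i0); exact: skey_sgenA.
Qed.

Lemma swkN b (i : nat) k : k != 0 -> swk b i (- k) = - swk b i k.
Proof.
move=> k0; rewrite /swk; case: (i =P 0%N) => i0; first case: b.
- rewrite /sw0B; do ?[case: eqP => ?]; lia.
- rewrite /sw0D; do ?[case: eqP => ?]; lia.
- rewrite /swA; do ?[case: eqP => ?]; lia.
Qed.

Lemma swkK b (i : nat) k : k != 0 -> swk b i (swk b i k) = k.
Proof.
move=> k0; rewrite /swk; case: (i =P 0%N) => i0; first case: b.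
- by rewrite {2}/sw0B; do ?[case: eqP => ?]; rewrite /sw0B; do ?[case: eqP => ?]; lia.
- by rewrite {2}/sw0D; do ?[case: eqP => ?]; rewrite /sw0D; do ?[case: eqP => ?]; lia.
- by rewrite {2}/swA; do ?[case: eqP => ?]; rewrite /swA; do ?[case: eqP => ?]; lia.
Qed.

Lemma skey_neq0 x : skey x != 0.
Proof. by have := skey_abs x; case: eqP => // ->. Qed.

Lemma sgen_Bn b i : sgen b i \in Bn n.
Proof.
apply/BnP => x; apply: skey_inj.
by rewrite skey_sgen !skey_sopp skey_sgen swkN// skey_neq0.
Qed.

Lemma sgenK b i : (sgen b i * sgen b i = 1)%g.
Proof.
apply/permP => x; rewrite permM perm1; apply: skey_inj.
by rewrite !skey_sgen swkK// skey_neq0.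
Qed.

End signed_permutations.
Arguments sgen : simpl never.

Section inversions.
Context {m : nat}.
Local Notation n := m.+2.
Implicit Types (x y : signed n) (w : {perm signed n}) (i : 'I_n).

Lemma abs_neqP x y : reflect (skey x <> skey y /\ skey x <> - skey y) (x.1 != y.1).
Proof.
apply: (iffP idP) => [xy|[h1 h2]].
  have := skey_abs x; have := skey_abs y; move: xy; rewrite -val_eqE/=.
  by split=> e; move: H H0; rewrite e; lia.
apply/negP => /eqP e; have := skey_abs x; have := skey_abs y; rewrite e; lia.
Qed.

Definition ipair w : {set signed n * signed n} :=
  [set p | [&& skey p.1 < skey p.2, p.1.1 != p.2.1 & skey (w p.2) < skey (w p.1)]].
(** For w in [Bn n] an inversion (x, y) comes together with the distinct inversion (-y, -x), hence
    the half. This is the length in type D; type B adds the number of negative letters. *)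
Definition invD w := #|ipair w|./2.
Definition negc w := #|[set i : 'I_n | skey (w (i, false)) < 0]|.
Definition lenf (b : bool) w := (invD w + (if b then negc w else 0))%N.

(** The simple root of the generator, encoded as the pair of points that it swaps and whose order it
    thereby reverses. *)
Definition sroot b i : signed n * signed n :=
  if i == 0%N :> nat then
    (if b then ((i, true), (i, false)) else ((i, true), (ordS i, false)))
  else ((ord_pred i, false), (i, false)).
Definition desc b i w := skey (w (sroot b i).2) < skey (w (sroot b i).1).

Section flip.
Variables (s : {perm signed n}).
Hypothesis sB : s \in Bn n.
Hypothesis ssK : (s * s = 1)%g.

Let sK x : s (s x) = x. Proof. by rewrite -permM ssK perm1. Qed.

Let sabs x y : (s x).1 != (s y).1 = (x.1 != y.1).
Proof.
suff H u v : u.1 != v.1 -> (s u).1 != (s v).1.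
  by apply/idP/idP => [/H|/H//]; rewrite !sK.
move=> /abs_neqP[h1 h2]; apply/abs_neqP; split=> [/skey_inj/perm_inj e|e].
  by apply: h1; rewrite e.
apply: h2; have : s u = s (sopp v) by apply: skey_inj; rewrite e skey_Bn.
by move=> /perm_inj ->; rewrite skey_sopp.
Qed.

Let sig (p : signed n * signed n) := (s p.1, s p.2).
Let sigK : involutive sig. Proof. by case=> x y; rewrite /sig/= !sK. Qed.

Let S := [set p : signed n * signed n |
  [&& skey p.1 < skey p.2, p.1.1 != p.2.1 & skey (s p.2) < skey (s p.1)]].

Let sig_pos p : skey p.1 < skey p.2 -> p.1.1 != p.2.1 -> p \notin S ->
  skey (s p.1) < skey (s p.2).
Proof.
move=> h1 h2; rewrite inE h1 h2/= -leNgt le_eqVlt => /predU1P[/skey_inj/perm_inj e|//].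
by rewrite e ltxx in h1.
Qed.

Lemma card_ipair_flip0 w : w \in Bn n -> S = finset.set0 ->
  #|ipair (s * w)%g| = #|ipair w|.
Proof.
move=> wB S0; rewrite -(card_imset (mem (ipair w)) (inv_inj sigK)).
apply: eq_card => p.
have nS u : u \notin S by rewrite S0 inE.
apply/idP/imsetP => [|[r + ->]].
  rewrite inE !permM => /and3P[h1 h2 h3]; exists (sig p); last by rewrite sigK.
  by rewrite inE /sig/= sabs h2 h3 sig_pos.
rewrite !inE !permM /sig/= !sK sabs => /and3P[h1 h2 h3].
by rewrite h2 h3 sig_pos.
Qed.

(** Applying s to both entries carries the inversions of w to inversions of [(s * w)%g]; the only
    new ones are the two pairs of [S], whose order s itself reverses. *)
Lemma card_ipair_flip w x y : w \in Bn n ->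
  S = [set (x, y); (sopp y, sopp x)] -> s x = y -> s y = x -> x.1 != y.1 ->
  skey (w x) < skey (w y) -> #|ipair (s * w)%g| = (#|ipair w|.+2)%N.
Proof.
move=> wB SE sx sy xy wxy.
have Sw p : p \in S -> skey (w p.1) < skey (w p.2).
  by rewrite SE !inE => /orP[]/eqP->//=; rewrite !skey_Bn// ltrN2.
have Ssig p : p \in S -> skey (w (s p.2)) < skey (w (s p.1)).
  have /BnP hs := sB.
  by rewrite SE !inE => /orP[]/eqP->/=; rewrite ?hs ?sx ?sy// !skey_Bn// ltrN2.
have c2 : #|S| = 2.
  rewrite SE cards2; suff -> : (x, y) != (sopp y, sopp x) by [].
  by rewrite xpair_eqE negb_and; apply/orP; left; apply: contra xy => /eqP->.
have -> : ipair (s * w)%g = sig @: ipair w :|: S.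
  apply/finset.setP => p; rewrite [RHS]inE; apply/idP/orP => [|[/imsetP[r + ->]|pS]].
  - have [pS _|pS] := boolP (p \in S); [by right|left; apply/imsetP].
    move: H; rewrite inE !permM => /and3P[h1 h2 h3].
    exists (sig p); last by rewrite sigK.
    by rewrite inE /sig/= sabs h2 h3 sig_pos.
  - move=> rw; have rS : r \notin S.
      apply: contraL rw => /Sw wr; rewrite inE.
      by apply/negP => /and3P[_ _ /(lt_trans wr)]; rewrite ltxx.
    move: rw; rewrite !inE !permM /sig/= !sK sabs => /and3P[h1 h2 h3].
    by rewrite h2 h3 sig_pos.
  - have := Ssig _ pS; move: pS; rewrite !inE !permM => /and3P[h1 h2 _] h3.
    by rewrite h1 h2 h3.
rewrite cardsU disjoint_setI0 ?cards0 ?subn0 ?c2 ?card_imset ?addn2//.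
  exact: inv_inj sigK.
rewrite finset.disjoints_subset; apply/fintype.subsetP => p /imsetP[r + ->].
rewrite !inE /sig/= !sK => /and3P[h1 h2 h3]; apply/negP => /and3P[_ _].
by move=> /(lt_trans h1); rewrite ltxx.
Qed.

End flip.
End inversions.

Section lengths.
Context {m : nat}.
Local Notation n := m.+2.
Implicit Types (x y : signed n) (w : {perm signed n}) (i : 'I_n).

Lemma skey_sroot b i :
  skey (sroot b i).1 = (if i == 0%N :> nat then -1 else i%:Z) /\
  skey (sroot b i).2 = (if i == 0%N :> nat then (if b then 1 else 2) else i.+1%:Z).
Proof.
rewrite /sroot; case: (posnP i) => [i0|i0].
  by case: b; rewrite /skey/= i0 ?mod0n.
by have := ord_predE i0; move: (ord_pred i) => a ai; rewrite /skey/= ai prednK.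
Qed.

Lemma sgen_sroot b i :
  sgen b i (sroot b i).1 = (sroot b i).2 /\ sgen b i (sroot b i).2 = (sroot b i).1.
Proof.
have [k1 k2] := skey_sroot b i.
suff : sgen b i (sroot b i).1 = (sroot b i).2.
  by move=> <-; split=> //; rewrite -permM sgenK perm1.
apply: skey_inj; rewrite skey_sgen k1 k2 /swk; case: (posnP i) => [_|i0].
  by case: b {k1 k2}.
by rewrite /swA eqxx.
Qed.

Lemma sroot_abs b i : ~~ (b && (i == 0%N :> nat)) -> (sroot b i).1.1 != (sroot b i).2.1.
Proof.
have [k1 k2] := skey_sroot b i => h; apply/abs_neqP; rewrite k1 k2.
by move: h; case: (posnP i) => [_|i0]; case: b {k1 k2} => //=; lia.
Qed.

Lemma sgen_reversed b i : ~~ (b && (i == 0%N :> nat)) ->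
  [set p : signed n * signed n |
    [&& skey p.1 < skey p.2, p.1.1 != p.2.1 & skey (sgen b i p.2) < skey (sgen b i p.1)]]
  = [set sroot b i; (sopp (sroot b i).2, sopp (sroot b i).1)].
Proof.
move=> hbi; have [k1 k2] := skey_sroot b i; apply/finset.setP => -[x y].
rewrite !inE /= [sroot b i]surjective_pairing !xpair_eqE/= !skey_eq !skey_sopp k1 k2.
rewrite !skey_sgen; have x0 := skey_neq0 x; have y0 := skey_neq0 y.
have aE : reflect (skey x <> skey y /\ skey x <> - skey y) (x.1 != y.1) by exact: abs_neqP.
case: aE => [[h1 h2]|h]; last first.
  rewrite andFb andbF; apply/esym/negbTE/negP => /orP[]/andP[/eqP e1 /eqP e2]; apply: h.
    by rewrite e1 e2; clear k1 k2 e1 e2; move: hbi; case: (posnP i) => [_|i0]; case: b => //=; lia.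
  by rewrite e1 e2; clear k1 k2 e1 e2; move: hbi; case: (posnP i) => [_|i0]; case: b => //=; lia.
move: (skey x) (skey y) x0 y0 h1 h2 => k l k0 l0 h1 h2 {k1 k2 x y}.
rewrite /swk; move: hbi; case: (posnP i) => [i0|i0].
  case: b => //= _; rewrite /sw0D.
  by apply/idP/idP; do ?[case: eqP => ? //=]; lia.
by rewrite andbF => _; rewrite /swA; apply/idP/idP; do ?[case: eqP => ? //=]; lia.
Qed.

Lemma desc_sgen b i w : w \in Bn n -> desc b i (sgen b i * w)%g = ~~ desc b i w.
Proof.
have [e1 e2] := sgen_sroot b i; have [k1 k2] := skey_sroot b i.
move=> wB; rewrite /desc !permM e1 e2 -leNgt le_eqVlt; case: eqP => //= /skey_inj/perm_inj e.
exfalso; have : skey (sroot b i).1 = skey (sroot b i).2 by rewrite e.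
by rewrite k1 k2; clear; case: (posnP i) => [_|]; case: b; lia.
Qed.

Lemma invD_up b i w : w \in Bn n -> ~~ (b && (i == 0%N :> nat)) -> ~~ desc b i w ->
  invD (sgen b i * w)%g = (invD w).+1.
Proof.
move=> wB hbi dw; have [e1 e2] := sgen_sroot b i.
rewrite /invD (card_ipair_flip (sgen_Bn b i) (sgenK b i) wB _ e1 e2 (sroot_abs hbi))//.
  by rewrite sgen_reversed// -surjective_pairing.
have := desc_sgen b i wB; rewrite dw /desc !permM e1 e2; exact.
Qed.

Lemma invD_B0 i w : w \in Bn n -> i = 0%N :> nat -> invD (sgen true i * w)%g = invD w.
Proof.
move=> wB i0; rewrite /invD (card_ipair_flip0 (sgen_Bn true i) (sgenK true i) wB)//.
apply/finset.setP => -[x y]; rewrite !inE !skey_sgen /swk i0/=.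
apply/negbTE/negP => /and3P[h1 /abs_neqP[h2 h3]]; move: (skey_neq0 x) (skey_neq0 y) h1 h2 h3.
by rewrite /sw0B; do ?[case: eqP => ? //=]; lia.
Qed.

(** For i > 0 the generator permutes the positive points among themselves. *)
Lemma negc_up_A b i w : w \in Bn n -> (0 < i)%N -> negc (sgen b i * w)%g = negc w.
Proof.
move=> wB i0; pose f (j : 'I_n) := (sgen b i (j, false)).1.
have fE j : sgen b i (j, false) = (f j, false).
  rewrite [LHS]surjective_pairing; congr (_, _).
  have := skey_sgen b i (j, false); rewrite /swk (gtn_eqF i0) /swA /skey/=.
  by case: (sgen b i (j, false)) => k [|//]/=; do ?[case: eqP => ? //=]; lia.
have fK : involutive f.
  move=> j; have := fE (f j); rewrite -fE -permM sgenK perm1 => -[]; exact: esym.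
rewrite /negc -(card_imset _ (inv_inj fK)); apply: eq_card => j.
apply/imsetP/idP => [[k + ->]|h]; first by rewrite !inE permM fE.
exists (f j); last by rewrite fK.
by move: h; rewrite !inE permM fE fK.
Qed.

Lemma negcS w : negc w = (\sum_(i < n) (skey (w (i, false)) < 0)%R)%N.
Proof.
rewrite /negc -sum1dep_card big_mkcond/=; apply: eq_bigr => i _.
by case: (_ < _).
Qed.

Lemma negc_flip (a : 'I_n) (u w : {perm signed n}) :
  (forall j, j != a -> (skey (u (j, false)) < 0) = (skey (w (j, false)) < 0)) ->
  (negc u + (skey (w (a, false)) < 0)%R = negc w + (skey (u (a, false)) < 0)%R)%N.
Proof.
move=> h; rewrite !negcS (bigD1 a)//= [in RHS](bigD1 a)//= addnAC [RHS]addnAC.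
congr (_ + _)%N; first exact: addnC.
by apply: eq_bigr => j ja; rewrite h.
Qed.

Lemma negc_up_B0 i w : w \in Bn n -> i = 0%N :> nat -> ~~ desc true i w ->
  negc (sgen true i * w)%g = (negc w).+1.
Proof.
move=> wB i0 dw; have dsw := desc_sgen true i wB.
have sr : sroot true i = ((i, true), (i, false)) by rewrite /sroot i0.
have tE u : u \in Bn n -> skey (u (i, true)) = - skey (u (i, false)).
  by move=> uB; rewrite -skey_Bn.
have uB := BnM (sgen_Bn true i) wB.
have := @negc_flip i (sgen true i * w)%g w.
move: dw dsw; rewrite /desc sr /= !tE// => dw; rewrite dw => dsw.
have -> : (skey (w (i, false)) < 0) = false by have := skey_neq0 (w (i, false)); lia.
have -> : (skey ((sgen true i * w)%g (i, false)) < 0) = true by lia.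
rewrite addn0 addn1; apply=> j ji; rewrite permM; congr (skey (w _) < 0).
apply: skey_inj; rewrite skey_sgen /swk i0/= /sw0B /skey/=.
by move: ji; rewrite -val_eqE/= => ji; do ?[case: eqP => ? //=]; lia.
Qed.

Lemma lenf_up b i w : w \in Bn n -> ~~ desc b i w ->
  lenf b (sgen b i * w)%g = (lenf b w).+1.
Proof.
move=> wB dw; rewrite /lenf; case: b dw => dw; last by rewrite invD_up// !addn0.
case: (posnP i) => [i0|i0].
  by rewrite invD_B0// negc_up_B0// addnS.
by rewrite invD_up// ?(gtn_eqF i0)// negc_up_A.
Qed.

Lemma lenf_down b i w : w \in Bn n -> desc b i w ->
  lenf b w = (lenf b (sgen b i * w)%g).+1.
Proof.
move=> wB dw; have h := @lenf_up b i _ (BnM (sgen_Bn b i) wB).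
by rewrite mulgA sgenK mul1g desc_sgen// dw in h; exact: h.
Qed.

Definition Wg (b : bool) : {set {perm signed n}} := if b then Bn n else Dn n.

Lemma negcE w : negc w = #|[set i : 'I_n | (w (i, false)).2]|.
Proof. by apply: eq_card => i; rewrite !inE /skey; case: (w _).2 => /=; lia. Qed.

Lemma DnE w : (w \in Dn n) = (w \in Bn n) && ~~ odd (negc w).
Proof. by rewrite inE negcE. Qed.

Lemma Wg_Bn b w : w \in Wg b -> w \in Bn n.
Proof. by case: b => //=; rewrite DnE => /andP[]. Qed.

Lemma Wg1 b : 1%g \in Wg b.
Proof.
case: b; rewrite /Wg; first exact: Bn1; rewrite DnE Bn1/= /negc.
by rewrite (_ : [set _ | _] = finset.set0) ?cards0//; apply/finset.setP => i; rewrite !inE perm1.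
Qed.

(** The first two letters trade places and both change sign, so the parity survives. *)
Lemma odd_negc_D0 i w : w \in Bn n -> i = 0%N :> nat ->
  odd (negc (sgen false i * w)%g) = odd (negc w).
Proof.
move=> wB i0; have [e1 e2] := sgen_sroot false i.
have sr : sroot false i = ((i, true), (ordS i, false)) by rewrite /sroot i0.
move: e1 e2; rewrite {}sr/= => e1 e2.
move: (ordS0E i0) e1 e2; move: (ordS i) => a av e1 e2.
have ia : a != i by rewrite -val_eqE/= av i0.
have si : sgen false i (i, false) = (a, true).
  have /BnP h := sgen_Bn false i; apply: (can_inj soppK).
  by rewrite -h /sopp/= e1.
have tE (v : {perm signed n}) j : v \in Bn n -> skey (v (j, true)) = - skey (v (j, false)).
  by move=> vB; rewrite -skey_Bn.
pose c := (\sum_(j < n | (j != i) && (j != a)) (skey (w (j, false)) < 0)%R)%N.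
have ng (v : {perm signed n}) : (forall j, j != i -> j != a -> v (j, false) = w (j, false)) ->
    odd (negc v) = (skey (v (i, false)) < 0) (+) (skey (v (a, false)) < 0) (+) odd c.
  move=> hv; rewrite negcS (bigD1 i)//= (bigD1 a)//= addnA !oddD !oddb.
  congr (_ (+) odd _); apply: eq_bigr => j /andP[ji ja]; by rewrite hv.
rewrite (ng w)// ng; last first.
  move=> j ji ja; rewrite permM; congr (w _); apply: skey_inj.
  rewrite skey_sgen /swk i0/= /sw0D /skey/=.
  move: ji ja; rewrite -!val_eqE/= av i0 => ji ja.
  by do ?[case: eqP => ? //=]; lia.
rewrite !permM si e2 !tE//; have := skey_neq0 (w (i, false)).
have := skey_neq0 (w (a, false)); move: (skey _) (skey _) => k l k0 l0.
have neg (x : int) : x != 0 -> (- x < 0) = ~~ (x < 0) by lia.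
by rewrite !neg//; case: (k < 0); case: (l < 0); case: (odd c).
Qed.

Lemma sgen_Wg b i w : w \in Wg b -> (sgen b i * w)%g \in Wg b.
Proof.
move=> wW; have wB := Wg_Bn wW; have swB := BnM (sgen_Bn b i) wB.
case: b wW swB => // /=; rewrite !DnE => /andP[_ ow] ->/=.
by case: (posnP i) => i0; [rewrite odd_negc_D0|rewrite negc_up_A].
Qed.

Lemma key_increasing w : w \in Bn n ->
  (forall i j : 'I_n, j = i.+1 :> nat -> (`|skey (w (i, false))| < `|skey (w (j, false))|)%N) ->
  forall i, `|skey (w (i, false))|%N = i.+1.
Proof.
move=> wB incr i; pose f k := `|skey (w (inord k, false))|%N.
rewrite -[i in LHS]inord_val -/(f i); apply: (@strictly_increasing_nat n f) => // k kn.
  by apply: incr; rewrite !inordK//; exact: ltnW.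
by rewrite /f skey_abs ltn_ord.
Qed.

(** The ascents make the letters increase, and the one at s_0 gives |w(1)| < w(2); so the absolute
    values increase strictly within 1, ..., n and |w(i)| = i. *)
Lemma no_desc_1 b w : w \in Wg b -> (forall i, ~~ desc b i w) -> w = 1%g.
Proof.
move=> wW nd; have wB := Wg_Bn wW.
have step (i j : 'I_n) : j = i.+1 :> nat -> skey (w (i, false)) < skey (w (j, false)).
  move=> ji; have j0 : (0 < j)%N by rewrite ji.
  have := nd j; rewrite /desc /sroot (gtn_eqF j0) /=.
  have := ord_predE j0; move: (ord_pred j) => a av; have -> : a = i by apply/val_inj; rewrite /= av ji.
  rewrite -leNgt le_eqVlt => /predU1P[/skey_inj/perm_inj[e]|//].
  by move: ji; rewrite e; lia.
have i1n : (1 < n)%N by [].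
pose i0 : 'I_n := ord0; pose i1 : 'I_n := Ordinal i1n.
have step0 : (`|skey (w (i0, false))| < `|skey (w (i1, false))|)%N /\
    0 < skey (w (i1, false)).
  have := nd i0; rewrite /desc /sroot /=.
  have tE (v : {perm signed n}) j : v \in Bn n -> skey (v (j, true)) = - skey (v (j, false)).
    by move=> vB; rewrite -skey_Bn.
  have := step i0 i1 (erefl _); have := skey_neq0 (w (i0, false)).
  case: b {wW nd}; rewrite /= tE//.
    by move: (skey (w (i0, false))) (skey (w (i1, false))) => k l; lia.
  have -> : ordS i0 = i1 by apply/val_inj.
  have : (skey (w (i0, true)) <> skey (w (i1, false))).
    by move=> /skey_inj/perm_inj[].
  by rewrite tE//; move: (skey (w (i0, false))) (skey (w (i1, false))) => k l; lia.
have pos (i : 'I_n) : (0 < i)%N -> 0 < skey (w (i, false)).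
  case: i => -[|k] kn // _; elim: k kn => [|k IH] kn; first by have [_] := step0; congr (_ < skey (w (_, _))); apply/val_inj.
  have kn' : (k.+1 < n)%N by exact: ltnW.
  exact: lt_trans (IH kn') (@step (Ordinal kn') (Ordinal kn) (erefl _)).
have absE : forall i, `|skey (w (i, false))|%N = i.+1.
  apply: key_increasing => // i j ji; have [i00|ip] := posnP i.
    have -> : i = i0 by apply/val_inj.
    have -> : j = i1 by apply/val_inj; rewrite /= ji i00.
    by have [] := step0.
  have := step _ _ ji; have := pos _ ip; lia.
(* In type B this is the ascent at s_0; in type D a negative first letter would be the only negative
   one, against the parity. *)
have pos0 : 0 < skey (w (i0, false)).
  case: b wW nd => [_ nd|wW nd].
    have := nd i0; rewrite /desc /sroot /= -[(i0, true)]/(sopp (i0, false)) skey_Bn//.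
    by have := skey_neq0 (w (i0, false)); lia.
  move: wW; rewrite /Wg DnE negcS big_ord_recl big1 => [|j _].
    by rewrite -[ord0]/i0; have := skey_neq0 (w (i0, false)); case: ltP => //=; lia.
  by have := pos (lift ord0 j) (ltn0Sn _); case: ltP => //=; lia.
have wE (i : 'I_n) : w (i, false) = (i, false).
  apply: skey_inj; rewrite [RHS]/skey/=; have := absE i.
  have : 0 < skey (w (i, false)).
    have [e|/pos//] := posnP i.
    by move: pos0; congr (_ < skey (w (_, _))); exact/val_inj.
  by move: (skey (w (i, false))) => k; lia.
apply/permP => -[i [|]]; rewrite perm1//.
by rewrite -[(i, true)]/(sopp (i, false)); have /BnP -> := wB; rewrite wE.
Qed.

Lemma length_lenf b w : w \in Wg b -> length (sgen b) w = lenf b w.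
Proof.
apply: length_characterization => {w}.
- exact: Wg1.
- by move=> i w; exact: sgen_Wg.
- exact: sgenK.
- have e0 : ipair (1%g : {perm signed n}) = finset.set0.
    apply/finset.setP => p; rewrite !inE !perm1; apply/negbTE/negP => /and3P[h1 _].
    by move=> /(lt_trans h1); rewrite ltxx.
  rewrite /lenf /invD e0 cards0 add0n; case: b => //.
  by rewrite negcS big1// => i _; rewrite perm1.
- move=> i w /Wg_Bn wB; case: (boolP (desc b i w)) => dw; last by rewrite lenf_up.
  by rewrite (lenf_down wB dw); lia.
- move=> w wW w1; have : ~~ [forall i, ~~ desc b i w].
    by apply: contra w1 => /forallP h; apply/eqP; exact: no_desc_1 wW h.
  rewrite negb_forall => /existsP[i]; rewrite negbK => dw.
  by exists i; exact: lenf_down (Wg_Bn wW) dw.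
Qed.

Lemma length_desc b i w : w \in Wg b ->
  (length (sgen b) (sgen b i * w)%g < length (sgen b) w)%N = desc b i w.
Proof.
move=> wW; rewrite !length_lenf ?sgen_Wg//; have wB := Wg_Bn wW.
case: (boolP (desc b i w)) => dw; first by rewrite (lenf_down wB dw); lia.
by rewrite (lenf_up wB dw); lia.
Qed.

End lengths.

(** * Descents in one-line notation, braid relations and exchange *)

Section exchange.
Context {m : nat}.
Local Notation n := m.+2.
Implicit Types (x y : signed n) (w : {perm signed n}) (i j : 'I_n) (b : bool).

Definition unkey (k : int) : signed n := (inord (`|k|%N.-1), k < 0).

Lemma unkeyK (k : int) : k != 0 -> (`|k| <= n)%N -> skey (unkey k) = k.
Proof.
move=> k0 kn; rewrite /unkey /skey/= inordK; last lia.
by case: ltP => h /=; lia.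
Qed.

Lemma skeyK x : unkey (skey x) = x.
Proof.
apply: skey_inj; rewrite unkeyK ?skey_neq0// skey_abs; exact: ltn_ord.
Qed.

(* The one-line notation of [w], as a function on the integers of [±n]. *)
Definition wval w (k : int) : int := skey (w (unkey k)).

Lemma wval_skey w x : skey (w x) = wval w (skey x).
Proof. by rewrite /wval skeyK. Qed.

Lemma wvalN w (k : int) : w \in Bn n -> k != 0 -> (`|k| <= n)%N ->
  wval w (- k) = - wval w k.
Proof.
move=> wB k0 kn; rewrite /wval -skey_Bn//; congr (skey (w _)).
by apply: skey_inj; rewrite skey_sopp !unkeyK//; lia.
Qed.

Lemma wval_neq0 w k : wval w k != 0. Proof. exact: skey_neq0. Qed.

Lemma wval_abs w k : (0 < `|wval w k| <= n)%N.
Proof. by rewrite /wval skey_abs ltn_ord. Qed.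

Lemma wval_inj w (k l : int) : k != 0 -> (`|k| <= n)%N -> l != 0 -> (`|l| <= n)%N ->
  wval w k = wval w l -> k = l.
Proof.
move=> k0 kn l0 ln /skey_inj/perm_inj e.
by rewrite -(unkeyK k0 kn) -(unkeyK l0 ln) e.
Qed.

Lemma wval_sgen b i w k : k != 0 -> (`|k| <= n)%N ->
  wval (sgen b i * w)%g k = wval w (swk b i k).
Proof.
by move=> k0 kn; rewrite /wval permM -[in RHS]/(wval w _) -{2}(unkeyK k0 kn) -skey_sgen -wval_skey.
Qed.

Lemma wval_mulsgen b j w k : wval (w * sgen b j)%g k = swk b j (wval w k).
Proof. by rewrite /wval permM skey_sgen. Qed.

Lemma desc_wval b i w : w \in Bn n -> desc b i w =
  if i == 0%N :> nat then (if b then wval w 1 < 0 else wval w 2 < - wval w 1)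
  else wval w i.+1%:Z < wval w i%:Z.
Proof.
move=> wB; rewrite /desc !wval_skey; have [-> ->] := skey_sroot b i.
case: (posnP i) => [i0|//]; rewrite wvalN//; case: b => //.
by have := wval_neq0 w 1; move: (wval w 1) => k; lia.
Qed.

Lemma desc_sgen_wval b i j w : w \in Bn n -> desc b j (sgen b i * w)%g =
  (wval w (swk b i (if j == 0%N :> nat then (if b then 1 else 2) else j.+1%:Z)) <
   wval w (swk b i (if j == 0%N :> nat then -1 else j%:Z))).
Proof.
move=> wB; rewrite /desc !permM !(wval_skey w) !skey_sgen.
by have [-> ->] := skey_sroot b j.
Qed.

(** The bonds of the Coxeter diagram; in type D, s_0 is joined to s_2 and not to s_1. *)
Definition adjacent b i j : bool :=
  if i == 0%N :> nat then j == (if b then 1 else 2)%N :> nat else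
  if j == 0%N :> nat then i == (if b then 1 else 2)%N :> nat else
  (j == i.+1 :> nat) || (i == j.+1 :> nat).

Lemma desc_far b i j w : w \in Bn n -> i != j -> ~~ adjacent b i j ->
  desc b j (sgen b i * w)%g = desc b j w.
Proof.
move=> wB; rewrite desc_sgen_wval// desc_wval// /adjacent /swk -val_eqE/=.
have := ltn_ord i; have := ltn_ord j; move: (nat_of_ord i) (nat_of_ord j) => {}i {}j jn iN.
have N1 : wval w (-1) = - wval w 1 by exact: wvalN.
have N2 : wval w (- 2%:Z) = - wval w 2 by exact: wvalN.
have z1 := wval_neq0 w 1.
case: (posnP i) => [i0|i0]; case: (posnP j) => [j0|j0]; first by rewrite i0 j0.
- case: b => ij h.
    have -> : sw0B j.+1%:Z = j.+1%:Z by rewrite /sw0B; do ?[case: eqP => ? //=]; lia.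
    by have -> : sw0B j%:Z = j%:Z by rewrite /sw0B; do ?[case: eqP => ? //=]; lia.
  have [->|j1] := eqVneq j 1%N.
    by rewrite /sw0D/= N1 N2 ltrN2.
  have -> : sw0D j.+1%:Z = j.+1%:Z by rewrite /sw0D; do ?[case: eqP => ? //=]; lia.
  by have -> : sw0D j%:Z = j%:Z by rewrite /sw0D; do ?[case: eqP => ? //=]; lia.
- case: b => ij h.
    have -> : swA i 1 = 1 by rewrite /swA; do ?[case: eqP => ? //=]; lia.
    have -> : swA i (-1) = -1 by rewrite /swA; do ?[case: eqP => ? //=]; lia.
    by rewrite N1; move: (wval w 1) z1 => k; lia.
  have [->|i1] := eqVneq i 1%N.
    by rewrite /swA/= N2; move: (wval w 1) (wval w 2) => k l; lia.
  have -> : swA i 2 = 2 by rewrite /swA; do ?[case: eqP => ? //=]; lia.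
  have -> : swA i (-1) = -1 by rewrite /swA; do ?[case: eqP => ? //=]; lia.
  by rewrite N1.
move=> ij h.
have -> : swA i j.+1%:Z = j.+1%:Z by rewrite /swA; do ?[case: eqP => ? //=]; lia.
by have -> : swA i j%:Z = j%:Z by rewrite /swA; do ?[case: eqP => ? //=]; lia.
Qed.

(** Turning an ascent into a descent gives a neighbouring generator a smaller left entry or a larger
    right entry to compare, which makes its descent harder. *)
Lemma desc_mono b i j w : w \in Bn n -> i != j -> ~~ desc b i w ->
  desc b j (sgen b i * w)%g -> desc b j w.
Proof.
move=> wB ij; case: (boolP (adjacent b i j)) => [|far _]; last by rewrite desc_far.
move: ij; rewrite desc_sgen_wval// !desc_wval// /adjacent /swk -val_eqE/=.
have := ltn_ord i; have := ltn_ord j; move: (nat_of_ord i) (nat_of_ord j) => {}i {}j jn iN.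
have N1 : wval w (-1) = - wval w 1 by exact: wvalN.
have N2 : wval w (- 2%:Z) = - wval w 2 by exact: wvalN.
have z1 := wval_neq0 w 1; have z2 := wval_neq0 w 2.
case: (posnP i) => [i0|i0]; case: (posnP j) => [j0|j0]; first by rewrite i0 j0.
- by case: b => _ /eqP->; rewrite /sw0B /sw0D/= N1; move: (wval w 1) (wval w 2) (wval w 3) z1 z2 => k l r; lia.
- by case: b => _ /eqP->; rewrite /swA/= ?N1 ?N2; move: (wval w 1) (wval w 2) (wval w 3) z1 z2 => k l r; lia.
move=> _ /orP[]/eqP e.
  have -> : swA i j.+1%:Z = j.+1%:Z by rewrite /swA; do ?[case: eqP => ? //=]; lia.
  have -> : swA i j%:Z = i%:Z by rewrite /swA; do ?[case: eqP => ? //=]; lia.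
  by rewrite e; move: (wval w _) (wval w _) (wval w _) => a c d; lia.
have -> : swA i j.+1%:Z = i.+1%:Z by rewrite /swA; do ?[case: eqP => ? //=]; lia.
have -> : swA i j%:Z = j%:Z by rewrite /swA; do ?[case: eqP => ? //=]; lia.
by rewrite -e; move: (wval w _) (wval w _) (wval w _) => a c d; lia.
Qed.

(* The third reflection of the rank two subgroup generated by [i], [i+1]. *)
Lemma desc_braid b i j w : w \in Bn n -> (0 < i)%N -> j = i.+1 :> nat ->
  desc b j (sgen b i * w)%g = desc b i (sgen b j * w)%g.
Proof.
move=> wB i0 e; rewrite !desc_sgen_wval// /swk e (gtn_eqF i0)/=.
congr (wval w _ < wval w _); rewrite /swA; do ?[case: eqP => ? //=]; lia.
Qed.

(** Equal outcomes at (i, i+1) and (i+1, i+2) decide (i, i+2) by transitivity, and s_i brings just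
    those two entries side by side. *)
Lemma desc_braid_trans b i j w : w \in Bn n -> (0 < i)%N -> j = i.+1 :> nat ->
  desc b i w = desc b j w -> desc b j (sgen b i * w)%g = desc b i w.
Proof.
move=> wB i0 e; rewrite desc_sgen_wval// !desc_wval// /swk e (gtn_eqF i0)/=.
have -> : swA i i.+2%:Z = i.+2%:Z by rewrite /swA; do ?[case: eqP => ? //=]; lia.
have -> : swA i i.+1%:Z = i%:Z by rewrite /swA; do ?[case: eqP => ? //=]; lia.
have ne (k l : nat) : (0 < k <= n)%N -> (0 < l <= n)%N -> k <> l -> wval w k%:Z <> wval w l%:Z.
  by move=> kn ln kl /wval_inj e1; apply: kl; have := e1 ltac:(lia) ltac:(lia) ltac:(lia) ltac:(lia); lia.
have jn := ltn_ord j; rewrite e in jn.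
have := ne i i.+1 ltac:(lia) ltac:(lia) ltac:(lia).
have := ne i.+1 i.+2 ltac:(lia) ltac:(lia) ltac:(lia).
have := ne i i.+2 ltac:(lia) ltac:(lia) ltac:(lia).
by do 3 ?case: ltP; lia.
Qed.

Lemma sgen_inj b : injective (sgen b : 'I_n -> _).
Proof.
move=> i j e; apply/val_inj/eqP => /=; apply/negPn/negP => ij.
have [k1 k2] := skey_sroot b i; have [l1 l2] := skey_sroot b j.
have := sgen_sroot b j; rewrite -e => -[e1 _].
have := congr1 skey e1; rewrite skey_sgen l1 l2.
have := sgen_sroot b i; rewrite e => -[e2 _].
have := congr1 skey e2; rewrite skey_sgen k1 k2.
rewrite /swk; clear -ij.
by case: (posnP i) => ?; case: (posnP j) => ?; case: b;
  rewrite /sw0B /sw0D /swA; do ?[case: eqP => ? //=]; lia.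
Qed.

Lemma swk_reversed b j (k l : int) : ~~ (b && (j == 0%N :> nat)) ->
  k != 0 -> l != 0 -> k <> - l -> k < l -> swk b j l < swk b j k ->
  (swk b j k = l /\ swk b j l = k).
Proof.
move=> hb k0 l0 kl lt; rewrite /swk; move: hb; case: (posnP j) => [j0|j0].
  by case: b => //= _; rewrite /sw0D; do ?[case: eqP => ? //=]; lia.
by rewrite andbF => _; rewrite /swA; do ?[case: eqP => ? //=]; lia.
Qed.
End exchange.

Section exchange_property.
Context {m : nat}.
Local Notation n := m.+2.
Implicit Types (x y : signed n) (w : {perm signed n}) (i j : 'I_n) (b : bool).

Lemma swk_orbit b (j : nat) (k r : int) : k != 0 -> r != 0 ->
  swk b j k <> k -> swk b j r <> r ->
  [\/ r = k, r = swk b j k, r = - k | r = - swk b j k].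
Proof.
move=> k0 r0 hk hr.
suff : [|| r == k, r == swk b j k, r == - k | r == - swk b j k].
  by case/or4P => /eqP; [constructor 1|constructor 2|constructor 3|constructor 4].
move: hk hr; rewrite /swk; case: (posnP j) => [j0|j0].
  by case: b; rewrite /sw0B /sw0D; do ?[case: eqP => ? //=]; lia.
by rewrite /swA; do ?[case: (_ =P _) => ? //=]; lia.
Qed.

Lemma sgen_orbit b j x y : sgen b j x <> x -> sgen b j y <> y ->
  [\/ y = x, y = sgen b j x, y = sopp x | y = sopp (sgen b j x)].
Proof.
move=> hx hy.
have hx' : swk b j (skey x) <> skey x by rewrite -skey_sgen => /skey_inj.
have hy' : swk b j (skey y) <> skey y by rewrite -skey_sgen => /skey_inj.
case: (swk_orbit (skey_neq0 x) (skey_neq0 y) hx' hy') => e; [constructor 1|constructor 2|constructor 3|constructor 4];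
  by apply: skey_inj; rewrite ?skey_sopp ?skey_sgen.
Qed.

(** The points moved by a generator are x, its image and their negatives, so agreement at one moved
    point spreads to all of them; w then matches the fixed points too. *)
Lemma sgen_conj b i j w x : w \in Bn n -> sgen b i x <> x ->
  sgen b j (w x) = w (sgen b i x) -> (sgen b i * w = w * sgen b j)%g.
Proof.
move=> wB hx e; have /BnP wo := wB; have /BnP so := sgen_Bn b j.
have /BnP sio := sgen_Bn b i.
have sK c (k : 'I_n) z : sgen c k (sgen c k z) = z by rewrite -permM sgenK perm1.
have hwx : sgen b j (w x) <> w x by rewrite e => /perm_inj.
have sopp_inj := inv_inj (@soppK m).
apply/permP => z; rewrite !permM.
have [sz|/eqP sz] := eqVneq (sgen b i z) z; last first.
  have e2 : sgen b j (w (sgen b i x)) = w x by rewrite -e sK.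
  case: (sgen_orbit hx sz) => ->; rewrite ?sio ?wo ?so ?sK ?e ?e2 ?sio ?wo ?sK//.
rewrite sz; have [//|/eqP nz] := eqVneq (sgen b j (w z)) (w z).
exfalso; case: (sgen_orbit hwx nz); rewrite ?e -?wo => /perm_inj ez; move: sz; rewrite ez ?sio ?sK.
- exact: hx.
- by move=> /esym/hx.
- by move=> /sopp_inj/hx.
- by move=> /sopp_inj/esym/hx.
Qed.

(** The descent changes only if s_j reverses the two values of w on the simple root of i. Opposite
    values aside, a generator reverses only pairs that it swaps, and [sgen_conj] applies. *)
Lemma desc_exchange b i j w : w \in Bn n ->
  desc b i (w * sgen b j)%g != desc b i w -> (sgen b i * w = w * sgen b j)%g.
Proof.
move=> wB; have [e1 e2] := sgen_sroot b i; have [k1 k2] := skey_sroot b i.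
have xy : (sroot b i).1 <> (sroot b i).2.
  by move=> /(congr1 skey); rewrite k1 k2; clear; case: (posnP i) => [_|]; case: b; lia.
rewrite /desc !permM !skey_sgen.
have -> (A B : bool) : (A != B) = A && ~~ B || ~~ A && B by case: A B => -[].
move=> h.
apply: (@sgen_conj _ _ _ _ (sroot b i).1) => //; first by rewrite e1 => /esym.
rewrite e1; apply: skey_inj; rewrite skey_sgen.
set k := skey (w (sroot b i).1) in h *; set l := skey (w (sroot b i).2) in h *.
have k0 : k != 0 := skey_neq0 _; have l0 : l != 0 := skey_neq0 _.
have kl : k <> l by move=> /skey_inj/perm_inj.
(* Opposite values occur only at s_0 in type B, where the descent is the sign of w(1); only s_0
   changes a sign, and only that of 1 and -1. *)
have [kNl|/eqP kNl] := eqVneq k (- l).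
  have bi : b && (i == 0%N :> nat).
    apply/negPn/negP => /sroot_abs/abs_neqP[_ hh]; apply: hh.
    have : w (sroot b i).1 = w (sopp (sroot b i).2).
      by apply: skey_inj; rewrite skey_Bn.
    by move=> /perm_inj ->; rewrite skey_sopp.
  move: h; rewrite kNl swkN//; case/andP: bi => -> _.
  rewrite /swk; case: (posnP j) => [j0|j0].
    by rewrite /sw0B; move: (l) l0 => r r0; clear -r0; do ?[case: eqP => ? //=]; lia.
  by rewrite /swA; move: (l) l0 => r r0; clear -r0 j0; do ?[case: eqP => ? //=]; lia.
have hb : ~~ (b && (j == 0%N :> nat)).
  apply/negP => /andP[bt /eqP j0]; move: h; rewrite bt /swk j0/= /sw0B.
  by move: (k) (l) k0 l0 kl kNl => r t; clear; do ?[case: eqP => ? //=]; lia.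
case: (ltP k l) => [klt|]; last rewrite le_eqVlt => /predU1P[e|lk].
- have rev : swk b j l < swk b j k.
    by move: h; rewrite (lt_gtF klt) !(andbT, andbF, orbF).
  by have [-> _] := swk_reversed hb k0 l0 kNl klt rev.
- by case: kl.
have nrev : ~~ (swk b j l < swk b j k).
  by move: h; rewrite lk !(andbT, andbF).
have rev : swk b j k < swk b j l.
  rewrite ltNge le_eqVlt (negbTE nrev) orbF; apply/negP => /eqP e.
  by apply: kl; rewrite -(swkK b j k0) -(swkK b j l0) e.
have [|_ ->//] := swk_reversed hb l0 k0 _ lk rev.
by move=> lNk; apply: kNl; rewrite lNk opprK.
Qed.

End exchange_property.

(** * Insertion of letters *)

Section insertion.
Context {m : nat}.
Local Notation n := m.+2.
Implicit Types (x y c : signed n) (w v : {perm signed n}).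

Lemma sgenB_A_idx (i : 'I_n) x : (0 < i)%N ->
  (sgen true i x).1 = (if x.1 == i.-1 :> nat then i : nat else
                       if x.1 == i :> nat then i.-1 else x.1) :> nat /\
  (sgen true i x).2 = x.2.
Proof.
move=> i0; have := skey_sgen true i x; rewrite /swk (gtn_eqF i0).
case: (sgen true i x) => j c'; case: x => l c /=; rewrite /skey/= /swA.
by case: c'; case: c; do ?[case: eqP => ? //=]; split=> //; lia.
Qed.

Lemma sgenB_0_idx (i : 'I_n) x : i = 0%N :> nat ->
  (sgen true i x).1 = x.1 /\ (sgen true i x).2 = x.2 (+) (x.1 == 0%N :> nat).
Proof.
move=> i0; have := skey_sgen true i x; rewrite /swk i0/=.
case: (sgen true i x) => j c'; case: x => l c /=; rewrite /skey/= /sw0B.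
by case: c'; case: c; do ?[case: eqP => ? //=]; split=> //; try (apply/val_inj => /=); lia.
Qed.

(* Inserting the letter [k] in position [c] of a word of length [k] moves the
   letters in positions [>= c] one step to the right. *)
Definition zidx (k a j : nat) : nat :=
  if (j < a)%N then j else if j == a then k else if (j <= k)%N then j.-1 else j.

Lemma zidx_lt k a j : (k < n)%N -> (j < n)%N -> (zidx k a j < n)%N.
Proof. by rewrite /zidx; do ?[case: ifP => ?]; lia. Qed.

Lemma zidx_inj k a i j : (a <= k)%N -> zidx k a i = zidx k a j -> i = j.
Proof. by rewrite /zidx; do ?[case: ifP => ?]; lia. Qed.

Definition zfun (k : nat) c x : signed n :=
  (inord (zidx k c.1 x.1), x.2 (+) (c.2 && (x.1 == c.1))).

Lemma zfun_inj (k : nat) c : (c.1 <= k < n)%N -> injective (zfun k c).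
Proof.
move=> /andP[ck kn] x y [] /(congr1 val)/=.
rewrite !inordK ?zidx_lt// => /(zidx_inj ck)/val_inj e e2.
by case: x y e e2 => i b [j b'] /= -> /addIb ->.
Qed.

(** The dependent match hands the range condition to [zfun_inj]; out of range the value is 1. *)
Definition zperm (k : nat) c : {perm signed n} :=
  (if (c.1 <= k < n)%N as t return (c.1 <= k < n)%N = t -> {perm signed n}
   then fun h => perm (@zfun_inj k c h) else fun=> 1%g) erefl.

Lemma zpermE k c x : (c.1 <= k < n)%N -> zperm k c x = zfun k c x.
Proof.
move=> h; rewrite /zperm; move: erefl; rewrite {2 3}h => h'.
by rewrite permE.
Qed.

Lemma zperm_Bn k c : (c.1 <= k < n)%N -> zperm k c \in Bn n.
Proof.
by move=> h; apply/BnP => x; rewrite !zpermE// /zfun /sopp/= addNb.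
Qed.

Lemma zperm_top k c : (c.1 <= k < n)%N -> zperm k c c = (inord k, false).
Proof.
move=> h; rewrite zpermE// /zfun /zidx ltnn eqxx eqxx andbT.
by rewrite addbb.
Qed.

Lemma zperm_id k : (k < n)%N -> zperm k (inord k, false) = 1%g.
Proof.
move=> kn; apply/permP => x; rewrite zpermE /= ?inordK ?leqnn// /zfun/= inordK//.
rewrite addbF perm1 [RHS]surjective_pairing; congr (_, _); apply/val_inj.
by rewrite /= inordK ?zidx_lt//; rewrite /zidx; do ?[case: ifP => ?]; lia.
Qed.

(** Moving the inserted letter by one place is a generator: a positive letter travels left from the
    end, a negative one right from the front, and the weight can be tracked step by step. *)
Lemma zperm_stepA k (a i : 'I_n) (b : bool) : (a <= k < n)%N -> (i <= k)%N ->
  (0 < i)%N -> (if b then i = a.+1 :> nat else i = a :> nat) ->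
  (sgen true i * zperm k (a, b) = zperm k (if b then i else ord_pred i, b))%g.
Proof.
move=> ak ik i0 hia; move: (ord_pred i) (ord_predE i0) => i' ip.
apply/permP => x; have [e1 e2] := sgenB_A_idx x i0.
have ck : ((if b then i else i', b).1 <= k < n)%N by case: b hia => /= e; rewrite ?ip; lia.
rewrite permM !zpermE// {ck}.
have xn := ltn_ord x.1.
rewrite /zfun; congr (_, _).
  congr inord; rewrite {}e1 {e2}; move: (nat_of_ord x.1) xn => l xn.
  case: b hia => /= e; rewrite ?ip;
    (case: (l =P i.-1 :> nat) => [el|el]; [|case: (l =P i :> nat) => el']);
    by rewrite /zidx; do ?[case: ifP => ?]; lia.
rewrite /= e2; congr (_ (+) _); case: b hia => //= e.
rewrite -!(inj_eq val_inj)/= {}e1; move: (nat_of_ord x.1) xn => l xn; rewrite e/=.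
by (case: (l =P a) => [->|el]; [|case: (l =P a.+1) => el']); rewrite ?eqxx; lia.
Qed.

Lemma zperm_step0 k (i : 'I_n) : (k < n)%N -> i = 0%N :> nat ->
  (sgen true i * zperm k (i, false) = zperm k (i, true))%g.
Proof.
move=> kn i0; apply/permP => x; have [e1 e2] := sgenB_0_idx x i0.
rewrite permM !zpermE/= ?i0// /zfun e1 e2 /= addbF; congr (_, _ (+) _).
by rewrite -val_eqE/= i0.
Qed.

Definition Wk (k : nat) : {set {perm signed n}} :=
  [set w in Bn n | [forall x : signed n, (k <= x.1)%N ==> (w x == x)]].

Lemma WkP k w : reflect (w \in Bn n /\ forall x, (k <= x.1)%N -> w x = x) (w \in Wk k).
Proof.
rewrite [X in reflect _ X]inE; apply: (iffP andP) => -[wB h]; split=> //.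
  by move=> x kx; apply/eqP; move/forallP : h => /(_ x)/implyP; apply.
by apply/forallP => x; apply/implyP => kx; apply/eqP; exact: h.
Qed.

Lemma Wk_n : Wk n = Bn n.
Proof.
apply/finset.setP => w; apply/WkP/idP => [[]//|wB]; split=> // x.
by rewrite leqNgt ltn_ord.
Qed.

Lemma Wk_0 : Wk 0 = [set 1%g].
Proof.
apply/finset.setP => w; rewrite [RHS]inE; apply/WkP/eqP => [[_ h]|->].
  by apply/permP => x; rewrite h// perm1.
by split=> [|x _]; [exact: Bn1|rewrite perm1].
Qed.

Lemma zperm_Wk k c : (c.1 <= k < n)%N -> zperm k c \in Wk k.+1.
Proof.
move=> h; apply/WkP; split=> [|x kx]; first exact: zperm_Bn.
rewrite zpermE// /zfun [RHS]surjective_pairing; congr (_, _).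
  have -> : zidx k c.1 x.1 = x.1 by rewrite /zidx; do ?[case: ifP => ?]; lia.
  exact: inord_val.
suff /negbTE-> : x.1 != c.1 by rewrite andbF addbF.
by apply/eqP => e; move: h kx; rewrite e; lia.
Qed.

(** The place c is recovered from the product as the position of its top letter, so the
    decomposition of [Wk k.+1] is unique. *)
Lemma zperm_mulWk k c v : (c.1 <= k < n)%N ->
  ((zperm k c * v)%g \in Wk k.+1) && ((zperm k c * v)^-1%g (inord k, false) == c)
  = (v \in Wk k).
Proof.
move=> h; have [zB zf] := WkP _ _ (zperm_Wk h).
have zt := zperm_top h; have kn : (k < n)%N by case/andP : h.
apply/andP/idP => [[/WkP[zvB zvf] /eqP e]|/WkP[vB vf]].
  have vtop : v (inord k, false) = (inord k, false).
    by have := congr1 (zperm k c * v)%g e; rewrite permKV permM zt => <-.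
  have vB : v \in Bn n.
    by rewrite -[v]mul1g -(mulVg (zperm k c)) -mulgA; apply: BnM => //; exact: BnV.
  apply/WkP; split=> // x; rewrite leq_eqVlt => /predU1P[kx|kx].
    have [->|->] : x = (inord k, false) \/ x = sopp (inord k, false).
      have e1 : x.1 = inord k by apply/val_inj; rewrite /= inordK.
      by case: x {kx} e1 => [i [|]] /= ->; [right|left].
    - exact: vtop.
    - by have /BnP -> := vB; rewrite vtop.
  by have := zvf x kx; rewrite permM zf.
split; last first.
  apply/eqP; apply: (@perm_inj _ (zperm k c * v)%g); rewrite permKV permM zt vf//=.
  by rewrite inordK.
apply/WkP; split=> [|x kx]; first exact: BnM.
by rewrite permM zf// vf// ltnW.
Qed.

Lemma sum_Wk_rec (R : realType) k (F : {perm signed n} -> R) : (k < n)%N ->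
  \sum_(w in Wk k.+1) F w =
  \sum_(c : signed n | (c.1 <= k)%N) \sum_(v in Wk k) F (zperm k c * v)%g.
Proof.
move=> kn.
rewrite (partition_big (fun w : {perm signed n} => w^-1%g (inord k, false)) (fun c => (c.1 <= k)%N))/=.
  apply: eq_bigr => c ck; have h : (c.1 <= k < n)%N by rewrite ck.
  rewrite (reindex_inj (mulgI (zperm k c))); apply: eq_bigl => v.
  exact: zperm_mulWk.
move=> w /WkP[wB wf]; rewrite leqNgt; apply/negP => kx.
have := wf _ kx; rewrite permKV => e; move: kx; rewrite -e/= inordK//.
by rewrite ltnn.
Qed.

Lemma unkeyS l : unkey l.+1%:Z = (inord l, false) :> signed n.
Proof. by []. Qed.

Lemma wval_zperm k c v l : (c.1 <= k < n)%N -> v \in Wk k -> (l <= k)%N ->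
  wval (zperm k c * v)%g l.+1%:Z = if (l < c.1)%N then wval v l.+1%:Z else
    if l == c.1 then (if c.2 then - k.+1%:Z else k.+1%:Z) else wval v l%:Z.
Proof.
move=> h /WkP[_ vf] lk; have kn : (k < n)%N by case/andP : h.
have ln : (l < n)%N by exact: leq_ltn_trans kn.
rewrite /wval permM unkeyS zpermE// /zfun/= inordK// /zidx.
have -> : (inord l == c.1) = (l == c.1) by rewrite -val_eqE/= inordK.
case: ltnP => lc; first by rewrite (ltn_eqF lc) andbF.
case: eqVneq => [_|lc']; first by rewrite andbT vf /skey/= inordK//=; case: c.2.
rewrite lk andbF; case: l lc lc' {lk ln} => [|l _ _]; last by [].
by rewrite leqn0 => /eqP ->; rewrite eqxx.
Qed.

Lemma Wk_lt k v x : v \in Wk k -> (x.1 < k)%N -> ((v x).1 < k)%N.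
Proof.
move=> /WkP[_ vf] xk; rewrite ltnNge; apply/negP => kx.
by have /perm_inj e := vf _ kx; move: kx; rewrite e leqNgt xk.
Qed.

Lemma wval_Wk_le k v l : (k <= n)%N -> v \in Wk k -> (0 < l <= k)%N -> (`|wval v l%:Z| <= k)%N.
Proof.
case: l => // l kn vW /= lk; rewrite /wval unkeyS skey_abs; apply: Wk_lt => //=.
by rewrite inordK//; exact: leq_trans kn.
Qed.

Context {R : realType} (q q0 : R).

Definition mwt w : R := q ^+ invD w * q0 ^+ negc w.

(** Each of the d steps from the end to place a carries the largest letter leftwards over a smaller
    one, creating one inversion. *)
Lemma mwt_zperm_false k v d (a : 'I_n) : (k < n)%N -> v \in Wk k -> (a + d)%N = k ->
  mwt (zperm k (a, false) * v)%g = q ^+ d * mwt v.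
Proof.
move=> kn vW; elim: d a => [|d IH] a ad.
  by rewrite (_ : a = inord k) ?zperm_id// ?mul1g ?mul1r//; apply/val_inj; rewrite /= inordK//; lia.
have an : (a.+1 < n)%N by lia.
pose i : 'I_n := inord a.+1; have iv : i = a.+1 :> nat by rewrite inordK.
have i0 : (0 < i)%N by rewrite iv.
have ik : (i <= k < n)%N by lia.
have zs := @zperm_stepA k i i false ik ltac:(lia) i0 erefl.
have pa : ord_pred i = a by apply/ord_inj; rewrite ord_predE// iv.
rewrite /= pa in zs; rewrite -zs -mulgA.
have zB : (zperm k (i, false) * v)%g \in Bn n by apply: BnM; [exact: zperm_Bn|case/WkP : vW].
have nd : ~~ desc true i (zperm k (i, false) * v)%g.
  rewrite desc_wval// (gtn_eqF i0) iv !wval_zperm ?iv//=; try lia.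
  rewrite ltnn eqxx ltnSn; have := @wval_Wk_le k v a.+1; move: (wval v _) => z; lia.
rewrite /mwt invD_up// ?(gtn_eqF i0)// negc_up_A// exprS -mulrA -/(mwt _) IH; last lia.
by rewrite exprS mulrA.
Qed.

(** The letter travels k steps to the front, changes sign at the price [q0], and returns a steps to
    the right, creating an inversion at every step. *)
Lemma mwt_zperm_true k v (a : 'I_n) : (k < n)%N -> v \in Wk k -> (a <= k)%N ->
  mwt (zperm k (a, true) * v)%g = q0 * q ^+ (k + a) * mwt v.
Proof.
move=> kn vW; have [l] := ubnP (a : nat); elim: l a => // l IH a al ak.
have vB : v \in Bn n by case/WkP : vW.
case: (posnP a) => a0.
  have zs := zperm_step0 kn a0; rewrite -zs -mulgA.
  have h : (a <= k < n)%N by lia.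
  have zB : (zperm k (a, false) * v)%g \in Bn n by apply: BnM => //; exact: zperm_Bn.
  have nd : ~~ desc true a (zperm k (a, false) * v)%g.
    by rewrite desc_wval// a0 wval_zperm//= a0.
  have e0 := mwt_zperm_false kn vW (d := k) (a := a) ltac:(lia); rewrite /mwt in e0.
  rewrite /mwt invD_B0// negc_up_B0// exprS mulrCA e0.
  by rewrite (_ : k + a = k)%N ?mulrA// a0 addn0.
have ha := ltn_ord a.
have [i iv] : exists i : 'I_n, i = a.-1 :> nat by exists (ord_pred a); exact: ord_predE.
have ik : (i <= k < n)%N by lia.
have e1 : a = i.+1 :> nat by lia.
have zs := @zperm_stepA k i a true ik ak a0 e1.
rewrite /= in zs; rewrite -zs -mulgA.
have zB : (zperm k (i, true) * v)%g \in Bn n by apply: BnM => //; exact: zperm_Bn.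
have nd : ~~ desc true a (zperm k (i, true) * v)%g.
  rewrite desc_wval// (gtn_eqF a0) [X in _ < wval _ X%:Z]e1 !wval_zperm//=; try lia.
  rewrite ltnn eqxx e1 ltnNge leqnSn gtn_eqF//= -e1.
  have := @wval_Wk_le k v a; move: (wval v _) => z; lia.
rewrite /mwt invD_up// ?(gtn_eqF a0)// negc_up_A// exprS -mulrA -/(mwt _) IH; [|lia|lia].
by rewrite -/(mwt v) e1 addnS exprS !mulrA [q * q0]mulrC.
Qed.
End insertion.

Section insertion_sum.
Context {R : realType}.
Implicit Types (S f h : nat -> R).

(* Inserting at position [a] breaks the pair [(a - 1, a)] and moves the later
   pairs one step to the right. *)
Definition ins_coef S (a l : nat) : R :=
  if (l.+1 < a)%N then S l else if l.+1 == a then 0 else S l.+1.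

(** Old pairs are collected with their new weights; the last two terms are the pairs formed by the
    inserted letter with its left and right neighbours. *)
Lemma sum_insertion S f h (a k : nat) : (a <= k)%N ->
  (forall l, (l.+1 < a)%N -> f l = h l) ->
  (forall l, (a < l < k)%N -> f l = h l.-1) ->
  \sum_(l < k) S l * f l = \sum_(l < k.-1) ins_coef S a l * h l +
    ((0 < a)%:R * (S a.-1 * f a.-1) + (a < k)%:R * (S a * f a)).
Proof.
move=> ak flo; elim: k ak => [|k IH] ak fhi.
  by move: ak; rewrite leqn0 => /eqP ->; rewrite !big_ord0 !mul0r !addr0.
rewrite big_ord_recr/=; move: ak; rewrite leq_eqVlt => /predU1P[ak|ak].
  rewrite ak ltnn mul0r addr0 mul1r; congr (_ + _); apply: eq_bigr => l _.
  by rewrite /ins_coef ltnS ltn_ord flo ?ak ?ltnS.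
rewrite IH//; last by move=> l /andP[al lk]; rewrite fhi// al ltnW.
rewrite ak; move: ak; rewrite ltnS leq_eqVlt orbC; case: (ltnP a k) => /= [ak _|_ /eqP ak].
  case: k ak IH fhi => // k ak _ fhi; rewrite big_ord_recr/= {3}/ins_coef.
  rewrite (ltnNge k.+1) (ltnW ak)/= (gtn_eqF ak) (fhi k.+1); [|lia].
  by rewrite /=; ring.
rewrite -ak mul0r addr0 mul1r -addrA; congr (_ + _).
case: a {ak flo fhi IH} => [|a]; first by rewrite !big_ord0.
by rewrite big_ord_recr/= [ins_coef _ _ a]/ins_coef ltnn eqxx mul0r addr0.
Qed.

Lemma ins_coef_ge0_le1 S a l : (forall j, 0 <= S j <= 1) -> 0 <= ins_coef S a l <= 1.
Proof. by rewrite /ins_coef => S01; case: ifP => // _; case: ifP => // _; rewrite lexx ler01. Qed.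

Lemma ins_coef_dist S a k : (forall j, 0 <= S j <= 1) ->
  (forall l, (0 < l)%N -> (l.+1 < k)%N -> S l.+1 <= S l) ->
  \sum_(l < k.-1) `|ins_coef S a l - S l| <= 3.
Proof.
move=> S01 Sd; case: k Sd => [|[|k]] Sd; rewrite ?big_ord0 //=.
(* The indicator pays for the broken pair, 1 for index 0 where no monotonicity is assumed, and the
   other differences telescope. *)
have B K : (K.+1 < k.+2)%N ->
    \sum_(l < K.+1) `|ins_coef S a l - S l| <= (a <= K.+1)%:R + 1 + (S 1%N - S K.+1).
  elim: K => [|K IH] Kk.
    rewrite big_ord1/= /ins_coef; have := S01 0%N; have := S01 1%N.
    move: (S 0%N) (S 1%N) => x y hy hx.
    case: ifP => _; first by rewrite subrr normr0; case: leq => /=; lra.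
    by case: ifP => _; rewrite ler_norml; case: leq => /=; lra.
  rewrite big_ord_recr/=; have := IH (ltnW Kk); move: (\sum_(_ < _) _ : R) => s hs.
  have d := Sd K.+1 isT Kk; have := S01 K.+1; have := S01 K.+2; rewrite /ins_coef.
  move: (S K.+2) (S K.+1) (S 1%N) d hs => x y t d hs hx hy.
  case: (ltngtP K.+2 a) => h.
  - by rewrite subrr normr0; move: hs; rewrite (leqNgt a) (ltnW h)/=; lra.
  - by rewrite ler0_norm; [move: hs; case: leq => /=; lra|lra].
  - by move: hs; rewrite -h ltnn/= sub0r normrN ger0_norm; lra.
apply: (le_trans (B k _)) => //; have := S01 1%N; have := S01 k.+1.
by case: leq => /=; lra.
Qed.
End insertion_sum.

(** * Adjacency counts under insertion *)

Section adjacency_chain.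
Context {m : nat}.
Local Notation n := m.+2.
Implicit Types (x y c : signed n) (w v : {perm signed n}).

(* Positions [l], [l + 1] (from 0) carry consecutive values of equal sign; the
   values 1 and -1 do not count, as they differ by 2. *)
Definition zeta w (l : nat) : bool := `|wval w l.+1%:Z - wval w l.+2%:Z|%N == 1%N.

Lemma wval_topE k v l s : v \in Bn n -> (k < n)%N -> (l < n)%N ->
  (wval v l.+1%:Z == (if s then - k.+1%:Z else k.+1%:Z)) =
  (v^-1%g (inord k, false) == (inord l, s)).
Proof.
move=> vB kn ln; have -> : (if s then - k.+1%:Z else k.+1%:Z) = skey ((inord k : 'I_n), s).
  by rewrite /skey/= inordK//; case: s.
rewrite /wval unkeyS -skey_eq; apply/eqP/eqP => e.
  apply: (@perm_inj _ v); rewrite permKV; have /BnP vo := vB.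
  case: s e => e; last by rewrite e.
  by have := vo (inord l, false); rewrite e => ->.
have := congr1 v e; rewrite permKV; have /BnP vo := vB.
case: s {e} => e; last by rewrite -e.
have := vo (inord l, true); rewrite -e /sopp/= => ->; by [].
Qed.

Lemma zeta_zperm_lo k c v l : (c.1 <= k < n)%N -> v \in Wk k -> (l.+1 < c.1)%N ->
  zeta (zperm k c * v)%g l = zeta v l.
Proof.
move=> h vW lc; rewrite /zeta !wval_zperm//; try lia.
by rewrite lc (ltn_trans (ltnSn l) lc).
Qed.

Lemma zeta_zperm_hi k c v l : (c.1 <= k < n)%N -> v \in Wk k -> (c.1 < l < k)%N ->
  zeta (zperm k c * v)%g l = zeta v l.-1.
Proof.
move=> h vW /andP[cl lk]; case: l cl lk => // l cl lk.
rewrite /zeta !wval_zperm//; try lia.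
rewrite (ltnNge l.+1) (ltnW cl)/= (gtn_eqF cl) (ltnNge l.+2) (leqW (ltnW cl))/=.
by rewrite (gtn_eqF (leqW cl)).
Qed.

(** All other letters have absolute value at most k, so the new letter k + 1 is adjacent only to the
    letter k of equal sign: only the place of the previous top letter matters. *)
Lemma zeta_zperm_left k c v : (c.1 <= k < n)%N -> v \in Wk k -> (0 < c.1)%N ->
  zeta (zperm k c * v)%g c.1.-1 = (v^-1%g (inord k.-1, false) == (inord c.1.-1, c.2)).
Proof.
move=> h vW c0; case/andP: (h) => ck kn.
rewrite /zeta !wval_zperm//; try lia.
rewrite prednK// leqnn ltnn eqxx -wval_topE; [|by case/WkP : vW|lia|lia].
have := @wval_Wk_le _ k v c.1 ltac:(lia) vW ltac:(lia).
by rewrite !prednK; try lia; move: (wval v _) => z; case: c.2; lia.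
Qed.

Lemma zeta_zperm_right k c v : (c.1 < k < n)%N -> v \in Wk k ->
  zeta (zperm k c * v)%g c.1 = (v^-1%g (inord k.-1, false) == (inord c.1, c.2)).
Proof.
move=> /andP[ck kn] vW; rewrite /zeta !wval_zperm//; try lia.
rewrite ltnn eqxx ltnNge leqnSn (gtn_eqF (ltnSn _))/=.
rewrite -wval_topE ?(leq_ltn_trans (leq_pred k))//; last by case/WkP : vW.
have := @wval_Wk_le _ k v c.1.+1 ltac:(lia) vW ltac:(lia).
by rewrite !prednK; try lia; move: (wval v _) => z; case: c.2; lia.
Qed.

Context {R : realType} (q : R) (e : nat).
Hypothesis q0 : 0 < q.
Implicit Types (S : nat -> R) (g : signed n -> R).

Definition Qs k S w : R := \sum_(l < k.-1) S l * (zeta w l)%:R.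

Definition ins_gain k S c y : R :=
  ((0 < c.1)%N && (y == (inord c.1.-1, c.2)))%:R * S c.1.-1 +
  ((c.1 < k)%N && (y == (inord c.1, c.2)))%:R * S c.1.

Lemma Qs_zperm k S c v : (c.1 <= k < n)%N -> v \in Wk k ->
  Qs k.+1 S (zperm k c * v)%g =
  Qs k (ins_coef S c.1) v + ins_gain k S c (v^-1%g (inord k.-1, false)).
Proof.
move=> h vW; case/andP: (h) => ck kn.
rewrite /Qs (@sum_insertion _ S (fun l => (zeta (zperm k c * v)%g l)%:R)
  (fun l => (zeta v l)%:R) c.1 k)//.
- congr (_ + _); rewrite /ins_gain; congr (_ + _).
    case: (posnP c.1) => [->|c0]; first by rewrite !mul0r.
    by rewrite zeta_zperm_left// mul1r mulrC.
  case: ltnP => ck'; last by rewrite !mul0r.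
  by rewrite zeta_zperm_right ?ck'// mul1r mulrC.
- by move=> l lc; rewrite zeta_zperm_lo.
- by move=> l lc; rewrite zeta_zperm_hi.
Qed.

(** The previous top letter cannot stand on both sides of the new one. *)
Lemma ins_gain_ge0_le1 k S c y : (forall j, 0 <= S j <= 1) -> 0 <= ins_gain k S c y <= 1.
Proof.
move=> S01; rewrite /ins_gain; have := S01 c.1; have := S01 c.1.-1.
move: (S c.1) (S c.1.-1) => s t hs ht.
case: (eqVneq y (inord c.1.-1, c.2)) => [->|_]; last first.
  by rewrite andbF; case: ((c.1 < k)%N && _) => /=; lra.
case: (posnP c.1) => c0; first by rewrite /=; case: ((_ < k)%N && _) => /=; lra.
have cn := ltn_ord c.1; have cn' : (c.1.-1 < n)%N by exact: leq_ltn_trans (leq_pred _) cn.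
have cc : (c.1.-1 < c.1)%N by rewrite prednK.
by rewrite xpair_eqE eqxx andbT -val_eqE/= !inordK// (ltn_eqF cc) andbF/=; lra.
Qed.

(* The sign exponent [e] is 1 for the Mallows measure of type B; [e = 0] gives the
   weight [q ^+ invD], whose restriction to [Dn] is that of type D. *)
Definition kap k c : R := if c.2 then q ^+ e * q ^+ (k + c.1) else q ^+ (k - c.1).
Definition kaptot k : R := \sum_(c : signed n | (c.1 <= k)%N) kap k c.
Definition pik k c : R := if (c.1 <= k)%N then kap k c / kaptot k else 0.
Definition Zk k : R := \sum_(w in @Wk m k) mwt q (q ^+ e) w.
Definition pk k w : R := if w \in Wk k then mwt q (q ^+ e) w / Zk k else 0.

Lemma mwt_zperm k c v : (c.1 <= k < n)%N -> v \in Wk k ->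
  mwt q (q ^+ e) (zperm k c * v)%g = kap k c * mwt q (q ^+ e) v.
Proof.
move=> /andP[ck kn] vW; rewrite /kap; case: c ck => a [|] /= ck.
  by rewrite mwt_zperm_true.
by apply: mwt_zperm_false => //; lia.
Qed.

Lemma mwt_gt0 w : 0 < mwt q (q ^+ e) w.
Proof. by rewrite /mwt mulr_gt0// !exprn_gt0. Qed.

Lemma kap_gt0 k c : 0 < kap k c.
Proof. by rewrite /kap; case: c.2; rewrite ?mulr_gt0 ?exprn_gt0. Qed.

Lemma kaptot_gt0 k : 0 < kaptot k.
Proof.
rewrite /kaptot (bigD1 (ord0, false))//=; apply: ltr_pwDl; first exact: kap_gt0.
by apply: sumr_ge0 => c _; apply/ltW/kap_gt0.
Qed.

Lemma Wk1 k : 1%g \in @Wk m k.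
Proof. by apply/WkP; split=> [|x _]; [exact: Bn1|rewrite perm1]. Qed.

Lemma Zk_gt0 k : 0 < Zk k.
Proof.
rewrite /Zk (bigD1 1%g) ?Wk1//=; apply: ltr_pwDl; first exact: mwt_gt0.
by apply: sumr_ge0 => c _; apply/ltW/mwt_gt0.
Qed.

Lemma pik_ge0 k c : 0 <= pik k c.
Proof. by rewrite /pik; case: ifP => // _; rewrite ltW// divr_gt0 ?kap_gt0 ?kaptot_gt0. Qed.

Lemma pk_ge0 k w : 0 <= pk k w.
Proof. by rewrite /pk; case: ifP => // _; rewrite ltW// divr_gt0 ?mwt_gt0 ?Zk_gt0. Qed.

Lemma pik_sum k : \sum_c pik k c = 1.
Proof. by rewrite -big_mkcond -mulr_suml divff// gt_eqF// kaptot_gt0. Qed.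

Lemma pk_sum k : \sum_w pk k w = 1.
Proof. by rewrite -big_mkcond -mulr_suml divff// gt_eqF// Zk_gt0. Qed.

Lemma pk_supp k w : pk k w != 0 -> w \in Wk k.
Proof. by rewrite /pk; case: ifP => //; rewrite eqxx. Qed.

Lemma pik_supp k c : pik k c != 0 -> (c.1 <= k)%N.
Proof. by rewrite /pik; case: ifP => //; rewrite eqxx. Qed.

Lemma Zk_rec k : (k < n)%N -> Zk k.+1 = kaptot k * Zk k.
Proof.
move=> kn; rewrite /Zk sum_Wk_rec// /kaptot mulr_suml; apply: eq_bigr => c ck.
by rewrite mulr_sumr; apply: eq_bigr => v vW; rewrite mwt_zperm// ck.
Qed.

(** The weight factors by [mwt_zperm], so the insertion place is independent of the shorter word. *)
Lemma pk_rec k (G : {perm signed n} -> R) : (k < n)%N ->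
  fexp (pk k.+1) G = fexp (pk k) (fun v => fexp (pik k) (fun c => G (zperm k c * v)%g)).
Proof.
move=> kn; rewrite /fexp.
transitivity (\sum_(w in Wk k.+1) mwt q (q ^+ e) w / Zk k.+1 * G w).
  rewrite [RHS]big_mkcond; apply: eq_bigr => w _; rewrite /pk.
  by case: ifP => // _; rewrite mul0r.
rewrite sum_Wk_rec// exchange_big/= big_mkcond/=; apply: eq_bigr => v _.
rewrite /pk; case: ifP => [vW|_]; last by rewrite mul0r.
rewrite mulr_sumr big_mkcond/=; apply: eq_bigr => c _.
rewrite /pik; case: ifP => ck; last by rewrite mul0r mulr0.
rewrite mwt_zperm ?ck// Zk_rec// mulrA; congr (_ * _).
by rewrite invfM; ring.
Qed.

(** With both signs added up the inequality becomes (1 - q)(1 - q^s) >= 0, true for q on either side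
    of 1; the two signs taken separately are monotone in opposite directions. *)
Lemma pik_mono k (a : nat) : (a < k)%N -> (k < n)%N ->
  fexp (pik k) (fun c => (c.1 == a :> nat)%:R) <=
  fexp (pik k) (fun c => (c.1 == a.+1 :> nat)%:R).
Proof.
move=> ak kn.
have E b : (b <= k)%N -> fexp (pik k) (fun c => (c.1 == b :> nat)%:R) =
    (q ^+ (k - b) + q ^+ e * q ^+ (k + b)) / kaptot k.
  move=> bk; have bn : (b < n)%N by exact: leq_ltn_trans kn.
  rewrite /fexp (eq_bigr (fun c => (fun i d => pik k (i, d) * (i == b :> nat)%:R) c.1 c.2)); last by case.
  rewrite -(pair_big xpredT xpredT (fun i d => pik k (i, d) * (i == b :> nat)%:R))/=.
  rewrite (bigD1 (inord b))//= [X in _ + X]big1 ?addr0; last first.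
    move=> i; rewrite -val_eqE/= inordK// => /negbTE ->.
    by rewrite big1// => d _; rewrite mulr0.
  rewrite !big_bool/= inordK// eqxx !mulr1 /pik /kap/= inordK// bk addrC mulrDl.
  by [].
rewrite !E//; last exact: ltnW.
apply: ler_wpM2r; first by rewrite invr_ge0 ltW// kaptot_gt0.
set t := (k - a.+1)%N; have -> : (k - a = t.+1)%N by rewrite /t; lia.
have -> : (k + a = t + (a.*2).+1)%N by rewrite /t; lia.
have -> : (k + a.+1 = (t + (a.*2).+1).+1)%N by rewrite /t; lia.
set s := (e + (a.*2).+1)%N.
have -> : q ^+ e * q ^+ (t + (a.*2).+1) = q ^+ t * q ^+ s.
  by rewrite /s -!exprD; congr (_ ^+ _); lia.
have -> : q ^+ e * q ^+ (t + (a.*2).+1).+1 = q ^+ t * (q * q ^+ s).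
  by rewrite /s -exprS -!exprD; congr (_ ^+ _); lia.
rewrite exprS; have t0 : 0 < q ^+ t by exact: exprn_gt0.
suff : 0 <= (1 - q) * (1 - q ^+ s) by nra.
have [q1|/ltW q1] := leP q 1.
  by rewrite mulr_ge0// subr_ge0// exprn_ile1// ltW.
by rewrite mulr_le0// subr_le0// exprn_ege1.
Qed.

Definition mean_coef k S l : R := fexp (pik k) (fun c => ins_coef S c.1 l).

Lemma mean_coef_ge0_le1 k S l : (forall j, 0 <= S j <= 1) -> 0 <= mean_coef k S l <= 1.
Proof.
move=> S01; apply/andP; split.
  by apply: fexp_ge0 => [c|c]; [exact: pik_ge0|case/andP : (ins_coef_ge0_le1 c.1 l S01)].
rewrite -[leRHS](fexp_cst (pik_sum k)); apply: ler_fexp => [c|c _]; first exact: pik_ge0.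
by case/andP : (ins_coef_ge0_le1 c.1 l S01).
Qed.

(* Positions further right are likelier ([pik_mono]), so the pairs further right
   are broken more often. *)
Lemma mean_coef_decr k S : (k < n)%N -> (forall j, 0 <= S j <= 1) ->
  (forall l, (0 < l)%N -> (l.+1 < k)%N -> S l.+1 <= S l) ->
  forall l, (0 < l)%N -> (l.+2 < k)%N -> mean_coef k S l.+1 <= mean_coef k S l.
Proof.
move=> kn S01 Sd l l0 lk.
have p0 := pik_ge0 k; have p1 := pik_sum k.
pose P a := fexp (pik k) (fun c => (c.1 == a :> nat)%:R).
have s0 : 0 <= S l.+1 by case/andP : (S01 l.+1).
(* Both coefficients are compared with [S l.+1]: place l + 2 breaks pair l + 1, place l + 1 breaks
   pair l, and elsewhere the monotonicity of [S] decides. *)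
have up : mean_coef k S l.+1 <= S l.+1 * (1 - P l.+2).
  rewrite mulrBr mulr1 -{1}[S l.+1](fexp_cst p1) -fexpZ -fexpB; apply: ler_fexp => // c ck.
  have {}ck := pik_supp ck; rewrite /ins_coef; case: (ltngtP l.+2 c.1) => h /=.
  - by rewrite mulr0 subr0.
  - by rewrite mulr0 subr0 Sd.
  - by rewrite mulr1 subrr.
have lo : S l.+1 * (1 - P l.+1) <= mean_coef k S l.
  rewrite mulrBr mulr1 -{1}[S l.+1](fexp_cst p1) -fexpZ -fexpB; apply: ler_fexp => // c ck.
  rewrite /ins_coef; case: (ltngtP l.+1 c.1) => h /=.
  - by rewrite mulr0 subr0 Sd// ltnW.
  - by rewrite mulr0 subr0.
  - by rewrite mulr1 subrr.
apply: (le_trans up); apply: le_trans lo.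
by rewrite ler_wpM2l// lerD2l lerN2 pik_mono// ltnW.
Qed.

Lemma Qs_mean k S v :
  fexp (pik k) (fun c => Qs k (ins_coef S c.1) v) = Qs k (mean_coef k S) v.
Proof.
rewrite /Qs fexp_sum; apply: eq_bigr => l _; rewrite /mean_coef mulrC -fexpZ.
by apply: eq_fexp => c; rewrite mulrC.
Qed.

Lemma Qs_dist k S c v : (forall j, 0 <= S j <= 1) ->
  (forall l, (0 < l)%N -> (l.+1 < k)%N -> S l.+1 <= S l) ->
  `|Qs k (ins_coef S c.1) v - Qs k S v| <= 3.
Proof.
move=> S01 Sd; rewrite /Qs -sumrB; apply: (le_trans (ler_norm_sum _ _ _)).
apply: le_trans (ins_coef_dist c.1 S01 Sd); apply: ler_sum => l _.
by rewrite -mulrBl normrM; case: zeta; rewrite /= ?normr1 ?normr0 ?mulr1 ?mulr0.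
Qed.

(* The term [g] absorbs the pair created by the last insertion, which depends on
   the shorter word only through the position of its largest letter.  Each step
   costs [(3 + 1 + 1) ^ 2], for [Qs_dist], [ins_gain] and [g]. *)
Lemma fvar_Qs k S g : (k <= n)%N -> (forall j, 0 <= S j <= 1) ->
  (forall l, (0 < l)%N -> (l.+2 < k)%N -> S l.+1 <= S l) -> (forall y, 0 <= g y <= 1) ->
  fvar (pk k) (fun w => Qs k S w + g (w^-1%g (inord k.-1, false))) <= 25 * k%:R.
Proof.
elim: k S g => [|k IH] S g kn S01 Sd g01.
  rewrite (_ : 25 * 0 = 0 ^+ 2 :> R); last by rewrite mulr0 expr2 mulr0.
  apply: (@fvar_dev _ _ _ _
    (Qs 0 S 1%g + g ((1 : {perm signed n})^-1%g (inord 0.-1, false)))) => [w||w /pk_supp].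
  - exact: pk_ge0.
  - exact: pk_sum.
  - by rewrite Wk_0 => /set1P ->; rewrite subrr normr0.
pose gm y := fexp (pik k) (fun c => ins_gain k S c y).
have gm01 y : 0 <= gm y <= 1.
  apply/andP; split.
    by apply: fexp_ge0 => [c|c]; [exact: pik_ge0|case/andP : (ins_gain_ge0_le1 k c y S01)].
  rewrite -[leRHS](fexp_cst (pik_sum k)); apply: ler_fexp => [c|c _]; first exact: pik_ge0.
  by case/andP : (ins_gain_ge0_le1 k c y S01).
have zE c v : (c.1 <= k)%N -> v \in Wk k ->
    Qs k.+1 S (zperm k c * v)%g + g ((zperm k c * v)^-1%g (inord k, false)) =
    Qs k (ins_coef S c.1) v + ins_gain k S c (v^-1%g (inord k.-1, false)) + g c.
  move=> ck vW; have h : (c.1 <= k < n)%N by rewrite ck.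
  rewrite Qs_zperm//; congr (_ + g _).
  by have := zperm_mulWk v h; rewrite vW => /andP[_ /eqP].
(* Given the shorter word, the value stays within 5 of [Qs k S v]; the conditional mean is again of
   the form to which the induction hypothesis applies, up to the constant mean of [g]. *)
apply: (le_trans (fvar_fiber (pk_ge0 k) (pk_sum k) (pik_sum k) (fun G => pk_rec G kn) (B := 5 ^+ 2) _)).
  move=> v /pk_supp vW; apply: (@fvar_dev _ _ _ _ (Qs k S v)) => [c||c /pik_supp ck].
  - exact: pik_ge0.
  - exact: pik_sum.
  rewrite /= zE//; have := Qs_dist c v S01 Sd; have := g01 c.
  have := ins_gain_ge0_le1 k c (v^-1%g (inord k.-1, false)) S01.
  move: (Qs k _ _) (Qs k _ _) (ins_gain _ _ _ _) (g c) => x y s t hs ht.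
  by rewrite !ler_norml; lra.
rewrite (_ : 5 ^+ 2 = 25 :> R); last by ring.
rewrite -[k.+1%:R]natr1 mulrDr mulr1 [leRHS]addrC lerD2l; apply: le_trans (IH (mean_coef k S) gm (ltnW kn) _ _ gm01).
- rewrite le_eqVlt -(fvarDcst (pk_sum k) (fun w => Qs k (mean_coef k S) w + _) (fexp (pik k) g)).
  apply/orP; left; apply/eqP; apply: eq_fvar => v /pk_supp vW.
  rewrite -Qs_mean /gm -fexpD [RHS]addrC -fexpD.
  by apply: eq_fexp_supp => c /pik_supp ck; exact: zE.
- by move=> j; exact: mean_coef_ge0_le1.
- exact: mean_coef_decr.
Qed.

(** The pair l = 0 has weight 0 so that a change of the sign of the first letter has no effect
    ([Nadj_flip]). The weights are nonincreasing from index 1 on, which is all that [fvar_Qs]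
    asks. *)
Definition Nadj w : R := \sum_(l < n.-1) (0 < l)%:R * (zeta w l)%:R.

Lemma fvar_Nadj_pk : fvar (pk n) Nadj <= 25 * n%:R.
Proof.
have := @fvar_Qs n (fun l => (0 < l)%:R) (fun=> 0) (leqnn n).
rewrite (@eq_fvar _ _ _ _ Nadj) => [h|w _]; last by rewrite addr0.
apply: h => [j|l l0 _|y].
- by case: (0 < j)%N; rewrite /= ?lexx ?ler01.
- by rewrite l0.
- by rewrite lexx ler01.
Qed.
End adjacency_chain.

(** * Transfer to the Mallows measures of types B and D *)

Section adjacency_variance.
Context {m : nat} {R : realType} (q : R).
Hypothesis q0 : 0 < q.
Local Notation n := m.+2.
Implicit Types (w v : {perm signed n}) (b : bool).

Lemma zeta_flip w (l : nat) : (0 < l)%N -> (l.+1 < n)%N ->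
  zeta (sgen true ord0 * w)%g l = zeta w l.
Proof.
move=> l0 ln; rewrite /zeta !wval_sgen; try lia.
have e k : swk true 0 k.+2%:Z = k.+2 by rewrite /swk/= /sw0B; do ?[case: eqP => ? //]; lia.
by case: l l0 ln => // l _ _; rewrite !e.
Qed.

Lemma Nadj_flip w : Nadj (sgen true ord0 * w)%g = Nadj w :> R.
Proof.
apply: eq_bigr => l _; case: (posnP l) => [->|l0]; first by rewrite !mul0r.
by rewrite zeta_flip//; have := ltn_ord l; lia.
Qed.

Lemma odd_negc_flip w : w \in Bn n -> odd (negc (sgen true ord0 * w)%g) = ~~ odd (negc w).
Proof.
move=> wB; case: (boolP (desc true ord0 w)) => d; last by rewrite negc_up_B0.
have := negc_up_B0 (BnM (sgen_Bn true ord0) wB) (erefl : @ord0 m.+1 = 0%N :> nat).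
by rewrite desc_sgen// d mulgA sgenK mul1g => /(_ isT) ->; rewrite negbK.
Qed.

(* Changing the sign of the first letter exchanges [Dn] and its complement. *)
Lemma sum_Bn_Dn (F : {perm signed n} -> R) :
  (forall w, w \in Bn n -> F (sgen true ord0 * w)%g = F w) ->
  \sum_(w in Bn n) F w = 2 * \sum_(w in Dn n) F w.
Proof.
move=> FE; rewrite (bigID (fun w => ~~ odd (negc w)))/=.
have -> : \sum_(w in Bn n | ~~ odd (negc w)) F w = \sum_(w in Dn n) F w.
  by apply: eq_bigl => w; rewrite DnE.
rewrite mulr_natl mulr2n; congr (_ + _).
rewrite (reindex_inj (mulgI (sgen true ord0)))/=.
have sB w : (sgen true ord0 * w)%g \in Bn n = (w \in Bn n).
  apply/idP/idP => h; last by apply: BnM => //; exact: sgen_Bn.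
  by rewrite -[w]mul1g -(sgenK true ord0) -mulgA; apply: BnM => //; exact: sgen_Bn.
rewrite (eq_bigl (fun w => w \in Dn n)).
  by apply: eq_bigr => w; rewrite DnE => /andP[wB _]; exact: FE.
move=> w; rewrite DnE sB; case: (boolP (w \in Bn n)) => //= wB.
by rewrite odd_negc_flip// negbK.
Qed.

Lemma mallowsE b w : mallows (Wg b) (sgen b) q w =
  if w \in Wg b then q ^+ lenf b w / \sum_(v in @Wg m b) q ^+ lenf b v else 0.
Proof.
rewrite /mallows; case: ifP => // wW; rewrite length_lenf//; congr (_ / _).
by apply: eq_bigr => v vW; rewrite length_lenf.
Qed.

Lemma fexp_mallows b (F : {perm signed n} -> R) : fexp (mallows (Wg b) (sgen b) q) F =
  (\sum_(w in Wg b) q ^+ lenf b w * F w) / \sum_(v in @Wg m b) q ^+ lenf b v.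
Proof.
rewrite /fexp mulr_suml [RHS]big_mkcond/=; apply: eq_bigr => w _; rewrite mallowsE.
by case: ifP => _; rewrite ?mul0r// mulrAC.
Qed.

Lemma fexp_pk (e : nat) (F : {perm signed n} -> R) : fexp (pk q e n) F =
  (\sum_(w in Bn n) mwt q (q ^+ e) w * F w) / \sum_(w in Bn n) mwt q (q ^+ e) w.
Proof.
rewrite /fexp mulr_suml [RHS]big_mkcond/=; apply: eq_bigr => w _; rewrite /pk /Zk Wk_n.
by case: ifP => _; rewrite ?mul0r// mulrAC.
Qed.

(** In type D, [invD] and F both ignore the sign of the first letter, so numerator and denominator
    over [Bn n] are twice those over [Dn n]. *)
Lemma fexp_mallows_pk b (F : {perm signed n} -> R) :
  (forall w, w \in Bn n -> F (sgen true ord0 * w)%g = F w) ->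
  fexp (mallows (Wg b) (sgen b) q) F = fexp (pk q b n) F.
Proof.
move=> FE; rewrite fexp_mallows fexp_pk; case: b.
  have mE w : mwt q (q ^+ true) w = q ^+ lenf true w.
    by rewrite /mwt /lenf exprD expr1.
  by congr (_ / _); apply: eq_bigr => w _; rewrite mE.
have mE w : mwt q (q ^+ false) w = q ^+ lenf false w.
  by rewrite /mwt /lenf addn0 expr0 expr1n mulr1.
have mI w : w \in Bn n -> q ^+ lenf false (sgen true ord0 * w)%g = q ^+ lenf false w.
  by move=> wB; rewrite /lenf !addn0 invD_B0.
under [in RHS]eq_bigr do rewrite mE; under [X in _ = _ / X]eq_bigr do rewrite mE.
rewrite !sum_Bn_Dn => [|w wB|w wB]; [|exact: mI|by rewrite mI// FE].
by rewrite -mulf_div divff ?mul1r// pnatr_eq0.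
Qed.

Lemma fvar_Nadj b : fvar (mallows (@Wg m b) (sgen b) q) Nadj <= 25 * n%:R.
Proof.
rewrite /fvar (@fexp_mallows_pk b Nadj) => [|w _]; last exact: Nadj_flip.
rewrite fexp_mallows_pk => [|w _]; last by rewrite Nadj_flip.
exact: fvar_Nadj_pk.
Qed.
End adjacency_variance.

(** * The kernel of the two-sided descent statistic *)

Section length_inverse.
Context {T I : finType} (s : I -> {perm T}).
Hypothesis ss : forall i, (s i * s i = 1)%g.

Lemma prod_rev_invg (t : seq I) : ((\prod_(i <- t) s i)^-1 = \prod_(i <- rev t) s i)%g.
Proof.
elim: t => [|i t IH]; first by rewrite /= !big_nil invg1.
rewrite big_cons rev_cons -cats1 big_cat big_seq1 invMg IH; congr (_ * _)%g.
by apply/eqP; rewrite eq_invg_mul ss.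
Qed.

Lemma has_wordV w k : has_word s w^-1%g k = has_word s w k.
Proof.
suff h u : has_word s u k -> has_word s u^-1%g k.
  by apply/idP/idP => /h //; rewrite invgK.
move=> /existsP[t /eqP->]; apply/existsP; exists [tuple of rev t].
by rewrite prod_rev_invg.
Qed.

Lemma lengthV w : length s w^-1%g = length s w.
Proof. by rewrite /length (_ : has_word s w^-1%g = has_word s w)//; apply/funext => k; exact: has_wordV. Qed.
End length_inverse.

Lemma card_ord_in (N : nat) (l : seq nat) : (#|[pred j : 'I_N | (j : nat) \in l]| <= size l)%N.
Proof.
rewrite cardE -(size_map val); apply: uniq_leq_size.
  by rewrite map_inj_uniq ?enum_uniq//; exact: val_inj.
by move=> k /mapP[j]; rewrite mem_enum inE => h ->.
Qed.

Section reflection_group.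
Context {m : nat} (b : bool).
Local Notation n := m.+2.
Implicit Types (w v u : {perm signed n}) (i j : 'I_n).
Local Notation s := (@sgen m b).

(** Stripping descents lowers [lenf] until [no_desc_1] applies. Closure under right multiplication
    and inversion follows for both types. *)
Lemma Wg_ind (P : {perm signed n} -> Prop) : P 1%g ->
  (forall i w, w \in Wg b -> P w -> P (s i * w)%g) -> forall w, w \in Wg b -> P w.
Proof.
move=> P1 PS w; have [k] := ubnP (lenf b w); elim: k w => // k IH w wk wW.
have wB := Wg_Bn wW.
case: (pselect (exists i, desc b i w)) => [[i di]|nd]; last first.
  rewrite (@no_desc_1 _ b w)// => i; apply/negP => di; apply: nd; by exists i.
rewrite -[w]mul1g -(sgenK b i) -mulgA; apply: PS; first exact: sgen_Wg.
by apply: IH (sgen_Wg i wW); have := lenf_down wB di; lia.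
Qed.

Lemma Wg_sgenE i w : ((s i * w)%g \in Wg b) = (w \in Wg b).
Proof.
apply/idP/idP => [/(sgen_Wg i)|]; last exact: sgen_Wg.
by rewrite mulgA sgenK mul1g.
Qed.

Lemma Wg_mulsgen i w : w \in Wg b -> (w * s i)%g \in Wg b.
Proof.
move: w; apply: Wg_ind => [|j w _ wW]; last by rewrite -mulgA Wg_sgenE.
by rewrite mul1g -[s i]mulg1 Wg_sgenE Wg1.
Qed.

Lemma WgV w : (w^-1%g \in Wg b) = (w \in Wg b).
Proof.
suff h u : u \in Wg b -> u^-1%g \in Wg b by apply/idP/idP => /h//; rewrite invgK.
move: u; apply: Wg_ind => [|i u _ uW]; first by rewrite invg1 Wg1.
by rewrite invMg (_ : (s i)^-1%g = s i) ?Wg_mulsgen//; apply/eqP; rewrite eq_invg_mul sgenK.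
Qed.

Lemma sgenV i : (s i)^-1%g = s i.
Proof. by apply/eqP; rewrite eq_invg_mul sgenK. Qed.

Lemma lenfV w : w \in Wg b -> lenf b w^-1%g = lenf b w.
Proof. by move=> wW; rewrite -!length_lenf ?WgV// lengthV//; exact: sgenK. Qed.

End reflection_group.

Section descent_flips.
Context {m : nat} {R : realType} (q : R) (b : bool).
Hypothesis q0 : 0 < q.
Local Notation n := m.+2.
Implicit Types (w v u : {perm signed n}) (i j : 'I_n).
Local Notation s := (@sgen m b).
Local Notation p := (mallows (Wg b) s q).

Lemma mallows_ge0 w : 0 <= p w.
Proof.
rewrite mallowsE; case: ifP => // _; apply: divr_ge0; first by rewrite exprn_ge0// ltW.
by apply: sumr_ge0 => v _; rewrite exprn_ge0// ltW.
Qed.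

Lemma mallows_supp w : p w != 0 -> w \in Wg b.
Proof. by rewrite mallowsE; case: ifP => //; rewrite eqxx. Qed.

Lemma mallows_sum : \sum_w p w = 1.
Proof.
under eq_bigr do rewrite mallowsE; rewrite -big_mkcond -mulr_suml divff//.
rewrite gt_eqF// (bigD1 1%g) ?Wg1//=; apply: ltr_pwDl; first by rewrite exprn_gt0.
by apply: sumr_ge0 => v _; rewrite exprn_ge0// ltW.
Qed.

Lemma mallowsV w : p w^-1%g = p w.
Proof. by rewrite !mallowsE WgV; case: ifP => // wW; rewrite lenfV. Qed.

Lemma mallows_up i w : ~~ desc b i w -> p (s i * w)%g = q * p w.
Proof.
move=> nd; rewrite !mallowsE Wg_sgenE; case: ifP => wW; last by rewrite mulr0.
by rewrite lenf_up ?(Wg_Bn wW)// exprS mulrA.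
Qed.

(** [true] marks the descents of w, [false] those of its inverse, so that both are flips in one
    family. *)
Definition dind (j : bool * 'I_n) w : bool := desc b j.2 (if j.1 then w else w^-1%g).
Definition dflip (j : bool * 'I_n) w := if j.1 then (s j.2 * w)%g else (w * s j.2)%g.

Lemma dflipV i w : dflip (false, i) w = (dflip (true, i) w^-1)^-1%g.
Proof. by rewrite /dflip/= invMg invgK sgenV. Qed.

Lemma dflipK (j : bool * 'I_n) : involutive (dflip j).
Proof.
by case: j => [[] i] w; rewrite /dflip/= ?mulgA ?sgenK ?mul1g// -mulgA sgenK mulg1.
Qed.

Lemma dflip_up (j : bool * 'I_n) w : ~~ dind j w -> p (dflip j w) = q * p w.
Proof.
case: j => [[] i]; rewrite /dind/= => nd; first exact: mallows_up.
by rewrite dflipV mallowsV mallows_up// mallowsV.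
Qed.

Lemma dind_flip (j : bool * 'I_n) w : p w != 0 -> dind j (dflip j w) = ~~ dind j w.
Proof.
move=> /mallows_supp wW; have wB := Wg_Bn wW.
case: j => [[] i]; rewrite /dind; first by rewrite /dflip/= desc_sgen.
by rewrite dflipV/= invgK /dflip/= desc_sgen//; exact: BnV.
Qed.

Local Notation X := (flip_stat (R := R) dind).
Local Notation D := (flip_diff (R := R) dind dflip).
Local Notation up := (flip_up dind dflip).
Local Notation dn := (flip_dn dind dflip).

Lemma flip_statE w : X w = \sum_i (desc b i w)%:R + \sum_i (desc b i w^-1%g)%:R.
Proof.
rewrite /flip_stat (eq_bigr (fun dj => (fun d i => (dind (d, i) w)%:R) dj.1 dj.2)); last by case.
rewrite -(pair_big xpredT xpredT (fun d i => (dind (d, i) w)%:R))/=.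
by rewrite big_bool.
Qed.

Lemma flip_stat_des w : w \in Wg b -> X w = two_sided_des s w.
Proof.
move=> wW; rewrite flip_statE /two_sided_des natrD /des -!sum1dep_card !natr_sum.
rewrite [in RHS]big_mkcond [X in _ = _ + X]big_mkcond /=.
by congr (_ + _); apply: eq_bigr => i _; rewrite length_desc ?WgV//; case: desc.
Qed.

Lemma flip_statV w : X w^-1%g = X w.
Proof. by rewrite !flip_statE invgK addrC. Qed.

Lemma flip_diffV i w : D (false, i) w = D (true, i) w^-1%g.
Proof.
have e : dind (false, i) w = dind (true, i) w^-1%g by [].
rewrite /flip_diff /flip_up /flip_dn e dflipV.
by case: ifP => _; rewrite flip_statV -[X w]flip_statV.
Qed.

Lemma flip_dn_spec i w : w \in Wg b -> [/\ dn (true, i) w \in Wg b,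
  ~~ desc b i (dn (true, i) w) & up (true, i) w = (s i * dn (true, i) w)%g].
Proof.
move=> wW; rewrite /flip_dn /flip_up /dind /dflip /=; case: ifP => d.
  split; [by rewrite Wg_sgenE|by rewrite desc_sgen ?d// (Wg_Bn wW)|].
  by rewrite mulgA sgenK mul1g.
by split=> //; rewrite d.
Qed.

Definition push i j w : R :=
  (desc b j (up (true, i) w))%:R - (desc b j (dn (true, i) w))%:R.
Definition exch i w : R := \sum_j ((s i * w)%g == (w * s j)%g)%:R.

Lemma exch_flip i w : exch i (s i * w)%g = exch i w.
Proof.
apply: eq_bigr => j _; rewrite mulgA sgenK mul1g; congr (_%:R); congr nat_of_bool.
apply/eqP/eqP => e; last by rewrite e -mulgA sgenK mulg1.
by rewrite [in RHS]e -!mulgA sgenK mulg1.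
Qed.

Lemma exch_dn i w : exch i (dn (true, i) w) = exch i w.
Proof. by rewrite /flip_dn; case: ifP => // _; rewrite exch_flip. Qed.

(* A right flip changes a left descent only when it is also a left flip. *)
Lemma exch_core i j u : u \in Wg b -> ~~ desc b i u ->
  (desc b j (s i * u)^-1%g)%:R - (desc b j u^-1%g)%:R = ((s i * u)%g == (u * s j)%g)%:R :> R.
Proof.
move=> uW nd; have uB := Wg_Bn uW; have uVB := BnV uB.
have uVW : u^-1%g \in Wg b by rewrite WgV.
case: eqP => e.
  have E : ((s i * u)^-1 = s j * u^-1)%g by rewrite e invMg sgenV.
  have l1 : lenf b (s j * u^-1)%g = (lenf b u^-1%g).+1.
    by rewrite -E !lenfV ?Wg_sgenE// lenf_up.
  rewrite E desc_sgen//; case: (boolP (desc b j u^-1%g)) => [d|_]; last by rewrite subr0.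
  by have := lenf_down uVB d; rewrite l1; lia.
rewrite (_ : desc b j (s i * u)^-1%g = desc b j u^-1%g) ?subrr//.
apply/eqP/negPn/negP; rewrite invMg sgenV => /(desc_exchange uVB) E; apply: e.
by have := congr1 invg E; rewrite !invMg invgK !sgenV => ->.
Qed.

Lemma flip_diffE i w : w \in Wg b ->
  D (true, i) w = 1 + \sum_(j | j != i) push i j w + exch i w.
Proof.
move=> wW; have [dW nd ue] := flip_dn_spec i wW.
rewrite -exch_dn /flip_diff !flip_statE /exch /push opprD addrACA -!sumrB ue.
congr (_ + _); last by apply: eq_bigr => j _; exact: exch_core.
by rewrite (bigD1 i)//= desc_sgen ?(Wg_Bn dW)// (negbTE nd) subr0.
Qed.

Lemma push_le0 i j w : w \in Wg b -> j != i -> -1 <= push i j w <= 0.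
Proof.
move=> wW ji; have [dW nd ue] := flip_dn_spec i wW; rewrite /push ue.
have := @desc_mono _ b i j _ (Wg_Bn dW); rewrite eq_sym ji => /(_ isT nd).
move: (desc b j _) (desc b j _) => y x xy.
by clear -xy; case: x y xy => -[] xy //=; rewrite ?subrr ?sub0r ?lexx ?lerN10 ?oppr_le0 ?ler01//; have := xy isT.
Qed.

Lemma push_far i j w : w \in Wg b -> j != i -> ~~ adjacent b i j -> push i j w = 0.
Proof.
move=> wW ji far; have [dW nd ue] := flip_dn_spec i wW; rewrite /push ue.
by rewrite desc_far ?subrr ?(Wg_Bn dW)// eq_sym.
Qed.

Lemma exch_ge0_le1 i w : 0 <= exch i w <= 1.
Proof.
rewrite /exch sumr_ge0//=; case: (pselect (exists j, (s i * w)%g = (w * s j)%g)) => [[j e]|ne].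
  rewrite (bigD1 j)//= big1 ?addr0; first by case: eqP.
  move=> k kj; case: eqP => // e'; case/eqP: kj; apply: (@sgen_inj _ b).
  by apply: (mulgI w); rewrite -e -e'.
by rewrite big1 ?ler01// => j _; case: eqP => // e; case: ne; exists j.
Qed.

Lemma push_sum i w : w \in Wg b -> -3 <= \sum_(j | j != i) push i j w <= 0.
Proof.
move=> wW; apply/andP; split; last first.
  by apply: sumr_le0 => j ji; case/andP : (push_le0 wW ji).
(* Contains every neighbour of i in the Coxeter diagram of either type. *)
pose l := [:: i.+1; i.-1; if i == 0%N :> nat then 2%N else 0%N].
apply: (@le_trans _ _ (\sum_(j | j != i) - ((j : nat) \in l)%:R)); last first.
  apply: ler_sum => j ji; have /andP[lo _] := push_le0 wW ji.
  case: (boolP (adjacent b i j)) => [a|/(push_far wW ji)->]; last by case: in_mem; rewrite /=; lra.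
  suff -> : (j : nat) \in l by [].
  move: a; rewrite /adjacent /l !inE; case: (i == 0%N :> nat) / eqP => [->|i0].
    by case: b => /eqP ->.
  case: (j == 0%N :> nat); first by rewrite !orbT.
  by case/orP => /eqP e; [rewrite e eqxx|rewrite e/= eqxx orbT].
rewrite sumrN lerN2; apply: (@le_trans _ _ (\sum_(j < n) ((j : nat) \in l)%:R)).
  by rewrite [leRHS](bigD1 i)//= ler_wpDl//; apply: ler_sum => j _.
rewrite -natr_sum ler_nat; apply: leq_trans (card_ord_in n l).
by rewrite -sum1_card [X in (_ <= X)%N]big_mkcond/=; apply: leq_sum => j _; rewrite inE; case: (_ \in l).
Qed.

(** The flipped descent itself gives 1, its diagram neighbours between -3 and 0, and the descents of
    the inverse 0 or 1. *)
Lemma flip_diff_bound (j : bool * 'I_n) w : p w != 0 -> `|D j w| <= 2.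
Proof.
move=> /mallows_supp; suff h i u : u \in Wg b -> `|D (true, i) u| <= 2.
  by case: j => [[] i] wW; [exact: h|rewrite flip_diffV h// WgV].
move=> uW; rewrite flip_diffE//; have := push_sum i uW; have := exch_ge0_le1 i u.
by move: (exch i u) (\sum_(_ | _) _) => x y; rewrite ler_norml; lra.
Qed.

Lemma push_pair i j w : w \in Wg b -> (0 < i)%N -> j = i.+1 :> nat ->
  push i j w + push j i w = - (desc b i w != desc b j w)%:R.
Proof.
move=> wW i0 ji; have wB := Wg_Bn wW.
have z1 := desc_braid b wB i0 ji; have z2 := @desc_braid_trans _ b i j w wB i0 ji.
(* Case analysis on the rank two subgroup: equal descents fix the third comparison by transitivity,
   and for unequal ones both values of it give -1. *)
rewrite /push /flip_up /flip_dn /dind /dflip /=.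
case di : (desc b i w) z2; case dj : (desc b j w) => /= z2; rewrite ?di ?dj -?z1;
  try (rewrite (z2 erefl)); try (case: (desc b j (s i * w)%g));
  by rewrite /=; ring.
Qed.

Definition turn i w : bool :=
  [&& (0 < i)%N, (i.+1 < n)%N & desc b i w != desc b (inord i.+1) w].

(** Bonds between generators of positive index pair up to minus the turns; what remains is the row
    of s_0, at least -3, and the column of s_0, at least -2. *)
Lemma push_total w : w \in Wg b ->
  -5 <= (\sum_i \sum_(j | j != i) push i j w) + \sum_i (turn i w)%:R <= 0.
Proof.
move=> wW; pose P (i : 'I_n) := (0 < i)%N.
pose A := \sum_(i | P i) \sum_(j | P j && (j == i.+1 :> nat)) push i j w.
pose B := \sum_(i | P i) \sum_(j | P j && (i == j.+1 :> nat)) push i j w.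
have AB : A + B = - \sum_i (turn i w)%:R.
  rewrite /B (exchange_big_dep P)/=; last by move=> i j _ /andP[].
  rewrite /A -big_split -sumrN [RHS](bigID P)/= [X in _ = _ + X]big1 ?addr0; last first.
    by move=> i; rewrite /P /turn => /negbTE ->; rewrite oppr0.
  apply: eq_bigr => i Pi; rewrite /turn -/(P i) Pi/=.
  rewrite -big_split/=; case: ltnP => iN; last first.
    rewrite big1 ?oppr0// => j /andP[_ /eqP e]; have := ltn_ord j; rewrite e; lia.
  rewrite (big_pred1 (inord i.+1)) => [|j]; last first.
    by rewrite /P [RHS]/= -(inj_eq val_inj) [in RHS]/= inordK//; case: eqP => [->|_]; rewrite ?andbT ?andbF.
  by rewrite push_pair// inordK.
have split3 : \sum_i \sum_(j | j != i) push i j w =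
    A + B + (\sum_(j | j != ord0) push ord0 j w + \sum_(i | P i) push i ord0 w).
  have PE i : P i = (i != ord0) by rewrite /P lt0n.
  suff main : \sum_(i | P i) \sum_(j | j != i) push i j w =
      A + B + \sum_(i | P i) push i ord0 w.
    by rewrite (bigD1 ord0)//= [X in _ + X = _](eq_bigl _ _ (fun i => esym (PE i))) main; ring.
  rewrite /A /B -!big_split/=; apply: eq_bigr => i Pi.
  rewrite (bigD1 ord0)/=; last by rewrite eq_sym -PE.
  rewrite addrC; congr (_ + _).
  rewrite (bigID (fun j : 'I_n => j == i.+1 :> nat))/=; congr (_ + _).
    apply: eq_bigl => j; rewrite PE; case: (eqVneq j i) => [->|_] //.
    by rewrite (ltn_eqF (ltnSn i)) !andbF.
  rewrite (bigID (fun j : 'I_n => i == j.+1 :> nat))/= [X in _ + X]big1 ?addr0; last first.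
    move=> j /andP[/andP[/andP[ji j0] n1] n2]; apply: push_far => //.
    rewrite /adjacent; move: Pi; rewrite /P lt0n => /negbTE ->.
    by move: j0; rewrite -PE /P lt0n => /negbTE ->; rewrite negb_or n1.
  apply: eq_bigl => j; rewrite PE; case: (eqVneq (i : nat) j.+1) => [e|_]; rewrite ?andbF//.
  have -> : j != i by apply/eqP => ji; move: e; rewrite ji; lia.
  by rewrite (_ : (j == i.+1 :> nat) = false) ?andbT//; apply/eqP; lia.
rewrite split3 AB.
have := push_sum ord0 wW.
have : -2 <= \sum_(i | P i) push i ord0 w <= 0.
  apply/andP; split; last first.
    apply: sumr_le0 => i i0; have : ord0 != i by rewrite -val_eqE/= eq_sym -lt0n.
    by move=> /(push_le0 wW)/andP[].
  pose l := [:: 1; 2]%N.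
  apply: (@le_trans _ _ (\sum_(i | P i) - ((i : nat) \in l)%:R)); last first.
    apply: ler_sum => i i0; have i0' : ord0 != i by rewrite -val_eqE/= eq_sym -lt0n.
    have /andP[lo _] := push_le0 wW i0'.
    case: (boolP (adjacent b i ord0)) => [a|/(push_far wW i0')->]; last by case: (_ \in l); rewrite /=; lra.
    suff -> : (i : nat) \in l by [].
    move: a; rewrite /adjacent /l !inE gtn_eqF//=.
    by case: b => /eqP ->.
  rewrite sumrN lerN2; apply: (@le_trans _ _ (\sum_(j < n) ((j : nat) \in l)%:R)).
    by rewrite [leRHS](bigID P)/= lerDl sumr_ge0.
  rewrite -natr_sum ler_nat; apply: leq_trans (card_ord_in n l).
  by rewrite -sum1_card [X in (_ <= X)%N]big_mkcond/=; apply: leq_sum => j _; rewrite inE; case: (_ \in l).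
move: (\sum_(_ | _) _) (\sum_(_ | _) _) (\sum_i (turn i w)%:R) => x y t; lra.
Qed.

Lemma sgen_exchE i j w : w \in Bn n -> (0 < i)%N -> (0 < j)%N ->
  ((s i * w)%g == (w * s j)%g) = (swA j (wval w i%:Z) == wval w i.+1%:Z).
Proof.
move=> wB i0 j0; have iN := ltn_ord i.
have e1 : wval (s i * w)%g i%:Z = wval w i.+1%:Z.
  by rewrite wval_sgen; [|lia|lia]; rewrite /swk (gtn_eqF i0) /swA eqxx.
have e2 : wval (w * s j)%g i%:Z = swA j (wval w i%:Z).
  by rewrite wval_mulsgen /swk (gtn_eqF j0).
apply/eqP/eqP => [e|e]; first by rewrite -e2 -e.
apply: (@sgen_conj _ b i j w (unkey i%:Z)) => //.
  move=> /(congr1 skey); rewrite skey_sgen !unkeyK; [|lia|lia].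
  by rewrite /swk (gtn_eqF i0) /swA eqxx; lia.
by apply: skey_inj; rewrite -!permM -!/(wval _ _) e1 e2.
Qed.

Lemma exch_uniq i j k w : (s i * w)%g = (w * s j)%g -> (s i * w)%g = (w * s k)%g -> j = k.
Proof. by move=> -> /mulgI; exact: sgen_inj. Qed.

Lemma exch_pos i w : w \in Bn n -> (0 < i)%N ->
  \sum_(j < n | (0 < j)%N) ((s i * w)%g == (w * s j)%g)%:R = (zeta w i.-1)%:R :> R.
Proof.
move=> wB i0; have iN := ltn_ord i.
have ne : wval w i%:Z <> wval w i.+1%:Z.
  by move=> /wval_inj e; have := e ltac:(lia) ltac:(lia) ltac:(lia) ltac:(lia); lia.
have k0 := wval_abs w i%:Z; have l0 := wval_abs w i.+1%:Z.
case: (boolP (zeta w i.-1)) => z; last first.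
  rewrite big1// => j j0; rewrite sgen_exchE//; case: eqP => // e; exfalso; move: z.
  rewrite /zeta !prednK// -e; move: ne; rewrite -e; move: (wval w i%:Z) => k.
  by rewrite /swA; do ?[case: eqP => ? //=]; lia.
have [j j0 e] : exists2 j : 'I_n, (0 < j)%N & swA j (wval w i%:Z) = wval w i.+1%:Z.
  move: z; rewrite /zeta !prednK//; move: (wval w i%:Z) (wval w i.+1%:Z) k0 l0 ne => k l k0 l0 ne z.
  (* The values have equal sign and adjacent absolute values, so the generator exchanging them is
     indexed by the smaller absolute value. *)
  have jn : (minn `|k| `|l| < n)%N by lia.
  exists (Ordinal jn) => /=; first lia.
  rewrite /swA; have [kl|kl] := leqP `|k| `|l|.
    by do ?[case: eqP => ? //=]; lia.
  by do ?[case: eqP => ? //=]; lia.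
rewrite (bigD1 j)//= sgen_exchE// e eqxx big1 ?addr0// => k /andP[_ kj].
case: eqP => // e'; case/eqP: kj; apply: (exch_uniq e').
by apply/eqP; rewrite sgen_exchE// e.
Qed.

(** The three units are the exchanges in the row of s_0, those in its column, and the first pair of
    positions, which [Nadj] omits. *)
Lemma exch_total w : w \in Wg b -> 0 <= \sum_i exch i w - Nadj w <= 3.
Proof.
move=> wW; have wB := Wg_Bn wW.
pose P (i : 'I_n) := (0 < i)%N.
have PE i : (i != ord0) = P i by rewrite /P lt0n.
pose col : R := \sum_(i | P i) ((s i * w)%g == (w * s ord0)%g)%:R.
have colb : 0 <= col <= 1.
  rewrite /col sumr_ge0//=; case: (pselect (exists i, P i && ((s i * w)%g == (w * s ord0)%g))) => [[i /andP[Pi /eqP e]]|ne].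
    rewrite (bigD1 i)//= big1 ?addr0; first by case: eqP.
    move=> k /andP[_ ki]; case: eqP => // e'; case/eqP: ki; apply: (@sgen_inj _ b).
    by apply: (mulIg w); rewrite e e'.
  rewrite big1 ?ler01// => i Pi; case: eqP => // e; case: ne.
  by exists i; rewrite Pi/=; apply/eqP.
have -> : \sum_i exch i w - Nadj w = exch ord0 w + col + (zeta w 0)%:R.
  have -> : \sum_i exch i w = exch ord0 w + (col + \sum_(i | P i) (zeta w i.-1)%:R).
    rewrite (bigD1 ord0)//= (eq_bigl _ _ PE); congr (_ + _).
    rewrite /col -big_split/=; apply: eq_bigr => i Pi.
    by rewrite /exch (bigD1 ord0)//= (eq_bigl _ _ PE) exch_pos.
  have -> : \sum_(i | P i) (zeta w i.-1)%:R = \sum_(l < n.-1) (zeta w l)%:R :> R.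
    by rewrite big_mkcond big_ord_recl /= add0r; apply: eq_bigr => l _.
  have -> : \sum_(l < n.-1) (zeta w l)%:R = (zeta w 0)%:R + Nadj w :> R.
    rewrite /Nadj [LHS]big_ord_recl [X in _ = _ + X]big_ord_recl /= mul0r add0r; congr (_ + _).
    by apply: eq_bigr => l _; rewrite /= mul1r.
  by ring.
have := exch_ge0_le1 ord0 w; move: (exch ord0 w) colb => x; move: (col) => y.
by case: zeta => /=; lra.
Qed.

Definition row_kernel w : R := \sum_i D (true, i) w.

Lemma flip_kernelE w :
  flip_kernel (R := R) dind dflip w = row_kernel w + row_kernel w^-1%g.
Proof.
rewrite /flip_kernel (eq_bigr (fun dj => (fun d i => D (d, i) w) dj.1 dj.2)); last by case.
rewrite -(pair_big xpredT xpredT (fun d i => D (d, i) w))/= big_bool; congr (_ + _).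
by apply: eq_bigr => i _; exact: flip_diffV.
Qed.

Lemma row_kernel_bound w : w \in Wg b ->
  -5 <= row_kernel w - (n%:R - \sum_i (turn i w)%:R + Nadj w) <= 3.
Proof.
move=> wW; rewrite /row_kernel (eq_bigr (fun i => 1 + \sum_(j | j != i) push i j w + exch i w)); last first.
  by move=> i _; exact: flip_diffE.
rewrite !big_split/= sumr_const card_ord.
have := exch_total wW; have := push_total wW.
by move: (\sum_i exch i w) (\sum_i \sum_(_ | _) _) (\sum_i (turn i w)%:R) (Nadj w) (n%:R : R) => x y z t u; lra.
Qed.

Local Notation E := (fexp p).

Lemma sum_desc_swap j (G : {perm signed n} -> R) :
  \sum_v p v * (desc b j v)%:R * G v = q * \sum_v p v * (~~ desc b j v)%:R * G (s j * v)%g.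
Proof. exact: (flip_swap dflipK dflip_up dind_flip (true, j) G). Qed.

(* With [z] the descent at the third reflection of the rank two subgroup, the state
   [(x, y, z)] moves to [(~~ x, z, y)] under [s k] and to [(z, ~~ y, x)] under [s l].
   Six states occur, with weights 1, q, q, q^2, q^2, q^3. *)
Lemma turn_invariant (k : 'I_n) (F : {perm signed n} -> R) : (0 < k)%N -> (k.+1 < n)%N ->
  (forall w, w \in Wg b -> F (s k * w)%g = F w) ->
  (forall w, w \in Wg b -> F (s (inord k.+1) * w)%g = F w) ->
  (1 + q + q ^+ 2) * E (fun w => (turn k w)%:R * F w) = 2 * q * E F.
Proof.
move=> k0 kn Fk Fl; pose l : 'I_n := inord k.+1; have lk : l = k.+1 :> nat by rewrite inordK.
rewrite -/l in Fl; pose z w := desc b l (s k * w)%g.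
have zk w : z (s k * w)%g = desc b l w by rewrite /z mulgA sgenK mul1g.
have zl w : w \in Bn n -> z (s l * w)%g = desc b k w.
  move=> wB; rewrite /z (desc_braid b _ k0 lk) ?mulgA ?sgenK ?mul1g//.
  exact: BnM (sgen_Bn b l) wB.
have kl w : w \in Bn n -> desc b k (s l * w)%g = z w.
  by move=> wB; rewrite /z (desc_braid b wB k0 lk).
pose M x y t := \sum_w p w * F w * ([&& desc b k w == x, desc b l w == y & z w == t])%:R.
have supp (G1 G2 : {perm signed n} -> R) : (forall w, w \in Wg b -> G1 w = G2 w) ->
    \sum_w p w * G1 w = \sum_w p w * G2 w.
  by move=> G12; apply: (@eq_fexp_supp _ _ p) => w /mallows_supp; exact: G12.
have Mk y t : M true y t = q * M false t y.
  transitivity (\sum_w p w * (desc b k w)%:R * (F w * ((desc b l w == y) && (z w == t))%:R)).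
    apply: eq_bigr => w _; rewrite -!mulrA; congr (_ * _).
    by case: (desc b k w); rewrite /= ?mulr0 ?mul0r ?mul1r.
  rewrite sum_desc_swap; congr (_ * _); rewrite /M.
  under eq_bigr do rewrite -mulrA; under [RHS]eq_bigr do rewrite -mulrA.
  apply: supp => w wW; rewrite zk Fk// -/(z w).
  by case: (desc b k w); rewrite /= ?mulr0 ?mul0r ?mul1r// [in LHS]andbC.
have Ml x t : M x true t = q * M t false x.
  transitivity (\sum_w p w * (desc b l w)%:R * (F w * ((desc b k w == x) && (z w == t))%:R)).
    apply: eq_bigr => w _; rewrite -!mulrA; congr (_ * _).
    by case: (desc b l w); rewrite /= ?andbF ?mulr0 ?mul0r ?mul1r.
  rewrite sum_desc_swap; congr (_ * _); rewrite /M.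
  under eq_bigr do rewrite -mulrA; under [RHS]eq_bigr do rewrite -mulrA.
  apply: supp => w wW; have wB := Wg_Bn wW; rewrite zl// kl// Fl//.
  by case: (desc b l w); rewrite /= ?andbF ?mulr0 ?mul0r ?mul1r// [in LHS]andbC.
(* Impossible by transitivity; [Mk] then removes the opposite state (true, true, false) as well,
   leaving six. *)
have M001 : M false false true = 0.
  apply: big1 => w _; have [->|/mallows_supp/Wg_Bn wB] := eqVneq (p w) 0; first by rewrite !mul0r.
  have := @desc_braid_trans _ b k l w wB k0 lk; rewrite -/(z w).
  by case: (desc b k w); case: (desc b l w) => /= h; rewrite ?mulr0// h ?mulr0.
have EF : E F = M false false false + M false true false + M false true true +
    (M true false false + M true false true + M true true true) + M true true false.
  rewrite -[RHS]addr0 -[X in _ = _ + X]M001 /E /M -!big_split; apply: eq_bigr => w _ /=.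
  by case: (desc b k w); case: (desc b l w); case: (z w); rewrite /= ?mulr0 ?mulr1 ?addr0 ?add0r.
have ET : E (fun w => (turn k w)%:R * F w) =
    M false true false + M false true true + (M true false false + M true false true).
  rewrite /E /M -!big_split; apply: eq_bigr => w _ /=; rewrite /turn k0 kn/= -/l.
  by case: (desc b k w); case: (desc b l w); case: (z w);
    rewrite /= ?mulr0 ?mulr1 ?addr0 ?add0r ?mul0r ?mul1r ?mulr0.
rewrite EF ET [M true true false]Mk M001 [M true true true]Mk [M true false true]Mk.
rewrite [M true false false]Mk [M false true false]Ml [M false true true]Ml [M true false false]Mk.
by ring.
Qed.

Lemma turn_far i (k : 'I_n) w : w \in Bn n -> (0 < i)%N -> (i.+1 < k)%N || (k.+2 < i)%N ->
  turn k (s i * w)%g = turn k w.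
Proof.
move=> wB i0 ik; rewrite /turn; case: (posnP k) => //= k0; case: ltnP => //= kn.
have lk : (inord k.+1 : 'I_n) = k.+1 :> nat by rewrite inordK.
have far j : (0 < j)%N -> j <> i :> nat -> j <> i.+1 :> nat -> i <> j.+1 :> nat ->
    desc b j (s i * w)%g = desc b j w.
  move=> j0 ji j1 j2; apply: desc_far => //; first by apply/eqP => e; apply: ji; rewrite e.
  by rewrite /adjacent (gtn_eqF i0) (gtn_eqF j0); lia.
by rewrite !far ?lk//; lia.
Qed.

(** Equivalent to (q - 1)^2 >= 0, as 2/3 (1 + q + q^2) - 2q = 2/3 (q - 1)^2. *)
Lemma turn_mean (k : 'I_n) : E (fun w => (turn k w)%:R) <= 2 / 3.
Proof.
case: (boolP ((0 < k) && (k.+1 < n))%N) => [/andP[k0 kn]|nk]; last first.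
  rewrite (eq_fexp _ (G := fun=> 0)); last by move=> w; rewrite /turn andbA (negbTE nk).
  by rewrite (fexp_cst mallows_sum); lra.
have := @turn_invariant k (fun=> 1) k0 kn (fun _ _ => erefl) (fun _ _ => erefl).
rewrite (fexp_cst mallows_sum) mulr1; under eq_fexp do rewrite mulr1.
move: (E _) => x; have q1 : 0 <= (q - 1) ^+ 2 by exact: sqr_ge0.
move=> h; have : (1 + q + q ^+ 2) * (2 / 3 - x) >= 0 by nra.
by rewrite pmulr_rge0; [lra|nra].
Qed.

(** At this distance the flips at k and k + 1 do not affect the turn at l, which may serve as F in
    [turn_invariant]. *)
Lemma turn_cov (k l : 'I_n) : (k.+2 < l)%N || (l.+2 < k)%N ->
  E (fun w => (turn k w)%:R * (turn l w)%:R) =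
  E (fun w => (turn k w)%:R) * E (fun w => (turn l w)%:R).
Proof.
move=> kl; case: (boolP ((0 < k) && (k.+1 < n))%N) => [/andP[k0 kn]|nk]; last first.
  have z w : (turn k w)%:R = 0 :> R by rewrite /turn andbA (negbTE nk).
  rewrite [in RHS](eq_fexp _ z) (fexp_cst mallows_sum) mul0r.
  by rewrite (eq_fexp _ (G := fun=> 0)) ?(fexp_cst mallows_sum)// => w; rewrite z mul0r.
have := @turn_invariant k (fun=> 1) k0 kn (fun _ _ => erefl) (fun _ _ => erefl).
rewrite (fexp_cst mallows_sum) mulr1; under eq_fexp do rewrite mulr1.
have Fk w : w \in Wg b -> (turn l (s k * w)%g)%:R = (turn l w)%:R :> R.
  by move=> /Wg_Bn wB; rewrite turn_far//; lia.
have Fl w : w \in Wg b -> (turn l (s (inord k.+1) * w)%g)%:R = (turn l w)%:R :> R.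
  by move=> /Wg_Bn wB; rewrite turn_far ?inordK//; lia.
have := @turn_invariant k (fun w => (turn l w)%:R) k0 kn Fk Fl.
move: (E _) (E _) (E _) => x y z h1 h2.
apply: (@mulfI _ (1 + q + q ^+ 2)); first by rewrite gt_eqF//; nra.
by rewrite h1 mulrA h2; ring.
Qed.

Lemma turn_variance : fvar p (fun w => \sum_k (turn k w)%:R) <= 5 * n%:R.
Proof.
have c01 (x : bool) : 0 <= (x%:R : R) <= 1 by case: x; rewrite ?lexx ?ler01.
rewrite (fvar_sum _ mallows_sum); apply: (@le_trans _ _ (\sum_(k < n) (5 : R))); last first.
  by rewrite sumr_const card_ord mulr_natr.
(* At most five indices are within distance 2, each with covariance at most 1. *)
apply: ler_sum => k _; pose l := [:: k.-2; k.-1; k : nat; k.+1; k.+2].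
apply: (@le_trans _ _ (\sum_(j < n) ((j : nat) \in l)%:R)).
  apply: ler_sum => j _; case: (boolP ((k.+2 < j)%N || (j.+2 < k)%N)) => kj.
    by rewrite turn_cov// subrr; case/andP : (c01 ((j : nat) \in l)).
  have -> : (j : nat) \in l.
    by rewrite /l !inE; move: kj; lia.
  rewrite lerBlDr ler_wpDr//.
    by apply: mulr_ge0; apply: fexp_ge0 => [v|v]; rewrite ?mallows_ge0//; case/andP : (c01 (turn _ v)).
  rewrite -[leRHS](fexp_cst mallows_sum); apply: ler_fexp => [v|v _]; first exact: mallows_ge0.
  by have /andP[x0 x1] := c01 (turn k v); have /andP[y0 y1] := c01 (turn j v); rewrite mulr_ile1.
rewrite -natr_sum ler_nat; apply: leq_trans (card_ord_in n l).
by rewrite -sum1_card [X in (_ <= X)%N]big_mkcond/=; apply: leq_sum => j _; rewrite inE; case: (_ \in l).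
Qed.

Lemma row_kernel_mean : n%:R / 3 - 5 <= E row_kernel.
Proof.
apply: (@le_trans _ _ (E (fun w => n%:R - 5 - \sum_k (turn k w)%:R))).
  rewrite fexpB (fexp_cst mallows_sum) fexp_sum.
  have : \sum_k E (fun w => (turn k w)%:R) <= \sum_(k < n) (2 / 3).
    by apply: ler_sum => k _; exact: turn_mean.
  by rewrite sumr_const card_ord -mulr_natr; lra.
apply: ler_fexp => [v|v /mallows_supp vW]; first exact: mallows_ge0.
have := row_kernel_bound vW; have : 0 <= Nadj v :> R.
  by rewrite /Nadj sumr_ge0// => l _; rewrite mulr_ge0.
by move: (Nadj v) (\sum_k _) (n%:R : R) (row_kernel v) => x y z t; lra.
Qed.

Lemma row_kernel_variance : fvar p row_kernel <= 70 * n%:R + 64.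
Proof.
have p0 := mallows_ge0; have p1 := mallows_sum.
pose T w := - \sum_k (turn k w)%:R : R.
pose d w := row_kernel w - (n%:R + T w + Nadj w).
have -> : fvar p row_kernel = fvar p (fun w => Nadj w + (d w + T w)).
  rewrite -[in RHS](fvarDcst p1 _ n%:R); apply: eq_fvar => w _; rewrite /d; ring.
have hN : fvar p Nadj <= 25 * n%:R by exact: fvar_Nadj.
have hT : fvar p T <= 5 * n%:R by rewrite fvarN turn_variance.
(* [row_kernel_bound] confines the error to [-5, 3], of centre -1 and radius 4. Altogether 2 * 25 n
   + 2 (2 * 16 + 2 * 5 n) = 70 n + 64. *)
have hd : fvar p d <= 4 ^+ 2.
  apply: (@fvar_dev _ _ p _ (-1)) => // v /mallows_supp vW.
  have := row_kernel_bound vW; rewrite /d /T; move: (row_kernel v - _) => x.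
  by rewrite ler_norml; lra.
have h1 := fvarD2_le p0 p1 Nadj (fun w => d w + T w).
have h2 := fvarD2_le p0 p1 d T.
by move: h1 h2 hN hT hd; rewrite (_ : 4 ^+ 2 = 16 :> R); [lra|ring].
Qed.

Lemma fexp_invg (F : {perm signed n} -> R) : E (fun w => F w^-1%g) = E F.
Proof.
rewrite /fexp [RHS](reindex_inj invg_inj)/=.
by apply: eq_bigr => w _; rewrite mallowsV.
Qed.

Lemma kernel_mean : 2 / 3 * n%:R - 10 <= E (flip_kernel (R := R) dind dflip).
Proof.
rewrite (eq_fexp _ flip_kernelE) fexpD fexp_invg.
by have := row_kernel_mean; lra.
Qed.

Lemma kernel_variance : fvar p (flip_kernel (R := R) dind dflip) <= 280 * n%:R + 256.
Proof.
have -> : fvar p (flip_kernel (R := R) dind dflip) =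
    fvar p (fun w => row_kernel w + row_kernel w^-1%g).
  by apply: eq_fvar => w _; exact: flip_kernelE.
apply: (le_trans (fvarD2_le mallows_ge0 mallows_sum _ _)).
have -> : fvar p (fun w => row_kernel w^-1%g) = fvar p row_kernel.
  by rewrite /fvar fexp_invg (fexp_invg (fun w => (row_kernel w - E row_kernel) ^+ 2)).
by have := row_kernel_variance; lra.
Qed.
End descent_flips.

(** * Normal approximation with explicit constants *)

Section mallows_normal.
Context {m : nat} {R : realType} (q : R) (b : bool).
Hypothesis q0 : 0 < q.
Local Notation n := m.+2.
Local Notation s := (@sgen m b).
Local Notation p := (mallows (Wg b) s q).
Context {dZ : measure_display} {OmegaZ : measurableType dZ}.
Context {PZ : probability OmegaZ R} {Z : {RV PZ >-> R}}.
Hypothesis hZ : standard_normal Z.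
Context {d : measure_display} {Omega : measurableType d} (P : probability Omega R).
Context (w : Omega -> {perm signed n}).
Hypothesis hw : mallows_distributed (Wg b) s q P w.

Local Notation stat := (flip_stat (R := R) (dind b)).
Local Notation stdst v := ((stat v - fexp p stat) / Num.sqrt (fvar p stat)).

(** Off the group [length] takes a default value, so the descent count and the flip statistic are
    compared only on the support. *)
Lemma standardize_mallows : exists2 Y : {perm signed n} -> R,
  standardize P (fun t => two_sided_des s (w t)) = (fun t => Y (w t)) &
  forall v, p v != 0 -> Y v = stdst v.
Proof.
have mw v := (hw v).1; have pw v := (hw v).2.
have Em : fexp p (two_sided_des s) = fexp p stat.
  by apply: eq_fexp_supp => v /mallows_supp vW; rewrite flip_stat_des.
exists (fun v => (two_sided_des s v - fexp p (two_sided_des s)) / Num.sqrt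
    (\sum_u p u * (two_sided_des s u - fexp p (two_sided_des s)) ^+ 2)).
  exact: (standardize_finite mw pw (two_sided_des s)).
move=> v /mallows_supp vW; rewrite Em flip_stat_des//; congr (_ / Num.sqrt _).
rewrite /fvar; apply: eq_fexp_supp => u /mallows_supp uW.
by rewrite flip_stat_des.
Qed.

Lemma wasserstein_mallows_triv :
  (wasserstein1 P (standardize P (fun t => two_sided_des s (w t))) PZ Z <= 2%:E)%E.
Proof.
have mw v := (hw v).1; have pw v := (hw v).2.
have [Y -> YE] := standardize_mallows.
have h := wasserstein1_normal_triv hZ Y mw pw (mallows_ge0 b q0) (mallows_sum b q0).
apply: (le_trans h).
rewrite lee_fin -lerBrDr (_ : 2 - 1 = 1 :> R); last by ring.
rewrite -/(fexp p (fun v => `|Y v|)) (@eq_fexp_supp _ _ p _ (fun v => `|stdst v|)).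
  exact: (flip_std_norm (mallows_ge0 b q0) (mallows_sum b q0)).
by move=> v pv; rewrite YE.
Qed.

Lemma wasserstein_mallows_stein (a c M : R) : 0 < a -> 0 < c -> c ^+ 2 <= a ->
  a * n%:R <= 2 / 3 * n%:R - 10 -> 30 <= n%:R :> R ->
  (1 + q) / Num.sqrt q <= 2 * M ->
  (wasserstein1 P (standardize P (fun t => two_sided_des s (w t))) PZ Z <=
   ((51 / a + 64 / (a * c) * M) / Num.sqrt n%:R)%:E)%E.
Proof.
move=> a0 c0 ca an n30 qM.
have mw v := (hw v).1; have pw v := (hw v).2.
have [Y -> YE] := standardize_mallows.
apply: (@wasserstein1_normal_stein _ _ _ _ _ hZ _ _ _ _ p Y).
- exact: mw.
- exact: pw.
- exact: mallows_ge0.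
- exact: mallows_sum.
move=> f k k3 tay.
rewrite -/(fexp p (fun v => k (Y v) - Y v * f (Y v))).
rewrite (@eq_fexp_supp _ _ p _ (fun v => k (stdst v) - stdst v * f (stdst v))); last first.
  by move=> v pv; rewrite YE.
have n0 : 0 < n%:R :> R by rewrite ltr0n.
set r := Num.sqrt n%:R; have r0 : 0 < r by rewrite sqrtr_gt0.
have r2 : r ^+ 2 = n%:R by rewrite sqr_sqrtr// ltW.
have an0 : 0 < a * n%:R by exact: mulr_gt0.
(* 280 n + 256 <= 289 n for n >= 30; the 51 of the statement is 3 * 17. *)
have vW : fvar p (flip_kernel (R := R) (dind b) (dflip b)) <= (17 * r) ^+ 2.
  by rewrite exprMn r2; apply: (le_trans (kernel_variance b q0)); lra.
have cE := le_trans an (kernel_mean b q0).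
apply: (le_trans (flip_stein_bound (mallows_ge0 b q0) (mallows_sum b q0) q0 (dflipK b) (@dflip_up _ _ q b)
  (@dind_flip _ _ q b) (@flip_diff_bound _ _ _ b q0) an0 cE vW k3 tay)).
rewrite sqrtr_sqr ger0_norm; last by rewrite mulr_ge0// ltW.
rewrite card_prod card_bool card_ord natrM -[n%:R]r2.
set sq := Num.sqrt (q / _ * _).
(* [c] is a rational stand-in for sqrt a, and [qM] bounds sqrt q / (1 + q) from below. The 64 of the
   statement is 16 * 2 * 2. *)
have sqE : c * r / (2 * M) <= sq.
  have q1 : 0 < 1 + q by rewrite addr_gt0.
  have sq0 : 0 < Num.sqrt q by rewrite sqrtr_gt0.
  have -> : sq = Num.sqrt q / (1 + q) * (Num.sqrt a * r).
    rewrite /sq sqrtrM ?divr_ge0 ?exprn_ge0 ?ltW// sqrtrM ?ltW// sqrtrV ?exprn_ge0 ?ltW//.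
    by rewrite !sqrtr_sqr !ger0_norm ?ltW// sqrtrM ?ltW// sqrtr_sqr ger0_norm// ltW.
  have ca' : c <= Num.sqrt a by rewrite -(ger0_norm (ltW c0)) -sqrtr_sqr ler_wsqrtr.
  have M0 : 0 < 2 * M by apply: lt_le_trans qM; exact: divr_gt0.
  have M0' : 0 < M by lra.
  rewrite mulrC; apply: ler_pM; [by rewrite invr_ge0 ltW|by rewrite mulr_ge0// ltW| |].
    by rewrite -[leRHS]invrK lef_pV2 ?posrE ?invr_gt0 ?divr_gt0// invf_div.
  by rewrite ler_pM2r.
have M0 : 0 < M.
  suff : 0 < 2 * M by lra.
  by apply: lt_le_trans qM; rewrite divr_gt0 ?addr_gt0// sqrtr_gt0.
have lo0 : 0 < c * r / (2 * M) by rewrite !divr_gt0 ?mulr_gt0.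
have ar0 : 0 < a * r ^+ 2 by rewrite mulr_gt0// exprn_gt0.
apply: (@le_trans _ _ (3 * (17 * r) / (a * r ^+ 2) +
    16 * (2 * r ^+ 2) / (c * r / (2 * M) * (a * r ^+ 2)))).
  rewrite lerD2l; apply: ler_wpM2l; first by rewrite !mulr_ge0// ltW.
  have sq1 : 0 < sq by exact: lt_le_trans sqE.
  by rewrite lef_pV2 ?posrE ?(mulr_gt0 sq1 ar0) ?(mulr_gt0 lo0 ar0)// ler_wpM2r// ltW.
rewrite le_eqVlt; apply/orP; left; apply/eqP; field.
by rewrite !gt_eqF.
Qed.
End mallows_normal.

Lemma max_powR_half (R : realType) (q : R) : 0 < q ->
  1 <= Num.max (q `^ (- (1 / 2))) (q `^ (1 / 2)) /\
  (1 + q) / Num.sqrt q <= 2 * Num.max (q `^ (- (1 / 2))) (q `^ (1 / 2)).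
Proof.
move=> q0; rewrite powRN div1r (powR12_sqrt (ltW q0)).
set r := Num.sqrt q; have r0 : 0 < r by rewrite sqrtr_gt0.
have r2 : q = r ^+ 2 by rewrite sqr_sqrtr// ltW.
have h1 : r^-1 <= Num.max r^-1 r by rewrite le_max lexx.
have h2 : r <= Num.max r^-1 r by rewrite le_max lexx orbT.
split.
  have [r1|r1] := leP 1 r; first exact: le_trans h2.
  by apply: le_trans h1; rewrite -invr1 lef_pV2 ?posrE// ltW.
have -> : (1 + q) / r = r^-1 + r by rewrite r2; field; rewrite gt_eqF.
by move: h1 h2; lra.
Qed.

Lemma sqrt_natr_pow (R : realType) (k : nat) : k%:R `^ (- (1 / 2)) = (Num.sqrt k%:R)^-1 :> R.
Proof. by rewrite powRN div1r powR12_sqrt// ler0n. Qed.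

Theorem theorem1p6 (R : realType) (q : R) (hq : 0 < q)
    (dZ : measure_display) (OmegaZ : measurableType dZ)
    (PZ : probability OmegaZ R) (Z : {RV PZ >-> R})
    (hZ : standard_normal Z) :
  (forall (n : nat) (hn : (4 <= n)%N)
      (d : measure_display) (Omega : measurableType d)
      (P : probability Omega R) (w : Omega -> {perm signed n})
      (hw : mallows_distributed (Bn n) (@sgenB n) q P w),
    (wasserstein1
       P (standardize P (fun t => two_sided_des (@sgenB n) (w t))) PZ Z
     <= ((180 + 236 * Num.max (q `^ (- (1 / 2))) (q `^ (1 / 2)))
         * n%:R `^ (- (1 / 2)))%:E)%E) /\
  (forall (n : nat) (hn : (30 <= n)%N)
      (d : measure_display) (Omega : measurableType d)
      (P : probability Omega R) (w : Omega -> {perm signed n})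
      (hw : mallows_distributed (Dn n) (@sgenD n) q P w),
    (wasserstein1
       P (standardize P (fun t => two_sided_des (@sgenD n) (w t))) PZ Z
     <= ((384 + 666 * Num.max (q `^ (- (1 / 2))) (q `^ (1 / 2)))
         * n%:R `^ (- (1 / 2)))%:E)%E).

Proof.
have [M1 qM] := max_powR_half hq; move: (Num.max _ _ : R) M1 qM => M M1 qM.
split=> n hn d Omega P w hw; rewrite sqrt_natr_pow; case: n hn w hw => [|[|m]]// hn w hw.
(* 150 = 10 / (2/3 - 3/5), and (7/10)^2 <= 3/5; then 51/a = 85 and 64/(a c) < 153. *)
- have [n150|n150] := leqP 150 m.+2.
    have n150' : 150 <= m.+2%:R :> R by rewrite (ler_nat R 150).
    apply: le_trans.
      by apply: (@wasserstein_mallows_stein m R q true hq _ _ _ _ hZ _ _ P w hw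
        (3 / 5) (7 / 10) M) => //; lra.
    rewrite lee_fin ler_pM2r ?invr_gt0 ?sqrtr_gt0 ?ltr0n//; lra.
  apply: (le_trans (@wasserstein_mallows_triv m R q true hq _ _ _ _ hZ _ _ P w hw)).
  rewrite lee_fin ler_pdivlMr ?sqrtr_gt0 ?ltr0n//.
  (* 13^2 = 169 exceeds 150, and 180 + 236 M >= 416 is far above 2 * 13. *)
  have : Num.sqrt m.+2%:R <= 13 :> R.
    rewrite -[leRHS]ger0_norm// -sqrtr_sqr ler_wsqrtr// -natrX ler_nat.
    by apply: ltnW; apply: leq_trans n150 _.
  by lra.
(* 30 = 10 / (2/3 - 1/3); with a = 1/3 and c = 1/2 the constants are 153 and 384. *)
- have n30' : 30 <= m.+2%:R :> R by rewrite (ler_nat R 30).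
  apply: le_trans.
    by apply: (@wasserstein_mallows_stein m R q false hq _ _ _ _ hZ _ _ P w hw
      (1 / 3) (1 / 2) M) => //; lra.
  rewrite lee_fin ler_pM2r ?invr_gt0 ?sqrtr_gt0 ?ltr0n//; lra.
Qed.
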